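(* Let $D = \alpha(\infty)$ be a $1$-point divisor. Denote the generators of type (a) by \[ f_i = u^{d_i} t_{c_i}, \quad i = 0, 2, 3, \ldots, r, \] and denote the exceptional generators of types (b), (c), and (d) by $f_{(b)}$, $f_{(c)}$, and $f_{(d)}$, respectively. Then, with respect to the term order described below, a Gr\''obner basis of the relations of $S_D$ has the following leading terms: \begin{enumerate} \item All products $f_i f_j$, where $3 \leq i \leq r, 0 \leq j \leq i - 2, j \neq 1$, except possibly $f_3 f_0$ (see below); \item All products $f_i f_{(b)}$, $f_i f_{(c)}$, and $f_i f_{(d)}$, where $3 \leq i \leq r$, if these exceptional generators exist; \item Additional relations, according to the value of $\{-1/\alpha\}$ which also controls the generators: \[ \begin{tabular}{c|l|l} $\{-1/\alpha\} \in$ & Exc.\ gens. & Leading terms of relations \\ \hline $\{0\}$ & $f_{(b)}, f_{(c)}$ & $f_{(c)}^2$ \\ $(0,1/3)$ & $f_{(b)}, f_{(c)}, f_{(d)}$ & $f_{(c)}^2, f_{(b)} f_{(d)}, f_{(c)} f_{(d)}, f_{(d)}^2, f_0f_{(d)}, f_0f_2$ \\ $[1/3, 1/2)$ & $f_{(b)}, f_{(d)}$ & $\boxed{f_0^2f_2^2}, f_0f_{(d)}, f_{(b)} f_{(d)}, f_{(d)}^2$ \\ $[1/2, 2/3)$ & $f_{(c)}$ & $f_{(c)}^2$ \\ $[2/3, 1)$ & --- & $\boxed{f_0f_3^2}$, omit $f_0f_3$ \end{tabular} \] \end{enumerate} Moreover, the relations comprising the Gr\''obner basis are all minimal, with the possible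 exception of the two boxed ones: \begin{itemize} \item The relation with the quartic leading term $f_0^2 f_2^2$ is never minimal. \item The relation with the cubic leading term $f_0 f_3^2$ is minimal if and only if $\{-1/\alpha\}$ belongs to the subinterval $[2/3, 3/4)$. \end{itemize}
   Context: Let $C$ be an elliptic curve over an algebraically closed field $k$, $\infty\in C$ a point, $t_c$ ($c\in\{0\}\cup\mathbb{Z}_{\ge2}$) a function with polar divisor $c(\infty)$, and $S_D=\bigoplus_{d\ge0}u^dH^0(dD)$ the section ring of $D=\alpha(\infty)$, $\alpha>0$ rational. Let $0=c_0/d_0<c_1/d_1<\cdots<c_r/d_r=\alpha$ be the best lower approximations to $\alpha$, and $\{x\}$ the fractional part. $S_D$ is minimally generated by $f_v=t_cu^d$ for: (a) $(d,c)=(d_i,c_i)$, $i\ne1$; (b) $(\lceil 2/\alpha\rceil,2)$ if $\{-1/\alpha\}\in[0,1/2)$; (c) $(\lceil3/\alpha\rceil,3)$ if $\{-1/\alpha\}\in[0,1/3)\cup[1/2,2/3)$; (d) $(d_1+d_2,c_1+c_2)$ if $\{-1/\alpha\}\in(0,1/2)$. Write $v_i=(d_i,c_i)$ for the corresponding lattice points. Term order: generators are ordered by increasing degree $d$, then increasing pole order $c$, giving $f_0\prec f_{(b)}\prec f_{(c)}$ if $\{-1/\alpha\}=0$; $f_0\prec f_{(b)}\prec f_{(c)}\prec f_2\prec f_{(d)}\prec f_3\prec\cdots$ if $\{-1/\alpha\}\in(0,1/3)$; $f_0\prec f_{(b)}\prec f_2\prec f_{(d)}\prec f_3\prec\cdots$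 if in $[1/3,1/2)$; $f_0\prec f_2\prec f_{(c)}\prec f_3\prec\cdots$ if in $[1/2,2/3)$; $f_0\prec f_2\prec f_3\prec\cdots$ if in $[2/3,1)$. Monomials $\prod f_i^{a_i}$ are compared first by total degree $\sum a_id_i$, then by total pole order $\sum a_ic_i$, then by the exponents of the generators starting from the highest generator (larger exponent of the highest differing generator is larger). *)

(* Defs.v *)
(* The curve C is given by its function field K over k: the points of
   a smooth projective curve over an algebraically closed field are the places
   of its function field, so every place has degree 1. *)
From HB Require Import structures.
From mathcomp Require Import all_boot all_order all_algebra.
From mathcomp Require Import boolp.
From mathcomp Require Import freeg mpoly.

Set Implicit Arguments.
Unset Strict Implicit.
Unset Printing Implicit Defensive.

Import Order.TTheory GRing.Theory Num.Theory.
Local Open Scope ring_scope.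

(* [ord 0] stands for +oo, but is given the junk value 0, so that distinct
   places have distinct functions [ord]. *)
Record place (k K : fieldType) (iota : {rmorphism k -> K}) := Place {
  ord : K -> int;
  ord0 : ord 0 = 0;
  ordM : forall f g, f != 0 -> g != 0 -> ord (f * g) = ord f + ord g;
  ordD : forall f g, f != 0 -> g != 0 -> f + g != 0 ->
    Num.min (ord f) (ord g) <= ord (f + g);
  ordC : forall a, a != 0 -> ord (iota a) = 0;
  ord_surj : exists2 f, f != 0 & ord f = 1
}.

HB.instance Definition _ (k K : fieldType) (iota : {rmorphism k -> K}) :=
  gen_eqMixin (place iota).
HB.instance Definition _ (k K : fieldType) (iota : {rmorphism k -> K}) :=
  gen_choiceMixin (place iota).

Section FunctionField.

Context (k : closedFieldType) (K : fieldType) (iota : {rmorphism k -> K}).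

Definition in_simple_ext (x z : K) : Prop :=
  exists p q : {poly k},
    (map_poly iota q).[x] != 0 /\
    z = (map_poly iota p).[x] / (map_poly iota q).[x].

Definition function_field : Prop :=
  exists x : K, ~ algebraicOver iota x /\
    exists n (e : 'I_n -> K), forall z, exists a : 'I_n -> K,
      (forall i, in_simple_ext x (a i)) /\ z = \sum_(i < n) a i * e i.

Definition RR (a : place iota -> int) (f : K) : Prop :=
  f != 0 -> forall P, - a P <= ord P f.

Definition L (D : {freeg (place iota) / int}) : K -> Prop :=
  RR (fun P => coeff P D).

Definition H0 (D : {freeg (place iota) / rat}) : K -> Prop :=
  RR (fun P => Num.floor (coeff P D)).

Definition has_dim (V : K -> Prop) (n : nat) : Prop :=
  exists e : 'I_n -> K, (forall i, V (e i)) /\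
    forall f, V f ->
      exists! a : {ffun 'I_n -> k}, f = \sum_(i < n) iota (a i) * e i.

(* g = max_D (deg D - dim L(D) + 1); the first clause also records that every
   L(D) is finite-dimensional. *)
Definition has_genus (g : int) : Prop :=
  (forall D, exists n : nat, has_dim (L D) n /\ deg D - n%:Z + 1 <= g) /\
  (exists D (n : nat), has_dim (L D) n /\ deg D - n%:Z + 1 = g).

Definition elliptic_function_field : Prop :=
  function_field /\ has_genus 1.

Definition has_polar_divisor (f : K) (E : {freeg (place iota) / int}) : Prop :=
  f != 0 /\ forall P, coeff P E = Num.max 0 (- ord P f).

End FunctionField.

(* The section ring S_D, as a subring of K[u]; u is written 'X. *)
Section SectionRing.

Context (k : closedFieldType) (K : fieldType) (iota : {rmorphism k -> K}).

Definition sections (D : {freeg (place iota) / rat}) : {pred {poly K}} :=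
  fun s => `[< forall d : nat, H0 (D *+ d) s`_d >].

Lemma ord1 (P : place iota) : ord P 1 = 0.
Proof. by rewrite -(rmorph1 iota) ordC ?oner_neq0. Qed.

Lemma ordN (P : place iota) f : ord P (- f) = ord P f.
Proof.
have [->|f0] := eqVneq f 0; first by rewrite oppr0.
have nz1 : (-1 : k) != 0 by rewrite oppr_eq0 oner_neq0.
by rewrite -mulN1r ordM ?oppr_eq0 ?oner_neq0 // -(rmorphN1 iota) ordC // add0r.
Qed.

Lemma RR_0 (a : place iota -> int) : RR a 0.
Proof. by rewrite /RR eqxx. Qed.

Lemma RR_D (a : place iota -> int) f g : RR a f -> RR a g -> RR a (f + g).
Proof.
move=> Hf Hg; have [->|f0] := eqVneq f 0; first by rewrite add0r.
have [->|g0] := eqVneq g 0; first by rewrite addr0.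
move=> fg0 P; apply: le_trans (ordD P f0 g0 fg0).
by rewrite le_min (Hf f0 P) (Hg g0 P).
Qed.

Lemma RR_N (a : place iota -> int) f : RR a f -> RR a (- f).
Proof. by move=> Hf; rewrite /RR oppr_eq0 => f0 P; rewrite ordN; apply: Hf. Qed.

Lemma H0_M (D : {freeg (place iota) / rat}) i j f g :
  H0 (D *+ i) f -> H0 (D *+ j) g -> H0 (D *+ (i + j)) (f * g).
Proof.
move=> Hf Hg; rewrite /H0 /RR mulf_eq0 negb_or => /andP[f0 g0] P.
rewrite ordM //; apply: le_trans (lerD (Hf f0 P) (Hg g0 P)).
rewrite -opprD lerN2 floor_ge_int intrD mulrnDr coeffD.
by apply: lerD; apply: floor_le.
Qed.

Lemma H0_C (a : k) : H0 (0 : {freeg (place iota) / rat}) (iota a).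
Proof. by move=> a0 P; rewrite coeff0 floor0 oppr0 ordC // -(fmorph_eq0 iota). Qed.

Lemma sections_subring D : subring_closed (sections D).
Proof.
split=> [|s s' /asboolP Hs /asboolP Hs'|s s' /asboolP Hs /asboolP Hs'];
  apply/asboolP => d.
- rewrite coef1; case: eqP => [->|_]; last exact: RR_0.
  by rewrite mulr0n -(rmorph1 iota); exact: H0_C.
- by rewrite coefB; apply: RR_D (Hs d) (RR_N (Hs' d)).
- rewrite coefM; elim/big_ind: _ => [|x y|i _]; [exact: RR_0|exact: RR_D|].
  by rewrite -[X in D *+ X](subnKC (ltn_ord i : i <= d)%N); apply: H0_M.
Qed.

HB.instance Definition _ D :=
  GRing.isSubringClosed.Build {poly K} (sections D) (sections_subring D).

Record section_ring (D : {freeg (place iota) / rat}) := SectionRing {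
  section_val :> {poly K};
  section_valP : section_val \in sections D
}.

HB.instance Definition _ D := [isSub for @section_val D].
HB.instance Definition _ D := [Choice of section_ring D by <:].
HB.instance Definition _ D :=
  [SubChoice_isSubComNzRing of section_ring D by <:].

Lemma const_subproof D (a : k) : (iota a)%:P \in sections D.
Proof.
apply/asboolP => d; rewrite coefC; case: eqP => [->|_]; last exact: RR_0.
by rewrite mulr0n; exact: H0_C.
Qed.

Definition section_const D (a : k) : section_ring D :=
  SectionRing (const_subproof D a).

Lemma section_const_is_zmod D : zmod_morphism (section_const D).
Proof. by move=> a b; apply: val_inj; rewrite /= !rmorphB. Qed.

Lemma section_const_is_monoid D : monoid_morphism (section_const D).
Proof.
by split=> [|a b]; apply: val_inj; rewrite /= ?rmorph1 ?rmorphM.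
Qed.

HB.instance Definition _ D :=
  GRing.isZmodMorphism.Build k (section_ring D) (section_const D)
    (section_const_is_zmod D).
HB.instance Definition _ D :=
  GRing.isMonoidMorphism.Build k (section_ring D) (section_const D)
    (section_const_is_monoid D).

(* u^d t_c for the lattice point v = (d, c); the default value 0 of [insubd]
   is only taken when u^d t_c is not in S_D. *)
Definition section_gen D (t : nat -> K) (v : nat * nat) : section_ring D :=
  insubd 0 (t v.2 *: 'X^(v.1)).

(* The kernel of k[x_1, ..., x_n] -> S_D. *)
Definition relations D n (f : 'I_n -> section_ring D) (p : {mpoly k[n]}) :
  Prop := mmap (section_const D) f p = 0.

End SectionRing.

(* Lattice points are pairs (d, c), standing for the fraction c / d. *)

Definition slope (v : nat * nat) : rat := v.2%:R / v.1%:R.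

(* No fraction of strictly smaller denominator is a strictly better lower bound;
   for alpha >= 1 this admits the integers 0/1, 1/1, 2/1, ... up to alpha. *)
Definition best_lower_approx (alpha : rat) (v : nat * nat) : Prop :=
  [/\ (0 < v.1)%N, coprime v.1 v.2, slope v <= alpha &
      forall w : nat * nat, (0 < w.1 < v.1)%N -> slope w <= alpha ->
        slope w <= slope v].

Definition best_lower_approxs (alpha : rat) (v : seq (nat * nat)) : Prop :=
  sorted (fun x y => slope x < slope y) v /\
  (forall x, x \in v <-> best_lower_approx alpha x).

(* {-1/alpha} *)
Definition theta (alpha : rat) : rat :=
  - alpha^-1 - (Num.floor (- alpha^-1))%:~R.

Section Generators.

Context (alpha : rat) (v : seq (nat * nat)).

Definition pt (i : nat) : nat * nat := nth (0, 0)%N v i.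

Definition ptb : nat * nat := (`|Num.ceil (2 / alpha)|%N, 2%N).
Definition ptc : nat * nat := (`|Num.ceil (3 / alpha)|%N, 3%N).
Definition ptd : nat * nat := ((pt 1).1 + (pt 2).1, (pt 1).2 + (pt 2).2)%N.

Definition has_b : bool := 0 <= theta alpha < 1 / 2.
Definition has_c : bool :=
  (0 <= theta alpha < 1 / 3) || (1 / 2 <= theta alpha < 2 / 3).
Definition has_d : bool := 0 < theta alpha < 1 / 2.

Definition exceptional : seq (nat * nat) :=
  (if has_b then [:: ptb] else [::]) ++
  (if has_c then [:: ptc] else [::]) ++
  (if has_d then [:: ptd] else [::]).

Definition point_le (x y : nat * nat) : bool :=
  (x.1 < y.1)%N || (x.1 == y.1) && (x.2 <= y.2)%N.

Definition generators : seq (nat * nat) :=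
  sort point_le (pt 0 :: drop 2 v ++ exceptional).

(* A product of generators is given as the list of their lattice points. *)
Definition leading_terms : seq (seq (nat * nat)) :=
  [seq [:: pt i; pt j] | i <- iota 3 (size v - 3),
     j <- [seq j <- iota 0 (i - 1) |
             (j != 1)%N && ~~ [&& i == 3, j == 0 & 2 / 3 <= theta alpha]]]
  ++ [seq [:: pt i; e] | i <- iota 3 (size v - 3), e <- exceptional]
  ++ (if theta alpha == 0 then
        [:: [:: ptc; ptc]]
      else if theta alpha < 1 / 3 then
        [:: [:: ptc; ptc]; [:: ptb; ptd]; [:: ptc; ptd]; [:: ptd; ptd];
            [:: pt 0; ptd]; [:: pt 0; pt 2]]
      else if theta alpha < 1 / 2 then
        [:: [:: pt 0; pt 0; pt 2; pt 2]; [:: pt 0; ptd]; [:: ptb; ptd];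
            [:: ptd; ptd]]
      else if theta alpha < 2 / 3 then
        [:: [:: ptc; ptc]]
      else
        [:: [:: pt 0; pt 3; pt 3]]).

End Generators.

Section TermOrder.

Context (gens : seq (nat * nat)).
Local Notation n := (size gens).

(* The product of the generators listed in s, with multiplicity. *)
Definition monom (s : seq (nat * nat)) : 'X_{1..n} :=
  [multinom count_mem (nth (0, 0)%N gens i) s | i < n].

Definition total_degree (m : 'X_{1..n}) : nat :=
  (\sum_(i < n) m i * (nth (0, 0) gens i).1)%N.
Definition total_pole_order (m : 'X_{1..n}) : nat :=
  (\sum_(i < n) m i * (nth (0, 0) gens i).2)%N.

Definition mon_key (m : 'X_{1..n}) : seqlexi nat :=
  [:: total_degree m, total_pole_order m & rev [seq m i | i <- enum 'I_n]].

Definition mon_le (m m' : 'X_{1..n}) : bool := (mon_key m <= mon_key m')%O.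

Definition lead_mon (k : ringType) (p : {mpoly k[n]}) : 'X_{1..n} :=
  last 0%MM (sort mon_le (msupp p)).

Definition homogeneous (k : ringType) (p : {mpoly k[n]}) : Prop :=
  {in msupp p &, forall m m', total_degree m = total_degree m'}.

Definition groebner_basis (k : ringType) (I : {mpoly k[n]} -> Prop)
    (G : seq {mpoly k[n]}) : Prop :=
  {in G, forall g, g != 0 /\ I g} /\
  (forall p, p != 0 -> I p ->
     exists2 g, g \in G & (lead_mon g <= lead_mon p)%MM).

End TermOrder.

Section Minimality.

Context (k : ringType) (n : nat).

Definition ideal_gen (A : {mpoly k[n]} -> Prop) (p : {mpoly k[n]}) : Prop :=
  exists s : seq ({mpoly k[n]} * {mpoly k[n]}),
    {in s, forall x, A x.2} /\ p = \sum_(x <- s) x.1 * x.2.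

(* g is in I but not in m I, where m = (x_1, ..., x_n) and I is an ideal. *)
Definition minimal_relation (I : {mpoly k[n]} -> Prop) (g : {mpoly k[n]}) :
  Prop :=
  I g /\ ~ exists q : 'I_n -> {mpoly k[n]},
             (forall i, I (q i)) /\ g = \sum_(i < n) 'X_i * q i.

Definition minimal_generating_set (I A : {mpoly k[n]} -> Prop) : Prop :=
  (forall p, I p <-> ideal_gen A p) /\
  (forall g, A g -> ~ ideal_gen (fun h => A h /\ h <> g) g).

End Minimality.

(* Main.v *)
(* A function regular off oo has pole order 0, 2, 3, ... at oo and, the residue
   fields being k, is determined by its pole order c up to a scalar and functions
   of smaller pole order. So a monomial contributes to S_D at the lattice point
   (d, c) of its degree and pole order, and every point below the line of slope
   alpha with c <> 1 carries exactly one standard monomial, its normal form: the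
   best lower approximations cut the cone into unimodular cones, and the finitely
   many exceptional generators fill in the cone of slope at most c_2 / d_2. Each
   leading term M thus yields a relation M - a N - (smaller pole orders), with N
   the normal form at the same point, and these relations are a Groebner basis.
   They are minimal when no relation has a term strictly dividing M. The boxed
   relations are f_0 R(f_b f_d) - f_b R(f_0 f_d) and, when theta >= 3/4,
   f_0 R(f_2 f_4) - f_2 R(f_0 f_4), where R(M) is the relation with lead M; when
   theta < 3/4, f_0 f_3^2 has the smallest degree among all leading terms. *)
Require Import Defs.
From HB Require Import structures.
From mathcomp Require Import all_boot all_order all_algebra.
From mathcomp Require Import boolp.
From mathcomp Require Import freeg mpoly.
From mathcomp Require Import zify ring lra.

Set Implicit Arguments.
Unset Strict Implicit.
Unset Printing Implicit Defensive.

Import Order.TTheory GRing.Theory Num.Theory.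
Local Open Scope ring_scope.

(** The curve enters only through its valuations and a genus defined as a maximum over divisors, so
    two inputs of the overview need an argument. Residue fields are k because any two functions are
    algebraically dependent over k. Pole order 1 is absent because a function x with a simple pole
    at oo would make all places linearly equivalent to oo; the powers of x would then give L(D)
    dimension at least deg D + 1 for a divisor D attaining the maximum 1, where the dimension is deg
    D. Standard monomials are compared with explicit normal forms: standard monomials are normal, a
    lattice point carries one normal form, and a lead exceeds the normal form at its point. Repeated
    replacement of leads then makes a standard monomial the least one at its point, so its pole
    cannot be cancelled by smaller terms. Minimality rests on best approximation: p i has larger
    slope than every point of smaller degree under the line, so no product of several generators in
    its degree reaches its pole order. Exceptional generators are checked range by range. *)

Lemma exists_linear_relation (F : fieldType) (T S : finType) (A : T -> S -> F) :
  (#|S| < #|T|)%N ->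
  exists2 c : T -> F, exists t, c t != 0 & forall s, \sum_t c t * A t s = 0.
Proof.
move=> ltST.
pose M := \matrix_(i < #|T|, j < #|S|) A (enum_val i) (enum_val j).
have: kermx M != 0.
  rewrite -mxrank_eq0 mxrank_ker -lt0n subn_gt0.
  exact: leq_ltn_trans (rank_leq_col M) ltST.
case/rowV0Pn => r /sub_kermxP rM r0.
exists (fun t => r 0 (enum_rank t)).
  case/rV0Pn: r0 => i ri; exists (enum_val i); by rewrite enum_valK.
move=> s; have /rowP /(_ (enum_rank s)) := rM.
rewrite !mxE => {2}<-; rewrite (reindex_onto enum_rank enum_val) => [|i _]; last first.
  exact: enum_valK.
apply: eq_big => [t|t _]; first by rewrite enum_rankK eqxx.
by rewrite mxE !enum_rankK.
Qed.

(** * Places *)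

Section Places.
Context (k : closedFieldType) (K : fieldType) (iota : {rmorphism k -> K}).
Implicit Types (P : place iota) (f g : K).

Lemma ordX P f n : f != 0 -> ord P (f ^+ n) = ord P f *+ n.
Proof.
move=> f0; elim: n => [|n IH]; first by rewrite expr0 mulr0n Defs.ord1.
by rewrite exprS ordM ?expf_neq0 // IH mulrS.
Qed.

Lemma ordV P f : f != 0 -> ord P f^-1 = - ord P f.
Proof.
move=> f0; apply/eqP; rewrite -addr_eq0 -ordM ?invr_eq0 //.
by rewrite mulVf // Defs.ord1.
Qed.

Lemma ordXz P f (n : int) : f != 0 -> ord P (f ^ n) = ord P f * n.
Proof.
move=> f0; case: n => n; first by rewrite -exprnP ordX // -mulr_natr natz.
rewrite NegzE -invr_expz -exprnP ordV ?expf_neq0 // ordX // mulrN -mulr_natr natz.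
by [].
Qed.

Lemma ord_prod P (I : Type) (r : seq I) (F : I -> K) :
  (forall i, F i != 0) -> ord P (\prod_(i <- r) F i) = \sum_(i <- r) ord P (F i).
Proof.
move=> F0; suff [] : \prod_(i <- r) F i != 0 /\
  ord P (\prod_(i <- r) F i) = \sum_(i <- r) ord P (F i) by [].
elim: r => [|i r [nz IH]]; first by rewrite !big_nil Defs.ord1 oner_neq0.
by rewrite !big_cons ordM // IH mulf_neq0.
Qed.

Lemma ord_scale P a f : a != 0 -> ord P (iota a * f) = ord P f.
Proof.
move=> a0; have [->|f0] := eqVneq f 0; first by rewrite mulr0.
by rewrite ordM ?fmorph_eq0 // ordC // add0r.
Qed.

Definition ord_ge P (a : int) f := f != 0 -> a <= ord P f.

Lemma ord_ge0 P a : ord_ge P a 0. Proof. by rewrite /ord_ge eqxx. Qed.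

Lemma ord_geD P a f g : ord_ge P a f -> ord_ge P a g -> ord_ge P a (f + g).
Proof.
move=> Hf Hg; have [->|f0] := eqVneq f 0; first by rewrite add0r.
have [->|g0] := eqVneq g 0; first by rewrite addr0.
move=> fg0; apply: le_trans (ordD P f0 g0 fg0).
by rewrite le_min Hf // Hg.
Qed.

Lemma ord_geZ P a c f : ord_ge P a f -> ord_ge P a (iota c * f).
Proof.
move=> Hf; have [->|c0] := eqVneq c 0; first by rewrite rmorph0 mul0r; exact: ord_ge0.
by rewrite /ord_ge ord_scale // mulf_eq0 fmorph_eq0 (negPf c0).
Qed.

Lemma ord_geN P a f : ord_ge P a f -> ord_ge P a (- f).
Proof. by rewrite /ord_ge ordN oppr_eq0. Qed.

Lemma ord_ge_sum P a (I : Type) (r : seq I) (Q : pred I) (F : I -> K) :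
  (forall i, Q i -> ord_ge P a (F i)) -> ord_ge P a (\sum_(i <- r | Q i) F i).
Proof.
by move=> H; apply: big_ind => //; [exact: ord_ge0 | exact: ord_geD].
Qed.

(** Among the terms with nonzero coefficient, the one of least order cannot be cancelled by the
    others, whose sum has strictly larger order. *)
Lemma distinct_ord_free P (I : finType) (z : I -> K) (c : I -> k) :
  (forall i, z i != 0) -> injective (fun i => ord P (z i)) ->
  \sum_i iota (c i) * z i = 0 -> forall i, c i = 0.
Proof.
move=> z0 inj_z sum0 i0; apply/eqP/negPn/negP => ci0.
case: (@Order.TotalTheory.arg_minP _ _ _ i0 (fun i => c i != 0) (fun i => ord P (z i))) =>
  // i ci Hi.
move: sum0; rewrite (bigD1 i) //= => /eqP; rewrite addr_eq0 => /eqP E.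
have: ord_ge P (ord P (z i) + 1) (iota (c i) * z i).
  rewrite E; apply: ord_geN; apply: ord_ge_sum => j ji.
  have [->|cj] := eqVneq (c j) 0; first by rewrite rmorph0 mul0r; exact: ord_ge0.
  apply: ord_geZ => _; rewrite -lezD1 lerD2r || rewrite lezD1.
  by rewrite lt_neqAle Hi // andbT; apply: contra ji => /eqP /inj_z ->.
rewrite /ord_ge ord_scale // mulf_eq0 fmorph_eq0 negb_or ci z0 => /(_ isT).
by rewrite -{2}[ord P (z i)]addr0 lerD2l.
Qed.

End Places.

(** * Algebraic dependence of two functions over k *)

Section AlgebraicDependence.
Context (k : closedFieldType) (K : fieldType) (iota : {rmorphism k -> K}).
Context (x : K) (n : nat) (e : 'I_n -> K).
Local Notation ev q := (map_poly iota q).[x].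

(** A filtration of the k[x]-span of the [e l] by the degree of the coefficients: [W M] is spanned
    by n (M + 1) elements, so its dimension grows linearly in M. *)
Let W (M : nat) (z : K) := exists2 C : 'I_n -> {poly k},
  forall l, (size (C l) <= M.+1)%N & z = \sum_l ev (C l) * e l.

Let WD M z w : W M z -> W M w -> W M (z + w).
Proof.
case=> C HC -> [C' HC' ->]; exists (fun l => C l + C' l) => [l|].
  by apply: leq_trans (size_polyD _ _) _; rewrite geq_max HC HC'.
by rewrite -big_split; apply: eq_bigr => l _ /=; rewrite rmorphD hornerD mulrDl.
Qed.

Let W0 M : W M 0.
Proof.
exists (fun=> 0) => [l|]; first by rewrite size_poly0.
by rewrite big1 // => l _; rewrite rmorph0 horner0 mul0r.
Qed.

Let WM M D (q : {poly k}) z : (size q <= D.+1)%N -> W M z -> W (D + M) (ev q * z).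
Proof.
move=> Hq [C HC ->]; exists (fun l => q * C l) => [l|].
  apply: leq_trans (size_polyMleq _ _) _; move: (HC l) Hq.
  by case: (size q) (size _) => [|a] [|b] //=; lia.
by rewrite mulr_sumr; apply: eq_bigr => l _; rewrite rmorphM hornerM mulrA.
Qed.

Let Wmono M M' z : (M <= M')%N -> W M z -> W M' z.
Proof. by move=> MM [C HC ->]; exists C => // l; apply: leq_trans (HC l) _. Qed.

Context (span_e : forall z, exists a : 'I_n -> K,
      (forall i, in_simple_ext iota x (a i)) /\ z = \sum_(i < n) a i * e i).

Let denom1 z : exists2 q : {poly k}, ev q != 0 & exists M, W M (ev q * z).
Proof.
have [a [Ha ->]] := span_e z.
have /cid [p /cid [q Hpq]] : exists p q : 'I_n -> {poly k}, forall i,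
  ev (q i) != 0 /\ a i = ev (p i) / ev (q i).
  exists (fun i => sval (cid (Ha i))), (fun i => sval (cid (svalP (cid (Ha i))))) => i.
  exact: (svalP (cid (svalP (cid (Ha i))))).
exists (\prod_i q i).
  by rewrite rmorph_prod horner_prod; apply/prodf_neq0 => i _; case: (Hpq i).
exists (\max_i size (p i * \prod_(j | j != i) q j)%R)%N.
exists (fun i => p i * \prod_(j | j != i) q j) => [l|].
  by apply: leqW; apply: leq_bigmax.
rewrite mulr_sumr; apply: eq_bigr => i _; have [qi ->] := Hpq i.
rewrite (bigD1 i) //= !rmorphM !hornerM /=.
set u := ev (\prod_(j | _) _); move: qi; set v := ev (q i) => qi.
by field.
Qed.

Let denom (s : seq K) : exists2 q : {poly k}, ev q != 0 &
  exists2 D, (size q <= D.+1)%N & forall z, z \in s -> W D (ev q * z).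
Proof.
elim: s => [|z s [q q0 [D Dq HD]]].
  exists 1; first by rewrite rmorph1 hornerC oner_neq0.
  by exists 0%N => //; rewrite size_poly1.
have [q' q'0 [M HM]] := denom1 z.
exists (q' * q); first by rewrite rmorphM hornerM mulf_neq0.
exists (size q' + size q + D + M)%N.
  apply: leq_trans (size_polyMleq _ _) _; lia.
move=> w; rewrite inE rmorphM hornerM => /orP[/eqP ->|ws].
  rewrite [_ * ev q]mulrC -mulrA; apply: Wmono (WM Dq HM).
  lia.
rewrite -mulrA; apply: Wmono (WM (leqnSn _) (HD w ws)); lia.
Qed.

(** There are N^2 monomials s^i f^j with i, j < N. After multiplication by one power of a common
    denominator they all lie in [W M] with M linear in N, so for large N they outnumber the
    dimension. *)
Lemma algebraically_dependent (s f : K) : exists N (c : 'I_N -> 'I_N -> k),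
  (exists i j, c i j != 0) /\
  \sum_i \sum_j iota (c i j) * (s ^+ i * f ^+ j) = 0.
Proof.
(* q clears the denominators of 1 and of multiplication by s and by f on the [e l]; each further
   factor s or f thus costs one factor q and raises the filtration level by D. *)
have [q q0 [D Dq HD]] := denom (1 :: [seq s * e l | l <- enum 'I_n] ++ [seq f * e l | l <- enum
  'I_n]).
have Wmul y M z : (forall l, W D (ev q * (y * e l))) -> W M z -> W (M + D) (ev q * (y * z)).
  move=> Hy [C HC ->]; rewrite !mulr_sumr.
  apply: big_ind; [exact: W0 | exact: WD | move=> l _].
  have -> : ev q * (y * (ev (C l) * e l)) = ev (C l) * (ev q * (y * e l)) by ring.
  exact: WM.
have Ws l : W D (ev q * (s * e l)).
  by apply: HD; rewrite in_cons mem_cat (map_f (fun l => s * e l)) ?mem_enum ?orbT.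
have Wf l : W D (ev q * (f * e l)).
  by apply: HD; rewrite in_cons mem_cat (map_f (fun l => f * e l)) ?mem_enum ?orbT.
have Wq z M i : W M z -> W (M + D * i) (ev q ^+ i * z).
  move=> Hz; elim: i => [|i IH]; first by rewrite expr0 mul1r muln0 addn0.
  rewrite exprS -mulrA; apply: Wmono (WM Dq IH); lia.
have Wmon i j : W (D * (i + j).+1) (ev q ^+ (i + j).+1 * (s ^+ i * f ^+ j)).
  elim: i => [|i IH]; last first.
    have -> : ev q ^+ (i.+1 + j).+1 * (s ^+ i.+1 * f ^+ j) =
      ev q * (s * (ev q ^+ (i + j).+1 * (s ^+ i * f ^+ j))).
      by rewrite addSn [ev q ^+ _.+2]exprS [s ^+ i.+1]exprS; ring.
    apply: Wmono (Wmul _ _ _ Ws IH); lia.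
  elim: j => [|j IH]; last first.
    have -> : ev q ^+ (0 + j.+1).+1 * (s ^+ 0 * f ^+ j.+1) =
      ev q * (f * (ev q ^+ (0 + j).+1 * (s ^+ 0 * f ^+ j))).
      by rewrite addnS [ev q ^+ _.+2]exprS [f ^+ j.+1]exprS; ring.
    apply: Wmono (Wmul _ _ _ Wf IH); lia.
  rewrite !expr0 mulr1 addn0 muln1 expr1; apply: HD; by rewrite inE eqxx.
(* Large enough for N^2 to exceed n (M + 1), where M = D (2 N + 1) is the level reached with the
   uniform exponent 2 N + 1 of the denominator. *)
pose N := (2 * n * D.+1).+1.
pose M := (D * (2 * N).+1)%N.
have Wmon' (ij : 'I_N * 'I_N) : W M (ev q ^+ (2 * N).+1 * (s ^+ ij.1 * f ^+ ij.2)).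
  case: ij => i j /=; have := Wq _ _ (2 * N - (i + j))%N (Wmon i j).
  rewrite mulrA -exprD; have -> : (2 * N - (i + j) + (i + j).+1 = (2 * N).+1)%N.
    by move: (ltn_ord i) (ltn_ord j); lia.
  apply: Wmono; rewrite -mulnDr /M; apply: leq_mul => //.
  by move: (ltn_ord i) (ltn_ord j); lia.
have Wmon2 (ij : 'I_N * 'I_N) : exists C : 'I_n -> {poly k}, (forall l, (size (C l) <= M.+1)%N) /\
   ev q ^+ (2 * N).+1 * (s ^+ ij.1 * f ^+ ij.2) = \sum_l ev (C l) * e l.
  by have [C C1 C2] := Wmon' ij; exists C.
pose C ij := sval (cid (Wmon2 ij)).
have HC ij := svalP (cid (Wmon2 ij)).
have [|c [[i j] cij] Hc] := @exists_linear_relation k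
  ('I_N * 'I_N)%type ('I_n * 'I_M.+1)%type (fun ij lm => (C ij lm.1)`_lm.2).
  rewrite !card_prod !card_ord /M /N; nia.
exists N, (fun i j => c (i, j)); split; first by exists i, j.
apply: (mulfI (expf_neq0 (2 * N).+1 q0)); rewrite mulr0.
rewrite pair_bigA /= mulr_sumr.
transitivity (\sum_(ij : 'I_N * 'I_N) \sum_l ev (c ij *: C ij l) * e l).
  apply: eq_bigr => ij _; rewrite mulrCA -surjective_pairing.
  rewrite (proj2 (HC ij)) mulr_sumr; apply: eq_bigr => l _.
  by rewrite linearZ /= hornerZ mulrA.
rewrite exchange_big big1 //= => l _; rewrite -mulr_suml.
rewrite -horner_sum -rmorph_sum.
suff -> : \sum_ij c ij *: C ij l = 0 by rewrite rmorph0 horner0 mul0r.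
apply/polyP => m; rewrite coef_sum coef0.
have [mM|Mm] := ltnP m M.+1; last first.
  apply: big1 => ij _; rewrite coefZ nth_default ?mulr0 //.
  exact: leq_trans (proj1 (HC ij) l) Mm.
rewrite -[RHS](Hc (l, Ordinal mM)); by apply: eq_bigr => ij _; rewrite coefZ.
Qed.

End AlgebraicDependence.

(** * Functions with poles at a single place of an elliptic function field *)

Section EllipticFunctionField.
Context (k : closedFieldType) (K : fieldType) (iota : {rmorphism k -> K}).
Implicit Types (P : place iota) (f g : K).

Lemma ord_geM P a b f g : ord_ge P a f -> ord_ge P b g -> ord_ge P (a + b) (f * g).
Proof.
move=> Hf Hg; rewrite /ord_ge mulf_eq0 negb_or => /andP[f0 g0].
by rewrite ordM // lerD // ?Hf ?Hg.
Qed.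

Lemma ord_ge_const P a : ord_ge P 0 (iota a).
Proof. by rewrite /ord_ge fmorph_eq0 => a0; rewrite ordC. Qed.

Lemma ord_ge_horner P (q : {poly k}) f :
  ord_ge P 0 f -> ord_ge P 0 (map_poly iota q).[f].
Proof.
move=> Hf; elim/poly_ind: q => [|q c IH]; first by rewrite rmorph0 horner0; exact: ord_ge0.
rewrite rmorphD rmorphM /= map_polyX map_polyC hornerMXaddC.
by apply: ord_geD; [rewrite -[0]addr0; apply: ord_geM | exact: ord_ge_const].
Qed.

(* Since K has transcendence degree 1 over k, f satisfies an equation
   Q(s, f) = 0 with Q(0, Y) <> 0, where s is a uniformizer at P; so f mod P is
   algebraic over k. *)
Lemma exists_residue P f : function_field iota -> ord_ge P 0 f ->
  exists a, ord_ge P 1 (f - iota a).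
Proof.
move=> [x [_ [n [e span_e]]]] Hf.
have [s s0 ords] := ord_surj P.
have [N [c [[i1 [j1 cij]] rel]]] := algebraically_dependent span_e s f.
pose Q i : {poly k} := \sum_(j < N) (c i j)%:P * 'X^j.
have QE i (j : 'I_N) : (Q i)`_j = c i j.
  rewrite coef_sum (bigD1 j) //= coefCM coefXn eqxx mulr1 big1 ?addr0 // => l lj.
  by rewrite coefCM coefXn -val_eqE eq_sym in lj *; rewrite (negPf lj) mulr0.
have Qi1 : Q i1 != 0 by apply/eqP => /polyP /(_ j1); rewrite QE coef0; apply/eqP.
(* For the least i with Q i nonzero, the term s^i (Q i)(f) is minus a sum of terms of order at least
   i + 1; so (Q i)(f) has positive order. *)
case: (@arg_minnP _ i1 (fun i => Q i != 0) (fun i => i : nat) Qi1) => i Qi Hmin.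
have relQ : \sum_(l < N) s ^+ l * (map_poly iota (Q l)).[f] = 0.
  rewrite -[RHS]rel; apply: eq_bigr => l _.
  rewrite rmorph_sum horner_sum mulr_sumr; apply: eq_bigr => j _.
  rewrite rmorphM /= map_polyC map_polyXn hornerM hornerXn hornerC; ring.
have HQ : ord_ge P 1 (map_poly iota (Q i)).[f].
  have Hi : ord_ge P (i%:Z + 1) (s ^+ i * (map_poly iota (Q i)).[f]).
    move: relQ; rewrite (bigD1 i) //= => /eqP; rewrite addr_eq0 => /eqP ->.
    apply: ord_geN; apply: ord_ge_sum => l li.
    have [->|Ql] := eqVneq (Q l) 0.
      by rewrite rmorph0 horner0 mulr0; exact: ord_ge0.
    rewrite -[_ + 1]addr0; apply: ord_geM; last exact: ord_ge_horner.
    move=> _; rewrite ordX // ords.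
    have := Hmin l Ql; rewrite leq_eqVlt => /orP[/eqP E|]; last by lia.
    by case/eqP: li; apply: val_inj.
  move=> q0; have := Hi; rewrite /ord_ge mulf_neq0 ?expf_neq0 // => /(_ isT).
  rewrite ordM ?expf_neq0 // ordX // ords; lia.
(* Over k the polynomial Q i splits. Without a residue every factor f - a would have order 0, and so
   would (Q i)(f). *)
have [r Er] := closed_field_poly_normal (Q i).
apply: contrapT => noa.
have nz a : f - iota a != 0.
  by apply/eqP => E; apply: noa; exists a; rewrite E; exact: ord_ge0.
have ord0a a : ord P (f - iota a) = 0.
  apply/eqP; rewrite eq_le; apply/andP; split.
    rewrite leNgt; apply/negP => H; apply: noa; exists a => _; lia.
  exact: (ord_geD Hf (ord_geN (@ord_ge_const P a)) (nz a)).
have EQ : (map_poly iota (Q i)).[f] = iota (lead_coef (Q i)) * \prod_(a <- r) (f - iota a).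
  rewrite {1}Er linearZ /= hornerZ rmorph_prod horner_prod; congr (_ * _).
  by apply: eq_bigr => a _; rewrite /= map_polyXsubC hornerXsubC.
have lc : lead_coef (Q i) != 0 by rewrite lead_coef_eq0.
move: HQ; rewrite EQ /ord_ge ord_scale // ord_prod // mulf_eq0 fmorph_eq0 negb_or lc.
rewrite prodf_seq_neq0 /= big1 => [|a _]; last exact: ord0a.
by move=> H; have /H : all (fun a => f - iota a != 0) r by apply/allP => a _.
Qed.

Lemma has_dim_relation (V : K -> Prop) n (I : finType) (z : I -> K) :
  (exists e : 'I_n -> K, forall i, exists a : 'I_n -> k,
     z i = \sum_j iota (a j) * e j) -> (n < #|I|)%N ->
  exists2 c : I -> k, exists i, c i != 0 & \sum_i iota (c i) * z i = 0.
Proof.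
move=> [e /choice [a Ha]] nI.
have [|c c0 Hc] := @exists_linear_relation k I 'I_n (fun i j => a i j).
  by rewrite card_ord.
exists c => //; under eq_bigr do rewrite Ha mulr_sumr.
rewrite exchange_big big1 //= => j _.
under eq_bigr do rewrite mulrA -rmorphM.
by rewrite -mulr_suml -rmorph_sum Hc rmorph0 mul0r.
Qed.

Context (ellC : elliptic_function_field iota) (oo : place iota).

Lemma elliptic_dim (D : {freeg (place iota) / int}) :
  exists n : nat, has_dim iota (L D) n /\ deg D <= n%:Z.
Proof. by have [_ [/(_ D) [n [? ?]] _]] := ellC; exists n; split => //; lia. Qed.

Lemma has_dim_relationL (V : K -> Prop) n (I : finType) (z : I -> K) :
  has_dim iota V n -> (forall i, V (z i)) -> (n < #|I|)%N ->
  exists2 c : I -> k, exists i, c i != 0 & \sum_i iota (c i) * z i = 0.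
Proof.
move=> [e [_ span]] Vz; apply: has_dim_relation => //; exists e => i.
by have [a [-> _]] := span _ (Vz i); exists a.
Qed.

(** If y had a zero, its powers would have distinct orders there and be independent in the
    finite-dimensional space L(0). *)
Lemma regular_ord0 y P0 : y != 0 -> (forall P, 0 <= ord P y) -> ord P0 y = 0.
Proof.
move=> y0 Hy; apply/eqP; rewrite eq_le Hy andbT leNgt; apply/negP => pos.
have [n [dimL _]] := elliptic_dim 0.
have [||c [i ci] rel] := @has_dim_relationL _ n 'I_n.+1 (fun i => y ^+ i) dimL.
- by move=> i _ P; rewrite coeff0 oppr0 ordX // mulrn_wge0.
- by rewrite card_ord.
case/negP: ci; apply/eqP; apply: (@distinct_ord_free _ _ _ P0 _ _ _ _ _ rel).
- by move=> j; rewrite expf_neq0.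
move=> j l /=; rewrite !ordX // => E; apply: val_inj.
exact: (mulrIn (lt0r_neq0 pos) E).
Qed.

Definition regular_off_oo y := forall P, P != oo -> 0 <= ord P y.

Lemma ord_oo_gt0 y : ord_ge oo 1 y -> regular_off_oo y -> y = 0.
Proof.
move=> Hoo Hy; apply/eqP/negPn/negP => y0.
have := @regular_ord0 y oo y0; have := Hoo y0; move=> H1 H2.
have: ord oo y = 0; last by lia.
apply: H2 => P; have [->|] := eqVneq P oo; [lia | exact: Hy].
Qed.

Lemma regular_offD y z : regular_off_oo y -> regular_off_oo z -> regular_off_oo (y + z).
Proof.
move=> Hy Hz P Poo.
have [->|yz] := eqVneq (y + z) 0; first by rewrite Defs.ord0.
by apply: (@ord_geD _ _ _ P 0 y z) => // _; [exact: Hy | exact: Hz].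
Qed.

Lemma regular_offZ a y : regular_off_oo y -> regular_off_oo (iota a * y).
Proof.
move=> Hy P Poo; have [->|a0] := eqVneq a 0; first by rewrite rmorph0 mul0r Defs.ord0.
by rewrite ord_scale // Hy.
Qed.

Lemma regular_offM y z : regular_off_oo y -> regular_off_oo z -> regular_off_oo (y * z).
Proof.
move=> Hy Hz P Poo.
have [->|y0] := eqVneq y 0; first by rewrite mul0r Defs.ord0.
have [->|z0] := eqVneq z 0; first by rewrite mulr0 Defs.ord0.
by rewrite ordM // addr_ge0 ?Hy ?Hz.
Qed.

Lemma regular_offX y i : regular_off_oo y -> regular_off_oo (y ^+ i).
Proof.
move=> Hy; elim: i => [|i IH]; last by rewrite exprS; exact: regular_offM.
by move=> P _; rewrite expr0 Defs.ord1.
Qed.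

(** The quotient y / z has order 0 at oo, and its residue is the scalar. *)
Lemma ord_eq_sub y z : y != 0 -> z != 0 -> ord oo y = ord oo z ->
  exists2 a, a != 0 & ord_ge oo (ord oo y + 1) (y - iota a * z).
Proof.
move=> y0 z0 E; have yz0 : y / z != 0 by rewrite mulf_neq0 ?invr_eq0.
have oyz : ord oo (y / z) = 0 by rewrite ordM ?invr_eq0 // ordV // E subrr.
have [|a Ha] := @exists_residue oo (y / z) (proj1 ellC).
  by move=> _; rewrite oyz.
exists a.
  by apply/eqP => a0; move: (Ha); rewrite a0 rmorph0 subr0 /ord_ge oyz => /(_ yz0).
have -> : y - iota a * z = (y / z - iota a) * z by field.
rewrite addrC E; exact: ord_geM.
Qed.

(** * Genus one excludes a simple pole *)

Section SimplePole.
Context (x : K) (x0 : x != 0) (ordx : ord oo x = - 1) (regx : regular_off_oo x).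

(** A multiple of x^(j + 1) cancels the pole of order j + 1; at the bottom only a constant is
    left. *)
Let span_powers j y : ord_ge oo (- j%:Z) y -> regular_off_oo y ->
  exists a : 'I_j.+1 -> k, y = \sum_i iota (a i) * x ^+ i.
Proof.
elim: j y => [|j IH] y Hoo Hy.
  have [|a Ha] := @exists_residue oo y (proj1 ellC); first by move: Hoo; rewrite oppr0.
  exists (fun=> a); rewrite big_ord1 expr0 mulr1.
  apply/eqP; rewrite -subr_eq0; apply/eqP; apply: ord_oo_gt0 Ha _.
  apply: regular_offD => // P Poo.
  by have := @ord_ge_const P a; have [->|] := eqVneq (iota a) 0;
    rewrite ?oppr0 ?Defs.ord0 // ordN => + H; exact.
have [|a Ha] := @exists_residue oo (y / x ^+ j.+1) (proj1 ellC).
  rewrite /ord_ge mulf_eq0 invr_eq0 (negPf (expf_neq0 _ x0)) orbF => y0.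
  rewrite ordM ?invr_eq0 ?expf_neq0 // ordV ?expf_neq0 // ordX // ordx.
  have := Hoo y0; lia.
have [||b Hb] := IH (y - iota a * x ^+ j.+1).
- have -> : y - iota a * x ^+ j.+1 = (y / x ^+ j.+1 - iota a) * x ^+ j.+1.
    by field; rewrite expf_neq0.
  have -> : - j%:Z = 1 + (- j.+1%:Z) by lia.
  apply: ord_geM Ha _ => _; rewrite ordX // ordx; lia.
- by apply: regular_offD Hy _ => P Poo; rewrite ordN;
  apply: regular_offZ (regular_offX _ regx) _ Poo.
exists (fun i => if unlift ord_max i is Some l then b l else a).
rewrite big_ord_recr /= unlift_none -[LHS](subrK (iota a * x ^+ j.+1)) Hb.
congr (_ + _); apply: eq_bigr => i _; congr (iota _ * _).
by have -> : widen_ord (leqnSn j.+1) i = fintype.lift ord_max i;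
  [apply: val_inj; rewrite /= /bump leqNgt ltn_ord | rewrite liftK].
Qed.

(** Z records two zeros of y. Multiplication by y^2 embeds L(2 Z) into the span of 1, x, x^2,
    whereas the genus bound gives L(2 Z) dimension at least 4. Using Z itself would only compare 2
    with 2, whence the doubling. *)
Let no_double_zero y (Z : {freeg (place iota) / int}) : y != 0 -> ord oo y = -1 ->
  regular_off_oo y -> deg Z = 2 -> coeff oo Z = 0 ->
  (forall P, P != oo -> coeff P Z <= ord P y) -> False.
Proof.
move=> y0 ordy regy degZ Zoo HZ.
have [n [[e [Ve unique]]]] := elliptic_dim (Z *+ 2); rewrite degMn degZ => n4.
have e_span i : exists a : 'I_3 -> k, y ^+ 2 * e i = \sum_j iota (a j) * x ^+ j.
  apply: span_powers.
    rewrite /ord_ge mulf_eq0 negb_or => /andP[? ei]; rewrite ordM ?expf_neq0 //.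
    by have := Ve i ei oo; rewrite coeffMn Zoo ordX // ordy; lia.
  move=> P Poo; have [->|ei] := eqVneq (e i) 0; first by rewrite mulr0 Defs.ord0.
  rewrite ordM ?expf_neq0 // ordX //.
  have := Ve i ei P; rewrite coeffMn; have := HZ P Poo; lia.
have [||c [i ci] rel] := @has_dim_relation (fun=> True) 3 'I_n (fun i => y ^+ 2 * e i).
- by exists (fun j => x ^+ j).
- by rewrite card_ord; lia.
have rel' : \sum_i iota (c i) * e i = 0.
  apply: (mulfI (expf_neq0 2 y0)); rewrite mulr0 mulr_sumr -[RHS]rel.
  by apply: eq_bigr => j _; rewrite mulrCA.
have [|a [_ uniqa]] := unique 0; first exact: RR_0.
have E1 : a = [ffun i => c i].
  by apply: uniqa; rewrite -[LHS]rel'; apply: eq_bigr => j _; rewrite ffunE.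
have E2 : a = [ffun=> 0].
  by apply: uniqa; rewrite big1 // => j _; rewrite ffunE rmorph0 mul0r.
move: ci; have := congr1 (fun g : {ffun 'I_n -> k} => g i) E2.
by rewrite {1}E1 !ffunE => ->; rewrite eqxx.
Qed.

(** The witness is x minus its residue at P; a second zero, at P or elsewhere, is excluded by
    [no_double_zero]. *)
Let local_parameter P : P != oo -> exists y, [/\ y != 0, ord oo y = -1, ord P y = 1 &
  forall Q, Q != oo -> Q != P -> ord Q y = 0].
Proof.
move=> Poo; have [|a Ha] := @exists_residue P x (proj1 ellC).
  by move=> _; exact: regx.
pose y := x - iota a.
have y0 : y != 0.
  apply/eqP => /eqP; rewrite subr_eq0 => /eqP E; move: ordx; rewrite E.
  by have [->|a0] := eqVneq a 0; [rewrite rmorph0 Defs.ord0 | rewrite ordC].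
have regy : regular_off_oo y.
  apply: regular_offD => // Q Qoo; rewrite ordN.
  have [->|a0] := eqVneq a 0; first by rewrite rmorph0 Defs.ord0.
  by rewrite ordC.
have ordy : ord oo y = -1.
  apply/eqP; rewrite eq_le; apply/andP; split; last first.
    apply: (@ord_geD _ _ _ oo (-1) x (- iota a)) => //; first by move=> _; rewrite ordx.
    by apply: ord_geN => a0; rewrite ordC // -(fmorph_eq0 iota).
  rewrite leNgt; apply/negP => ygt.
  have : ord_ge oo 0 (y + iota a).
    by apply: ord_geD; [move=> _; lia | exact: ord_ge_const].
  by rewrite /y subrK /ord_ge ordx => /(_ x0).
have Py : 1 <= ord P y by exact: Ha.
exists y; split => //.
  apply/eqP; rewrite eq_le Py andbT leNgt; apply/negP => P2.
  apply: (@no_double_zero y << 2 *g P >>) => //.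
  - by rewrite degU.
  - by rewrite coeffU (negPf Poo) mulr0.
  move=> Q Qoo; rewrite coeffU; have [<-|_] := eqVneq P Q; first by lia.
  by rewrite mulr0 regy.
move=> Q Qoo QP; apply/eqP; rewrite eq_le regy // andbT leNgt; apply/negP => Q1.
apply: (@no_double_zero y (<< 1 *g P >> + << 1 *g Q >>)) => //.
- by rewrite degD !degU.
- by rewrite coeffD !coeffU (negPf Poo) (negPf Qoo) !mulr0 addr0.
move=> R Roo; rewrite coeffD !coeffU; have [<-|PR] := eqVneq P R.
  by rewrite (negPf QP) mulr0; lia.
have [<-|QR] := eqVneq Q R; first by lia.
by rewrite !mulr0 addr0 regy.
Qed.

(* Multiplication by h below identifies L(D0) with L((deg D0) oo), which
   contains 1, x, ..., x^(deg D0). *)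
Lemma no_simple_pole : False.
Proof.
have [_ [_ [D0 [n [dimL degD0]]]]] := ellC.
have /choice [y Hy] : forall P, exists y, P != oo -> [/\ y != 0, ord oo y = -1, ord P y = 1 &
  forall Q, Q != oo -> Q != P -> ord Q y = 0].
  move=> P; have [->|/local_parameter [y Hy]] := eqVneq P oo; first by exists 0.
  by exists y.
(* Each factor has divisor (coeff P D0) (P - oo), so h has divisor D0 - (deg D0) oo. *)
pose F P := if P == oo then 1 else y P ^ coeff P D0.
have F0 P : F P != 0.
  rewrite /F; have [_|Poo] := eqVneq P oo; first exact: oner_neq0.
  by have [y0 _ _ _] := Hy P Poo; rewrite expfz_neq0.
pose h := \prod_(P <- dom D0) F P.
have h0 : h != 0 by rewrite prodf_seq_neq0; apply/allP => P _; rewrite F0.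
have ordF Q P : Q != oo -> ord Q (F P) = coeff P D0 * (P == Q)%:R.
  move=> Qoo; rewrite /F; have [->|Poo] := eqVneq P oo.
    by rewrite Defs.ord1 eq_sym (negPf Qoo) mulr0.
  have [y0 _ yP yQ] := Hy P Poo.
  rewrite ordXz //; have [<-|PQ] := eqVneq P Q; first by rewrite yP mul1r mulr1.
  by rewrite yQ ?mul0r ?mulr0 // eq_sym.
have ordh Q : Q != oo -> ord Q h = coeff Q D0.
  move=> Qoo; rewrite ord_prod //.
  under eq_bigr do rewrite ordF //.
  rewrite -[in RHS](freeg_sumE D0) raddf_sum; apply: eq_bigr => P _.
  by rewrite /= coeffU.
have ordooh : ord oo h = coeff oo D0 - deg D0.
  rewrite ord_prod // -{2 3}(freeg_sumE D0) !raddf_sum -big_split; apply: eq_bigr => P _ /=.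
  rewrite coeffU degU /F; have [->|Poo] := eqVneq P oo.
    by rewrite Defs.ord1 mulr1 subrr.
  have [y0 yoo _ _] := Hy P Poo.
  by rewrite ordXz // yoo mulr0 sub0r mulN1r.
(* D0 attains the genus, so n = deg D0, and the n + 1 quotients x^i / h with i <= deg D0 lie in
   L(D0). *)
have [||c [i ci] rel] := @has_dim_relationL _ n 'I_n.+1 (fun i => x ^+ i / h) dimL.
- move=> i _ P; rewrite ordM ?invr_eq0 ?expf_neq0 // ordV //.
  have [->|Poo] := eqVneq P oo.
    rewrite ordooh ordX // ordx; have := ltn_ord i; lia.
  by rewrite ordh // -[leLHS]add0r lerD2r; apply: regular_offX.
- by rewrite card_ord.
case/negP: ci; apply/eqP; apply: (@distinct_ord_free _ _ _ oo _ _ _ _ _ rel).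
- by move=> j; rewrite mulf_neq0 ?invr_eq0 ?expf_neq0.
move=> j l; rewrite !ordM ?invr_eq0 ?expf_neq0 // => /addIr.
rewrite !ordX // ordx => H; apply: val_inj => /=; lia.
Qed.

End SimplePole.

Lemma pole_order_nat y : y != 0 -> regular_off_oo y ->
  exists2 c : nat, c != 1%N & ord oo y = - c%:Z.
Proof.
move=> y0 Hy; have [pos|neg] := ltP 0 (ord oo y).
  by case/eqP: y0; apply: ord_oo_gt0 => // _; lia.
exists `|ord oo y|%N; last by lia.
by apply/eqP => E; apply: (@no_simple_pole y) => //; lia.
Qed.

End EllipticFunctionField.

(** * Best lower approximations *)

Section LatticePath.
Local Open Scope nat_scope.
Implicit Types (w x y : nat * nat).

(** Slopes are compared by cross multiplication with a lattice point A of slope alpha, which makes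
    the comparison meaningful for the origin too. *)
Definition below A w := w.2 * A.1 <= A.2 * w.1.

Definition best_below A w := [/\ 0 < w.1, coprime w.1 w.2, below A w &
  forall w', 0 < w'.1 < w.1 -> below A w' -> below w w'].

Record approx_path (A : nat * nat) (r : nat) (p : nat -> nat * nat) : Prop := ApproxPath {
  path_best : forall i, i <= r -> best_below A (p i);
  path_all : forall w, best_below A w -> exists2 i, i <= r & w = p i;
  path_incr : forall i j, i < j <= r -> (p i).2 * (p j).1 < (p j).2 * (p i).1;
  path_last : p r = A }.

Context (A : nat * nat) (r : nat) (p : nat -> nat * nat) (hp : approx_path A r p).

Lemma path_gt0 i : i <= r -> 0 < (p i).1.
Proof. by case/(path_best hp). Qed.

Lemma path_below i : i <= r -> below A (p i).
Proof. by case/(path_best hp). Qed.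

(** Equal slopes are impossible: x is in lowest terms, so x.1 would divide the smaller w.1. *)
Lemma best_below_strict x w : best_below A x -> 0 < w.1 < x.1 -> below A w ->
  w.2 * x.1 < x.2 * w.1.
Proof.
case=> x0 cop _ bestx wx Aw; have := bestx w wx Aw; rewrite /below leq_eqVlt.
case/orP => // /eqP E; have : x.1 %| w.1.
  by rewrite -(Gauss_dvdr _ cop) -E dvdn_mull.
by case/andP: wx => w0 /[swap] /dvdn_leq -/(_ w0); lia.
Qed.

Lemma path_fst_le i j : i <= j <= r -> (p i).1 <= (p j).1.
Proof.
move=> /andP[ij jr]; rewrite leqNgt; apply/negP => ji.
have ltij : i < j by rewrite ltn_neqAle ij andbT; apply: contraTneq ji => ->; rewrite ltnn.
have ir : i <= r by lia.
have := best_below_strict (path_best hp ir) (_ : 0 < (p j).1 < (p i).1) (path_below jr).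
rewrite ji path_gt0 // => /(_ isT); have := @path_incr _ _ _ hp i j; rewrite ltij jr => /(_ isT).
lia.
Qed.

Lemma path_snd_lt i j : i < j <= r -> (p i).2 < (p j).2.
Proof.
move=> ijr; have := path_incr hp ijr; have := @path_fst_le i j.
have : 0 < (p i).1 by apply: path_gt0; lia.
move=> H /(_ ltac:(lia)) H2 H3; rewrite ltnNge; apply/negP => H4.
nia.
Qed.

(* A lattice point w with d w = s x + y, d = det(x, y), 0 < s < d. *)
Lemma exists_between x y : coprime x.1 x.2 -> coprime y.1 y.2 -> 0 < x.1 <= y.1 ->
  x.2 * y.1 + 1 < y.2 * x.1 -> exists w, [/\ 0 < w.1 <= y.1,
    x.2 * w.1 < w.2 * x.1 & w.2 * y.1 < y.2 * w.1].
Proof.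
move: x y => [dx cx] [dy cy] /= copx copy /andP[dx0 dxy] det2.
pose dl : int := (cy * dx)%:Z - (cx * dy)%:Z.
have dl2 : (2 <= dl)%R by rewrite /dl; lia.
case: (egcdnP cx dx0) => u v E _; move: E; rewrite (eqP copx) => E.
(* By Bezout, q x + y = dl (v, u). Reducing q modulo dl keeps the right-hand side divisible by dl
   and bounds the coefficient of x. *)
pose q : int := (v%:Z * cy%:Z - u%:Z * dy%:Z)%R.
pose s := (q %% dl)%Z; have Es := divz_eq q dl; rewrite -/s in Es.
have s0 : (0 <= s)%R by apply: modz_ge0; lia.
have sd : (s < dl)%R by apply: ltz_pmod; lia.
set t := (q %/ dl)%Z in Es.
have e1 : (u%:Z * dx%:Z - v%:Z * cx%:Z = 1)%R by lia.
have W1 : (s * dx%:Z + dy%:Z = dl * (v%:Z - t * dx%:Z))%R.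
  have -> : s = (q - t * dl)%R by rewrite Es; ring.
  by have := congr1 (fun z => (dy%:Z * z)%R) e1; rewrite /= mulr1 /q /dl; lia.
have W2 : (s * cx%:Z + cy%:Z = dl * (u%:Z - t * cx%:Z))%R.
  have -> : s = (q - t * dl)%R by rewrite Es; ring.
  by have := congr1 (fun z => (cy%:Z * z)%R) e1; rewrite /= mulr1 /q /dl; lia.
move: W1 W2; set w1 := (v%:Z - _)%R; set w2 := (u%:Z - _)%R => W1 W2.
(* For s = 0 the number dl >= 2 would divide both coordinates of y, which are coprime. *)
have s1 : (1 <= s)%R.
  rewrite -gtz0_ge1 lt_neqAle s0 andbT; apply/eqP => s00.
  have : (`|dl| %| gcdn dy cy)%N.
    rewrite dvdn_gcd; move: W1 W2; rewrite -s00 !mul0r !add0r => W1 W2.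
    have -> : dy = `|dy%:Z|%N by []. have -> : cy = `|cy%:Z|%N by [].
    by rewrite W1 W2 !abszM !dvdn_mulr.
  rewrite (eqP copy) dvdn1; lia.
have dl0 : (0 < dl)%R by lia.
have w10 : (0 < w1)%R.
  by rewrite -(pmulr_rgt0 _ dl0) -W1 ltr_wpDl ?mulr_ge0 //; lia.
have w1dy : (w1 <= dy%:Z)%R.
  rewrite -(ler_pM2l dl0) -W1; apply: (@le_trans _ _ ((s + 1) * dy%:Z)%R).
    have -> : ((s + 1) * dy%:Z = s * dy%:Z + dy%:Z)%R by ring.
    by rewrite lerD2r ler_wpM2l //; lia.
  by rewrite ler_wpM2r //; lia.
have w20 : (0 <= w2)%R.
  by rewrite -(pmulr_rge0 _ dl0) -W2 addr_ge0 ?mulr_ge0 //; lia.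
exists (`|w1|%N, `|w2|%N) => /=.
have D1 : (dl * (w2 * dx%:Z - cx%:Z * w1) = dl)%R.
  have -> : (dl * (w2 * dx%:Z - cx%:Z * w1) = (dl * w2) * dx%:Z - cx%:Z * (dl * w1))%R by ring.
  rewrite -W1 -W2 /dl; lia.
have D2 : (dl * (cy%:Z * w1 - w2 * dy%:Z) = dl * s)%R.
  have -> : (dl * (cy%:Z * w1 - w2 * dy%:Z) = cy%:Z * (dl * w1) - (dl * w2) * dy%:Z)%R by ring.
  rewrite -W1 -W2 /dl; lia.
have D1' : (w2 * dx%:Z - cx%:Z * w1 = 1)%R.
  by apply: (@mulfI _ dl); [lia | rewrite D1 mulr1].
have D2' : (cy%:Z * w1 - w2 * dy%:Z = s)%R.
  by apply: (@mulfI _ dl); [lia | rewrite D2].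
split; lia.
Qed.

(** A determinant of 2 or more would put a lattice point strictly between p i and p (i + 1) in
    slope, of denominator at most that of p (i + 1). One of least denominator is itself a best lower
    approximation, so it would be a member of the path between two consecutive members. *)
Lemma path_det i : i < r -> (p i).1 * (p i.+1).2 = (p i).2 * (p i.+1).1 + 1.
Proof.
move=> ir; have ir' : i <= r by lia.
have := @path_incr _ _ _ hp i i.+1; rewrite ltnSn ir => /(_ isT) lt1.
apply/eqP; rewrite eqn_leq; apply/andP; split; last by lia.
rewrite leqNgt; apply/negP => det2.
have [dx0 copx _ bestx] := path_best hp ir'.
have [dy0 copy belowy besty] := path_best hp ir.
have dxy : (p i).1 <= (p i.+1).1 by apply: path_fst_le; lia.
have dx0y : 0 < (p i).1 <= (p i.+1).1 by rewrite dx0.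
have det2' : (p i).2 * (p i.+1).1 + 1 < (p i.+1).2 * (p i).1 by lia.
have [w0 [w0y w0x w0y']] := exists_between copx copy dx0y det2'.
pose between d := (0 < d) && `[< exists c,
  (p i).2 * d < c * (p i).1 /\ c * (p i.+1).1 < (p i.+1).2 * d >].
have ex : exists d, between d.
  exists w0.1; rewrite /between; apply/andP; split; first by lia.
  by apply/asboolP; exists w0.2.
case: (ex_minnP ex) => d /andP[d0 /asboolP [c [c1 c2]]] Hmin.
have dy : d <= (p i.+1).1.
  apply: leq_trans (Hmin w0.1 _) _; last by lia.
  rewrite /between; apply/andP; split; first by lia.
  by apply/asboolP; exists w0.2.
have Hbelow e f : f * (p i.+1).1 <= (p i.+1).2 * e -> below A (e, f).
  rewrite /below /= => H; move: belowy; rewrite /below => Hy.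
  rewrite -(leq_pmul2r dy0).
  apply: (@leq_trans ((p i.+1).2 * e * A.1)); first by rewrite mulnAC leq_mul2r H orbT.
  by rewrite mulnAC [leqRHS]mulnAC leq_mul2r Hy orbT.
have [j jr E] : exists2 j, j <= r & (d, c) = p j.
  apply: (path_all hp); split => //=.
  - apply/eqP; have g0 : 0 < gcdn d c by rewrite gcdn_gt0 d0.
    have /dvdnP[a Ed] := dvdn_gcdl d c; have /dvdnP[b Ec] := dvdn_gcdr d c.
    move: (gcdn d c) g0 Ed Ec => g g0 Ed Ec; subst d c.
    have a0 : 0 < a by move: d0; rewrite muln_gt0 => /andP[].
    have : a * g <= a.
      apply: Hmin; rewrite /between a0; apply/asboolP; exists b.
      by split; rewrite -(ltn_pmul2r g0); lia.
    by rewrite -{2}[a]muln1 leq_pmul2l //; lia.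
  - by apply: Hbelow; lia.
  (* A point of smaller denominator and larger slope would again lie between, since p (i + 1) is a
     best approximation; this contradicts the choice of d. *)
  move=> [e f] /= /andP[e0 ed] bel; rewrite /below /= leqNgt; apply/negP => H.
  have b1 : f * (p i.+1).1 < (p i.+1).2 * e.
    have e0y : 0 < e < (p i.+1).1 by rewrite e0 (leq_trans ed dy).
    exact: (best_below_strict (path_best hp ir) (w := (e, f))).
  suff /Hmin : between e by lia.
  rewrite /between e0; apply/asboolP; exists f; split => //.
  nia.
have jlt a : a <= r -> (p a).2 * d < c * (p a).1 -> a < j.
  move=> ar H; rewrite ltnNge leq_eqVlt; apply/negP => /orP[/eqP aj|aj].
    by move: H; rewrite -aj -E /=; lia.
  by have := @path_incr _ _ _ hp j a; rewrite aj ar -E /= => /(_ isT); lia.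
have jgt a : a <= r -> c * (p a).1 < (p a).2 * d -> j < a.
  move=> ar H; rewrite ltnNge leq_eqVlt; apply/negP => /orP[/eqP aj|aj].
    by move: H; rewrite aj -E /=; lia.
  by have := @path_incr _ _ _ hp a j; rewrite aj jr -E /= => /(_ isT); lia.
have := jlt i ir' c1; have := jgt i.+1 ir c2; lia.
Qed.

(** Take the last l < r for which p l has smaller slope than w. Since p l and p (l + 1) have
    determinant 1, the coordinates of w in this basis are determinants, and their signs express the
    two slope comparisons. *)
Lemma path_cone i w : i < r -> below A w -> (p i).2 * w.1 < w.2 * (p i).1 ->
  exists l a b, [/\ i <= l < r, 0 < b & 
    w = (a * (p l).1 + b * (p l.+1).1, a * (p l).2 + b * (p l.+1).2)].
Proof.
move=> ir bel H.
pose Q l := (l < r) && ((p l).2 * w.1 < w.2 * (p l).1).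
have exQ : exists l, Q l by exists i; rewrite /Q ir.
have [l /andP[lr Ql] lmax] := ex_maxnP exQ (fun l (Ql : Q l) => ltnW (proj1 (andP Ql))).
have il : i <= l by apply: lmax; rewrite /Q ir.
have next : w.2 * (p l.+1).1 <= (p l.+1).2 * w.1.
  have [lr1|rl1] := ltnP l.+1 r.
    rewrite leqNgt; apply/negP => H1; have : Q l.+1 by rewrite /Q lr1.
    by move/lmax; rewrite ltnn.
  by have -> : l.+1 = r by [lia]; rewrite (path_last hp).
have det := path_det lr.
exists l, ((p l.+1).2 * w.1 - w.2 * (p l.+1).1), (w.2 * (p l).1 - (p l).2 * w.1).
split; [by rewrite il lr | by rewrite subn_gt0 |].
move: w Ql next {bel H Q exQ lmax} => [d c] /= Ql next.
have [b Eb] : exists b, c * (p l).1 = (p l).2 * d + b by exists (c * (p l).1 - (p l).2 * d); lia.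
have [a Ea] : exists a, (p l.+1).2 * d = c * (p l.+1).1 + a.
  by exists ((p l.+1).2 * d - c * (p l.+1).1); lia.
rewrite Eb Ea !addKn; move: det Eb Ea.
move: (p l) (p l.+1) => [d1 c1] [d2 c2] /= det Eb Ea.
have D := congr1 (muln d) det; have C := congr1 (muln c) det.
have := congr1 (muln d1) Ea; have := congr1 (muln d2) Eb.
have := congr1 (muln c1) Ea; have := congr1 (muln c2) Eb.
by move=> ? ? ? ?; congr (_, _); lia.
Qed.

(** The condition 0 < b makes the cones half-open: cone l covers the slopes above that of p l up to
    that of p (l + 1). Different cones are therefore disjoint, and inside one cone the determinant 1
    makes coordinates unique. *)
Lemma path_cone_unique l l' a a' b b' : l < r -> l' < r -> 0 < b -> 0 < b' ->
  a * (p l).1 + b * (p l.+1).1 = a' * (p l').1 + b' * (p l'.+1).1 ->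
  a * (p l).2 + b * (p l.+1).2 = a' * (p l').2 + b' * (p l'.+1).2 ->
  [/\ l = l', a = a' & b = b'].
Proof.
move: l l' a a' b b'.
suff lt_case l l' a a' b b' : l < l' -> l' < r -> 0 < b' ->
    a * (p l).1 + b * (p l.+1).1 = a' * (p l').1 + b' * (p l'.+1).1 ->
    a * (p l).2 + b * (p l.+1).2 = a' * (p l').2 + b' * (p l'.+1).2 -> False.
  move=> l l' a a' b b' lr l'r b0 b'0 E1 E2.
  have [H|H|ll] := ltngtP l l'; [by case: (lt_case _ _ _ _ _ _ H l'r b'0 E1 E2) | by case:
    (lt_case _ _ _ _ _ _ H lr b0 (esym E1) (esym E2)) |].
  subst l'; have det := path_det lr; move: det E1 E2.
  move: (p l) (p l.+1) => [d1 c1] [d2 c2] /= det E1 E2.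
  have := congr1 (muln d1) E2; have := congr1 (muln d2) E2.
  have := congr1 (muln c1) E1; have := congr1 (muln c2) E1.
  have := congr1 (muln a) det; have := congr1 (muln a') det.
  have := congr1 (muln b) det; have := congr1 (muln b') det.
  by move=> *; split => //; lia.
move=> ll' l'r b'0 E1 E2; have lr : l < r by lia.
have det := path_det lr.
have inc1 : (p l.+1).2 * (p l').1 <= (p l').2 * (p l.+1).1.
  have [->|ne] := eqVneq l.+1 l'; first by [].
  by apply: ltnW; apply: (path_incr hp); lia.
have inc2 : (p l.+1).2 * (p l'.+1).1 < (p l'.+1).2 * (p l.+1).1.
  by apply: (path_incr hp); lia.
move: (p l) (p l.+1) (p l') (p l'.+1) det inc1 inc2 E1 E2.
move=> [d1 c1] [d2 c2] [d3 c3] [d4 c4] /= det inc1 inc2 E1 E2.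
have H1 : a' * (c2 * d3) <= a' * (c3 * d2) by rewrite leq_mul2l inc1 orbT.
have H2 : b' * (c2 * d4) < b' * (c4 * d2) by rewrite ltn_pmul2l.
have := congr1 (muln c2) E1; have := congr1 (muln d2) E2.
have := congr1 (muln a) det.
lia.
Qed.

End LatticePath.

Arguments pt : simpl never.

Lemma slope_le (x y : nat * nat) : (0 < x.1)%N -> (0 < y.1)%N ->
  (slope x <= slope y) = (x.2 * y.1 <= y.2 * x.1)%N.
Proof.
move=> x0 y0; rewrite /slope ler_pdivrMr ?ltr0n // mulrAC ler_pdivlMr ?ltr0n //.
by rewrite -!natrM ler_nat.
Qed.

Lemma slope_lt (x y : nat * nat) : (0 < x.1)%N -> (0 < y.1)%N ->
  (slope x < slope y) = (x.2 * y.1 < y.2 * x.1)%N.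
Proof. by move=> x0 y0; rewrite ltNge slope_le // -ltnNge. Qed.

Section BestLowerApproximations.
Context (alpha : rat) (alpha_gt0 : 0 < alpha).

Lemma exists_slope_eq : exists A : nat * nat,
  [/\ (0 < A.1)%N, coprime A.1 A.2 & slope A = alpha].
Proof.
exists (`|denq alpha|%N, `|numq alpha|%N); split => /=.
- by rewrite absz_gt0 denq_neq0.
- by rewrite coprime_sym coprime_num_den.
rewrite /slope /=.
have n0 : 0 <= numq alpha by rewrite numq_ge0 ltW.
by rewrite -[RHS]divq_num_den !natr_absz normr_denq ger0_norm.
Qed.

Lemma slope_below A w : (0 < A.1)%N -> (0 < w.1)%N -> slope A = alpha ->
  (slope w <= alpha) = below A w.
Proof. by move=> A0 w0 <-; rewrite slope_le. Qed.

Lemma best_belowP A w : (0 < A.1)%N -> slope A = alpha ->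
  best_below A w <-> best_lower_approx alpha w.
Proof.
move=> A0 EA; split=> [][w0 cop].
  rewrite -(slope_below A0) // => lew best; split => // w' /[dup] H /andP[w'0 _].
  by rewrite (slope_below A0) // slope_le //; exact: best.
rewrite (slope_below A0) // => lew best; split => // w' /[dup] H /andP[w'0 _].
by have := best w' H; rewrite (slope_below A0) // slope_le.
Qed.

(** The reduced fraction of alpha is a best lower approximation of maximal slope, so it ends the
    increasing list; (1, 0) starts it because no slope is negative. As alpha > 0 the two differ,
    whence 0 < r. *)
Lemma approx_pathP (v : seq (nat * nat)) : best_lower_approxs alpha v ->
  let r := (size v).-1 in
  [/\ approx_path (pt v r) r (pt v), size v = r.+1, (0 < r)%N, pt v 0 = (1, 0)%N &
      slope (pt v r) = alpha].
Proof.
move=> [sorted_v mem_v].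
have [A [A0 copA EA]] := exists_slope_eq.
have bestA : best_below A A.
  by split => //; rewrite /below.
have best0 : best_below A (1, 0)%N by split => // w /=; lia.
have inv w : best_below A w <-> w \in v.
  by split=> [/(best_belowP _ A0 EA)/mem_v //|/mem_v/(best_belowP _ A0 EA)].
have Av : A \in v by apply/inv.
have v0 : (0 < size v)%N by case: (v) Av.
have incr i j : (i < j < size v)%N -> slope (pt v i) < slope (pt v j).
  move=> /andP[ij jv]; apply: (@sorted_ltn_nth _ (fun x y => slope x < slope y)) => //.
  - by move=> y x z; apply: lt_trans.
  - by rewrite inE (ltn_trans ij jv).
have memp i : (i < size v)%N -> pt v i \in v by move=> iv; apply: mem_nth.
have bestp i : (i < size v)%N -> best_below A (pt v i).
  by move=> iv; apply/inv/memp.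
have E0 : pt v 0 = (1, 0)%N.
  have H0 : (1, 0)%N \in v by apply/inv.
  rewrite -(nth_index (0, 0)%N H0); have: (index (1, 0)%N v < size v)%N by rewrite index_mem.
  case: (posnP (index (1, 0)%N v)) => [-> //|i0 iv].
  have := incr 0%N (index (1, 0)%N v); rewrite i0 iv {2}/pt nth_index // => /(_ isT).
  by rewrite {2}/slope /= mul0r ltNge /slope divr_ge0.
have Elast : pt v (size v).-1 = A.
  rewrite -(nth_index (0, 0)%N Av); have: (index A v < size v)%N by rewrite index_mem.
  rewrite -[X in (_ < X)%N]prednK // ltnS leq_eqVlt => /orP[/eqP <- //|ilt].
  have := incr (index A v) (size v).-1; rewrite ilt prednK // leqnn => /(_ isT).
  rewrite {1}/pt nth_index // EA.
  have [p0 _ + _] := bestp (size v).-1 ltac:(by rewrite prednK).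
  by rewrite -(slope_below A0) // leNgt => /negPf ->.
split; rewrite ?Elast ?prednK //; last first.
  rewrite lt0n; apply/eqP => r0; move: EA; rewrite -Elast r0 E0 /slope mul0r => E.
  by move: alpha_gt0; rewrite -E ltxx.
split; rewrite ?Elast //.
- by move=> i ir; apply: bestp; rewrite -(prednK v0).
- move=> w /inv wv.
  exists (index w v); first by rewrite -ltnS prednK // index_mem.
  by rewrite /pt nth_index.
- move=> i j /andP[ij jr]; have jv : (j < size v)%N by rewrite -(prednK v0).
  have iv := ltn_trans ij jv.
  rewrite -slope_lt; first by apply: incr; rewrite ij.
    by case: (bestp i iv).
  by case: (bestp j jv).
Qed.

Context (v : seq (nat * nat)) (hv : best_lower_approxs alpha v).
Local Notation r := (size v).-1.
Local Notation A := (pt v r).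
Local Notation n := (pt v 1).1.
Local Notation th := (theta alpha).

Lemma pt_path : approx_path A r (pt v). Proof. by case: (approx_pathP hv). Qed.

Lemma r_gt0 : (0 < r)%N. Proof. by case: (approx_pathP hv). Qed.

Lemma size_v : size v = r.+1. Proof. by case: (approx_pathP hv). Qed.

Lemma pt0E : pt v 0 = (1, 0)%N. Proof. by case: (approx_pathP hv). Qed.

Lemma pt_gt0 i : (i <= r)%N -> (0 < (pt v i).1)%N.
Proof. exact: (path_gt0 pt_path). Qed.

Lemma belowE w : (0 < w.1)%N -> below A w = (slope w <= alpha).
Proof.
move=> w0; rewrite (slope_below (pt_gt0 (leqnn r))) //.
by case: (approx_pathP hv).
Qed.

Lemma n_gt0 : (0 < n)%N. Proof. exact: pt_gt0 r_gt0. Qed.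

Lemma pt1E : pt v 1 = (n, 1)%N.
Proof.
have := path_det pt_path r_gt0; rewrite pt0E mul1n mul0n add0n.
by case: (pt v 1) => d c /= ->.
Qed.

Lemma below_inv w : (0 < w.1)%N -> below A w = (w.2%:R * alpha^-1 <= w.1%:R).
Proof.
by move=> w0; rewrite belowE // /slope ler_pdivrMr ?ltr0n // [RHS]ler_pdivrMr // mulrC.
Qed.

(** The degree n of p 1 is the ceiling of 1 / alpha: (n, 1) is under the line, and (n - 1, 1) is
    not, because it would be a shorter point of larger slope. *)
Lemma thetaE : th = n%:R - alpha^-1.
Proof.
have up : alpha^-1 <= n%:R.
  have := path_below pt_path r_gt0; rewrite below_inv ?n_gt0 //.
  by rewrite {1}pt1E mul1r.
have lo : n%:R - 1 < alpha^-1.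
  rewrite ltNge; apply/negP => H.
  have n1 : (1 < n)%N.
    rewrite ltnNge; apply/negP => n1; have E : n = 1%N by move: n_gt0; lia.
    by move: H; rewrite E subrr leNgt invr_gt0 alpha_gt0.
  have b : below A (n.-1, 1)%N.
    rewrite below_inv /=; last by lia.
    by rewrite mul1r -subn1 natrB // n_gt0.
  have n1' : (0 < (n.-1, 1)%N.1 < n)%N by rewrite /=; lia.
  have := best_below_strict (path_best pt_path r_gt0) n1' b.
  have c1 : (pt v 1).2 = 1%N by rewrite pt1E.
  by rewrite c1 /=; lia.
rewrite /theta; have -> : Num.floor (- alpha^-1) = - n%:Z.
  apply: floor_def; rewrite !rmorphN /= rmorphD; lra.
by rewrite rmorphN /= opprK addrC.
Qed.

(** In terms of the deficit n c - d of a point (d, c), the line depends on theta alone. The deficit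
    is additive; it is -1 for p 0 and 0 for p 1. *)
Lemma below_theta w : (0 < w.1)%N ->
  below A w = ((n * w.2)%:R - w.1%:R <= th * w.2%:R).
Proof. by move=> w0; rewrite below_inv // thetaE natrM; lra. Qed.

Lemma theta_ge0 : 0 <= th.
Proof. by rewrite /theta subr_ge0 floor_le. Qed.

End BestLowerApproximations.

(** * The term order *)

Section LexMap.
Local Open Scope nat_scope.
Context (I : Type) (L : seq I).
Implicit Types (f g h : I -> nat).

Lemma lexi_map_add f g h :
  (([seq f i + h i | i <- L] : seqlexi nat) <= [seq g i + h i | i <- L])%O =
  (([seq f i | i <- L] : seqlexi nat) <= [seq g i | i <- L])%O.
Proof.
by elim: L => [|i L' IH] //=; rewrite !lexi_cons !leEnat !leq_add2r IH.
Qed.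

End LexMap.

Lemma lexi_map_lt (I : eqType) (R : rel I) (L : seq I) (j : I) (f g : I -> nat) :
  transitive R -> sorted R L -> j \in L -> (f j < g j)%N ->
  {in L, forall i, R i j -> f i = g i} ->
  (([seq f i | i <- L] : seqlexi nat) < [seq g i | i <- L])%O.
Proof.
move=> trR; elim: L => [//|x L IH] /= srt; rewrite inE => jL fg E.
rewrite ltxi_cons !leEnat; have [xj|xj] := eqVneq j x.
  by rewrite -xj (ltnW fg) leqNgt fg.
move: jL; rewrite (negPf xj) /= => jL.
have Exj : f x = g x.
  apply: E; first by rewrite inE eqxx.
  by move: (order_path_min trR srt) => /allP; apply.
rewrite Exj leqnn /=; apply: IH => //; first exact: path_sorted srt.
by move=> i iL; apply: E; rewrite inE iL orbT.
Qed.

Section Monomials.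
Local Open Scope nat_scope.
Context (gens : seq (nat * nat)).
Local Notation n := (size gens).
Local Notation pnt i := (nth (0, 0) gens i).
Implicit Types (m : 'X_{1..n}) (s : seq (nat * nat)).

Definition mon_lt m m' := ~~ mon_le m' m.

Lemma mon_ltE m m' : mon_lt m m' = (mon_key m < mon_key m')%O.
Proof. by rewrite /mon_lt /mon_le -ltNge. Qed.

Lemma mon_keyE m : mon_key m =
  [:: total_degree m, total_pole_order m & [seq m i | i <- rev (enum 'I_n)]].
Proof. by rewrite /mon_key map_rev. Qed.

Lemma mon_key_inj : injective (@mon_key gens).
Proof.
move=> m m'; rewrite !mon_keyE => -[_ _ /eq_in_map E]; apply/mnmP => i.
by apply: E; rewrite mem_rev mem_enum.
Qed.

Lemma mon_le_total : total (@mon_le gens).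
Proof. by move=> m m'; apply: le_total. Qed.

Lemma mon_le_trans : transitive (@mon_le gens).
Proof. by move=> m m' m''; apply: le_trans. Qed.

Lemma mon_le_anti m m' : mon_le m m' -> mon_le m' m -> m = m'.
Proof. by move=> H H'; apply: mon_key_inj; apply: le_anti; apply/andP. Qed.

Lemma mon_lt_neqAle m m' : mon_lt m m' = (m != m') && mon_le m m'.
Proof. by rewrite mon_ltE lt_neqAle (inj_eq mon_key_inj). Qed.

Lemma mon_lt_irr m : ~~ mon_lt m m. Proof. by rewrite mon_ltE ltxx. Qed.

Lemma mon_lt_trans m m' m'' : mon_lt m m' -> mon_lt m' m'' -> mon_lt m m''.
Proof. by rewrite !mon_ltE; apply: lt_trans. Qed.

Lemma mon_ltW m m' : mon_lt m m' -> mon_le m m'.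
Proof. by rewrite mon_ltE; apply: ltW. Qed.

Lemma total_degreeD m m' : total_degree (m + m')%MM = total_degree m + total_degree m'.
Proof.
by rewrite -big_split; apply: eq_bigr => i _ /=; rewrite mnmDE mulnDl.
Qed.

Lemma total_pole_orderD m m' :
  total_pole_order (m + m')%MM = total_pole_order m + total_pole_order m'.
Proof.
by rewrite -big_split; apply: eq_bigr => i _ /=; rewrite mnmDE mulnDl.
Qed.

Lemma mon_ltD m1 m2 m : mon_lt m1 m2 -> mon_lt (m1 + m)%MM (m2 + m)%MM.
Proof.
rewrite /mon_lt /mon_le !mon_keyE !lexi_cons !leEnat.
rewrite !total_degreeD !total_pole_orderD !leq_add2r.
under [in X in _ -> ~~ (_ && (_ ==> _ && (_ ==> (X <= _)%O)))]eq_map do rewrite mnmDE.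
under [in X in _ -> ~~ (_ && (_ ==> _ && (_ ==> (_ <= X)%O)))]eq_map do rewrite mnmDE.
by rewrite lexi_map_add.
Qed.

Lemma mon_leD m1 m2 m : mon_le m1 m2 -> mon_le (m1 + m)%MM (m2 + m)%MM.
Proof.
move=> H; have [->|ne] := eqVneq m1 m2; first exact: lexx.
by apply/mon_ltW/mon_ltD; rewrite mon_lt_neqAle ne.
Qed.

Lemma mon_lt_pole m m' : total_degree m = total_degree m' ->
  total_pole_order m < total_pole_order m' -> mon_lt m m'.
Proof.
move=> E H; rewrite mon_ltE !mon_keyE !ltxi_cons !leEnat E leqnn /=.
by rewrite (ltnW H) leqNgt H.
Qed.

Lemma mon_le_degree m m' : mon_le m m' -> total_degree m <= total_degree m'.
Proof. by rewrite /mon_le !mon_keyE lexi_cons !leEnat => /andP[]. Qed.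

Lemma mon_le_pole m m' : mon_le m m' -> total_degree m = total_degree m' ->
  total_pole_order m <= total_pole_order m'.
Proof.
by rewrite /mon_le !mon_keyE !lexi_cons !leEnat => + E; rewrite E leqnn /= => /andP[].
Qed.

Lemma mon_lt_exponent m m' (j : 'I_n) : total_degree m = total_degree m' ->
  total_pole_order m = total_pole_order m' -> m j < m' j ->
  (forall i : 'I_n, j < i -> m i = m' i) -> mon_lt m m'.
Proof.
move=> E1 E2 mj H; rewrite mon_ltE !mon_keyE !ltxi_cons !leEnat E1 E2 !leqnn /=.
apply: (@lexi_map_lt _ (fun a b : 'I_n => b < a) _ j) => //.
- by move=> a b c ab bc; apply: ltn_trans bc ab.
- rewrite rev_sorted; have: sorted ltn [seq val i | i <- enum 'I_n].
    by rewrite val_enum_ord iota_ltn_sorted.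
  by rewrite sorted_map.
- by rewrite mem_rev mem_enum.
by move=> i _; exact: H.
Qed.

Context (uniq_gens : uniq gens).
Context (degree_gt0 : forall p, p \in gens -> 0 < p.1).

Definition deg_of s := \sum_(p <- s) p.1.
Definition pole_of s := \sum_(p <- s) p.2.

Lemma sum_by_count (L s : seq (nat * nat)) (F : nat * nat -> nat) :
  uniq L -> {subset s <= L} ->
  \sum_(p <- s) F p = \sum_(p <- L) count_mem p s * F p.
Proof.
move=> uL; elim: s => [|q s IH] sL; first by rewrite big_nil big1.
rewrite big_cons IH; last by move=> p ps; apply: sL; rewrite inE ps orbT.
under [RHS]eq_bigr do rewrite /= mulnDl.
rewrite big_split /=; congr (_ + _).
rewrite (bigD1_seq q) //= ?eqxx ?mul1n; last by apply: sL; rewrite inE eqxx.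
by rewrite big1 ?addn0 // => p pq; rewrite eq_sym (negPf pq).
Qed.

Lemma total_degree_monom s : {subset s <= gens} ->
  total_degree (monom gens s) = deg_of s.
Proof.
move=> sg; rewrite /deg_of (sum_by_count _ uniq_gens) //.
rewrite (big_nth (0, 0)) big_mkord; apply: eq_bigr => i _.
by rewrite mnmE.
Qed.

Lemma total_pole_order_monom s : {subset s <= gens} ->
  total_pole_order (monom gens s) = pole_of s.
Proof.
move=> sg; rewrite /pole_of (sum_by_count _ uniq_gens) //.
rewrite (big_nth (0, 0)) big_mkord; apply: eq_bigr => i _.
by rewrite mnmE.
Qed.

Lemma monom_cat s s' : monom gens (s ++ s') = (monom gens s + monom gens s')%MM.
Proof. by apply/mnmP => i; rewrite mnmDE !mnmE count_cat. Qed.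

Lemma monom_gen (i : 'I_n) : monom gens [:: pnt i] = U_(i)%MM.
Proof. by apply/mnmP => j; rewrite mnm1E mnmE /= addn0 nth_uniq. Qed.

Lemma monom_perm s s' : perm_eq s s' -> monom gens s = monom gens s'.
Proof. by move=> /permP E; apply/mnmP => i; rewrite !mnmE E. Qed.

Lemma monom_inj s s' : {subset s <= gens} -> {subset s' <= gens} ->
  monom gens s = monom gens s' -> perm_eq s s'.
Proof.
move=> sg sg' /mnmP E; apply/allP => p ps; apply/eqP.
have pg : p \in gens by move: ps; rewrite mem_cat => /orP[/sg|/sg'].
have := E (Ordinal (etrans (index_mem p gens) pg)).
by rewrite !mnmE /= nth_index.
Qed.

Lemma monom_surj m : exists2 s, {subset s <= gens} & m = monom gens s.
Proof.
exists (flatten [seq nseq (m i) (pnt i) | i : 'I_n <- enum 'I_n]).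
  move=> p /flattenP[s /mapP[i _ ->]] /nseqP[-> _].
  exact: mem_nth.
apply/mnmP => j; rewrite mnmE count_flatten -map_comp sumnE big_map big_enum /=.
rewrite (bigD1 j) //= count_nseq /= eqxx mul1n big1 ?addn0 // => i ij.
by rewrite count_nseq /= nth_uniq // (inj_eq val_inj) (negPf ij).
Qed.

Lemma monom_le s s' : {subset s <= gens} -> {subset s' <= gens} ->
  (monom gens s <= monom gens s')%MM ->
  exists2 t, {subset t <= gens} & perm_eq s' (s ++ t).
Proof.
move=> sg sg' le; have [t tg Et] := monom_surj (monom gens s' - monom gens s)%MM.
exists t => //; apply: monom_inj => //.
  by move=> p; rewrite mem_cat => /orP[/sg|/tg].
by rewrite monom_cat -Et addmC submK.
Qed.

Lemma deg_of_cat s s' : deg_of (s ++ s') = deg_of s + deg_of s'.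
Proof. exact: big_cat. Qed.

Lemma pole_of_cat s s' : pole_of (s ++ s') = pole_of s + pole_of s'.
Proof. exact: big_cat. Qed.

Lemma deg_of_perm s s' : perm_eq s s' -> deg_of s = deg_of s'.
Proof. exact: perm_big. Qed.

Lemma pole_of_perm s s' : perm_eq s s' -> pole_of s = pole_of s'.
Proof. exact: perm_big. Qed.

Lemma mdeg_le_degree m : mdeg m <= total_degree m.
Proof.
rewrite mdegE; apply: leq_sum => i _; rewrite leq_pmulr //.
by apply: degree_gt0; apply: mem_nth.
Qed.

(** Smaller monomials have no larger degree, and all generators have positive degree, so only
    finitely many monomials lie below m; the induction is on their number. *)
Lemma mon_lt_ind (P : 'X_{1..n} -> Prop) :
  (forall m, (forall m', mon_lt m' m -> P m') -> P m) -> forall m, P m.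
Proof.
move=> step m; pose D := total_degree m.
suff : forall N m', total_degree m' <= D ->
    #|[set b : 'X_{1..n < D.+1} | mon_lt b m']| <= N -> P m'.
  by apply; [exact: leqnn | exact: leqnn].
elim=> [|N IH] m' Hm' HN; apply: step => m'' lt'.
  have b : mdeg m'' < D.+1.
    by rewrite ltnS; apply: leq_trans (mdeg_le_degree _) (leq_trans (mon_le_degree (mon_ltW lt'))
      Hm').
  move: HN; rewrite leqn0 cards_eq0 => /eqP/setP/(_ (BMultinom b)).
  by rewrite !inE /= lt'.
apply: IH; first exact: leq_trans (mon_le_degree (mon_ltW lt')) Hm'.
rewrite -ltnS; apply: leq_trans HN; apply: proper_card; apply/properP; split.
  by apply/subsetP => b; rewrite !inE => /mon_lt_trans; apply.
have b : mdeg m'' < D.+1.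
  by rewrite ltnS; apply: leq_trans (mdeg_le_degree _) (leq_trans (mon_le_degree (mon_ltW lt'))
    Hm').
by exists (BMultinom b); rewrite !inE //= mon_lt_irr.
Qed.

Definition point_lt (x y : nat * nat) : bool :=
  (x.1 < y.1) || (x.1 == y.1) && (x.2 < y.2).

(** At equal degree and pole order the exponents are read from the highest generator down. The first
    difference is at g, which is the top factor of s' and absent from s. *)
Lemma mon_lt_top s s' g : sorted point_le gens ->
  {subset s <= gens} -> {subset s' <= gens} ->
  deg_of s = deg_of s' -> pole_of s = pole_of s' -> g \in s' ->
  {in s, forall p, point_lt p g} -> {in s', forall p, p = g \/ point_lt p g} ->
  mon_lt (monom gens s) (monom gens s').
Proof.
move=> srt sg sg' Ed Ep gs' ltg leg; have gg := sg' _ gs'.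
pose j := Ordinal (etrans (index_mem g gens) gg).
have Ej : pnt j = g by rewrite /= nth_index.
apply: (@mon_lt_exponent _ _ j).
- by rewrite !total_degree_monom.
- by rewrite !total_pole_order_monom.
- rewrite !mnmE Ej; have -> : count_mem g s = 0.
    apply/count_memPn/negP => /ltg; rewrite /point_lt; lia.
  by rewrite -has_count has_pred1.
move=> i ji; rewrite !mnmE.
have tr : transitive point_le by move=> [a b] [c d] [e f]; rewrite /point_le /=; lia.
have le_gi : point_le g (pnt i).
  rewrite -{1}Ej; have := (sorted_ltn_nth tr (0, 0) srt); apply => //.
  - exact: ltn_ord.
  - exact: ltn_ord.
have ne : pnt i != g by rewrite -Ej nth_uniq // gtn_eqF.
have not_lt : ~ point_lt (pnt i) g.
  move: le_gi ne; case: (pnt i) => a b; case: (g) => c d.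
  by rewrite /point_le /point_lt xpair_eqE /=; lia.
rewrite !(count_memPn _) //; apply/negP.
  by case/leg => // E; rewrite E eqxx in ne.
by move/ltg.
Qed.

End Monomials.

Section LeadingMonomial.
Context (gens : seq (nat * nat)) (k : nzRingType).
Local Notation n := (size gens).
Implicit Types (p : {mpoly k[n]}).

Lemma lead_mon_supp p : p != 0 -> lead_mon p \in msupp p.
Proof.
move=> p0; rewrite /lead_mon; case E : (sort _ _) => [|m s].
  have := size_sort (@mon_le gens) (msupp p); rewrite E => /esym/size0nil.
  by move/eqP; rewrite msupp_eq0 (negPf p0).
by rewrite /= -(mem_sort (@mon_le gens)) E mem_last.
Qed.

Lemma lead_mon_max p m : m \in msupp p -> mon_le m (lead_mon p).
Proof.
move=> mp; rewrite /lead_mon; have := sort_sorted (@mon_le_total gens) (msupp p).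
move: mp; rewrite -(mem_sort (@mon_le gens)); case: (sort _ _) => [//|a s] /=.
elim: s a m => [|b s IH] a m /=; first by rewrite mem_seq1 => /eqP -> _; exact: lexx.
rewrite inE => /orP[/eqP ->|bs] /andP[ab path_s]; last exact: IH.
by apply: mon_le_trans ab _; apply: IH => //; rewrite inE eqxx.
Qed.

Lemma lead_monP p m : m \in msupp p -> {in msupp p, forall m', mon_le m' m} ->
  lead_mon p = m.
Proof.
move=> mp H; apply: mon_le_anti; last exact: lead_mon_max.
by apply: H; apply: lead_mon_supp; apply: contraTneq mp => ->; rewrite msupp0.
Qed.

End LeadingMonomial.

(** * Normal forms and the Groebner basis *)

(** The combinatorial input of the algebra. Existence, uniqueness and [nf_lt] together make a
    standard monomial the least one at its lattice point. *)
Record normal_forms (alpha : rat) (gens : seq (nat * nat))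
    (LT : seq (seq (nat * nat))) (nf : seq (nat * nat) -> Prop) : Prop := NormalForms {
  gens_uniq : uniq gens;
  gens_region : forall p, p \in gens ->
    [/\ (0 < p.1)%N, p.2 != 1%N & p.2%:R <= alpha * p.1%:R];
  leads_gens : forall M, M \in LT -> {subset M <= gens};
  nf_gens : forall s, nf s -> {subset s <= gens};
  nf_exists : forall d c : nat, c != 1%N -> c%:R <= alpha * d%:R ->
    exists s, [/\ nf s, deg_of s = d & pole_of s = c];
  nf_standard : forall s, {subset s <= gens} ->
    (forall M t, M \in LT -> ~~ perm_eq s (M ++ t)) -> nf s;
  nf_unique : forall s s', nf s -> nf s' -> deg_of s = deg_of s' ->
    pole_of s = pole_of s' -> perm_eq s s';
  nf_lt : forall s M, nf s -> M \in LT -> deg_of s = deg_of M ->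
    pole_of s = pole_of M -> mon_lt (monom gens s) (monom gens M) }.

(** * Values of monomials and the ideal of relations *)

Section Relations.
Context (k : closedFieldType) (K : fieldType) (iota : {rmorphism k -> K}).
Context (ellC : elliptic_function_field iota) (oo : place iota) (t : nat -> K).
Context (ht : forall c : nat, c != 1%N -> has_polar_divisor (t c) << c%:Z *g oo >>).
Context (alpha : rat).
Context (gens : seq (nat * nat)) (LT : seq (seq (nat * nat))).
Context (nf : seq (nat * nat) -> Prop) (hnf : normal_forms alpha gens LT nf).

Local Notation n := (size gens).
Local Notation pnt i := (nth (0, 0)%N gens i).
Local Notation D := (<< alpha *g oo >> : {freeg (place iota) / rat}).
Local Notation f := (fun i : 'I_n => section_gen D t (pnt i)).
Local Notation I := (relations f).
Implicit Types (m : 'X_{1..n}) (s M : seq (nat * nat)) (p q : {mpoly k[n]}).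

Let degree_gt0 (w : nat * nat) : w \in gens -> (0 < w.1)%N.
Proof. by case/(gens_region hnf). Qed.

Let pnt_gens (i : 'I_n) : pnt i \in gens. Proof. exact: mem_nth. Qed.

Lemma t_neq0 c : c != 1%N -> t c != 0.
Proof. by case/ht. Qed.

Lemma t_regular c : c != 1%N -> regular_off_oo oo (t c).
Proof.
case/ht => _ H P Poo; have := H P; rewrite coeffU eq_sym (negPf Poo) mulr0; lia.
Qed.

(** For c = 0 the polar divisor only says that there are no poles; that [t 0] does not vanish at oo
    comes from [regular_ord0]. *)
Lemma t_ord c : c != 1%N -> ord oo (t c) = - c%:Z.
Proof.
move=> c1; have [t0 /(_ oo)] := ht c1; rewrite coeffU eqxx mulr1.
have [c0|c0] := posnP c; last by lia.
move=> H; have -> : - c%:Z = 0 by rewrite c0.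
apply: (regular_ord0 ellC) => // P.
have [->|Poo] := eqVneq P oo; [by lia | exact: t_regular].
Qed.

Local Notation T := (mmap1 (fun i : 'I_n => t (pnt i).2)).

Lemma T_neq0 m : T m != 0.
Proof.
apply/prodf_neq0 => i _; rewrite expf_neq0 // t_neq0 //.
by case: (gens_region hnf (pnt_gens i)).
Qed.

Lemma T_regular m : regular_off_oo oo (T m).
Proof.
apply: big_ind => [P _|x y|i _]; first by rewrite Defs.ord1.
  exact: regular_offM.
apply: regular_offX; apply: t_regular.
by case: (gens_region hnf (pnt_gens i)).
Qed.

Lemma T_ord m : ord oo (T m) = - (total_pole_order m)%:Z.
Proof.
rewrite /mmap1 ord_prod => [|i]; last first.
  by rewrite expf_neq0 // t_neq0 //; case: (gens_region hnf (pnt_gens i)).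
rewrite /total_pole_order (big_morph _ PoszD (erefl _)) -sumrN.
apply: eq_bigr => i _; have [_ c1 _] := gens_region hnf (pnt_gens i).
by rewrite ordX ?t_neq0 // t_ord // PoszM -mulr_natr natz mulNr mulrC.
Qed.

Lemma section_genE (w : nat * nat) : w \in gens ->
  val (section_gen D t w) = t w.2 *: 'X^(w.1).
Proof.
move=> pg; have [_ c1 reg] := gens_region hnf pg.
rewrite /section_gen val_insubd; case: ifP => // /negP [].
apply/asboolP => d; rewrite coefZ coefXn; case: eqP => [->|_]; last first.
  by rewrite mulr0; exact: RR_0.
rewrite mulr1 => _ P; rewrite coeffMn coeffU.
have [<-|Poo] := eqVneq oo P.
  rewrite t_ord // lerN2 mulr1 floor_ge_int -mulr_natr.
  exact: reg.
by rewrite mulr0 mul0rn floor0 oppr0 t_regular // eq_sym.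
Qed.

Lemma val_mmap1 m : val (mmap1 f m) = T m *: 'X^(total_degree m).
Proof.
rewrite /mmap1 rmorph_prod.
rewrite (eq_bigr (fun i : 'I_n => (t (pnt i).2 ^+ m i) *: 'X^(m i * (pnt i).1))).
  by rewrite scaler_prod prodrXr.
move=> i _; transitivity (val (section_gen D t (pnt i)) ^+ m i); first exact: rmorphXn.
by rewrite section_genE // exprZn -exprM mulnC.
Qed.

Local Notation ev := (mmap iota (fun i : 'I_n => t (pnt i).2)).

Definition component (d : nat) p : {mpoly k[n]} :=
  \sum_(m <- msupp p | total_degree m == d) p@_m *: 'X_[m].

Lemma mcoeff_component d p m :
  (component d p)@_m = if total_degree m == d then p@_m else 0.
Proof.
rewrite raddf_sum /=; under eq_bigr do rewrite mcoeffZ mcoeffX.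
have [mp|mp] := boolP (m \in msupp p); last first.
  rewrite (memN_msupp_eq0 mp) if_same big_seq_cond big1 // => m' /andP[m'p _].
  by rewrite (_ : m' == m = false) ?mulr0 //; apply: contraNF mp => /eqP <-.
case: ifP => dm.
  rewrite big_mkcond (bigD1_seq m) ?msupp_uniq //= dm eqxx mulr1 big1 ?addr0 // => m' m'm.
  by rewrite (negPf m'm) mulr0 if_same.
rewrite big1 // => m' dm'; rewrite (_ : m' == m = false) ?mulr0 //.
by apply: contraTF dm' => /eqP ->; rewrite dm.
Qed.

(** The powers of u separate the degrees, so a relation can be tested in K one degree at a time. *)
Lemma relationsP p : I p <-> forall d, ev (component d p) = 0.
Proof.
have E d : ev (component d p) = (val (mmap (section_const D) f p))`_d.
  have -> : val (mmap (section_const D) f p) =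
      \sum_(m <- msupp p) (iota p@_m)%:P * (T m *: 'X^(total_degree m)).
    transitivity (\sum_(m <- msupp p) val (section_const D p@_m * mmap1 f m)).
      exact: rmorph_sum.
    apply: eq_bigr => m _; rewrite -val_mmap1; exact: rmorphM.
  rewrite coef_sum raddf_sum big_mkcond; apply: eq_bigr => m _.
  rewrite coefCM coefZ coefXn [_ == d]eq_sym; case: eqP => _; last by rewrite !mulr0.
  by rewrite mulr1 [LHS]mmapZ mmapX.
split=> [Ip d|H]; first by rewrite E (Ip : _ = _) coef0.
by apply: val_inj; apply/polyP => d; rewrite -E H coef0.
Qed.

Definition homogeneous_of d p := {in msupp p, forall m, total_degree m = d}.

Lemma component_id d p : homogeneous_of d p -> component d p = p.
Proof.
move=> hp; apply/mpolyP => m; rewrite mcoeff_component.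
case: eqP => // dm; apply/esym/memN_msupp_eq0/negP => mp; exact/dm/hp.
Qed.

Lemma component_homogeneous d p : homogeneous_of d (component d p).
Proof.
by move=> m; rewrite mcoeff_msupp mcoeff_component; case: ifP => [/eqP //|_]; rewrite eqxx.
Qed.

Lemma relations_homogeneous d p : homogeneous_of d p -> I p <-> ev p = 0.
Proof.
move=> hp; split=> [/relationsP /(_ d)|evp]; first by rewrite component_id.
apply/relationsP => e; have [<-|de] := eqVneq d e; first by rewrite component_id.
suff -> : component e p = 0 by rewrite raddf0.
apply/mpolyP => m; rewrite mcoeff_component mcoeff0; case: eqP => // dm.
by apply/memN_msupp_eq0/negP => /hp; rewrite dm => E; rewrite E eqxx in de.
Qed.

Lemma relations_component d p : I p -> I (component d p).
Proof.
by move=> /relationsP Ip; apply/(relations_homogeneous (@component_homogeneous d p)).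
Qed.

Lemma relations0 : I 0. Proof. exact: raddf0. Qed.

Lemma relationsD p q : I p -> I q -> I (p + q).
Proof. by rewrite /relations raddfD /= => -> ->; rewrite addr0. Qed.

Lemma relationsM p q : I q -> I (p * q).
Proof. by rewrite /relations rmorphM /= => ->; rewrite mulr0. Qed.

Lemma relationsB p q : I p -> I q -> I (p - q).
Proof. by rewrite /relations raddfB /= => -> ->; rewrite subr0. Qed.

Lemma relations_sum (J : Type) (r : seq J) (P : pred J) (F : J -> {mpoly k[n]}) :
  (forall j, P j -> I (F j)) -> I (\sum_(j <- r | P j) F j).
Proof. by move=> H; apply: big_ind => //; [exact: relations0 | exact: relationsD]. Qed.

Definition standard m := forall M, M \in LT -> ~~ (monom gens M <= m)%MM.

Definition normal_mon m := exists2 s, nf s & m = monom gens s.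

Lemma monom_degree s : nf s -> total_degree (monom gens s) = deg_of s.
Proof. by move/(nf_gens hnf); exact: total_degree_monom (gens_uniq hnf) _. Qed.

Lemma monom_pole s : nf s -> total_pole_order (monom gens s) = pole_of s.
Proof. by move/(nf_gens hnf); exact: total_pole_order_monom (gens_uniq hnf) _. Qed.

Lemma standard_normal m : standard m -> normal_mon m.
Proof.
have [s sg ->] := monom_surj (gens_uniq hnf) m => std; exists s => //.
apply: (nf_standard hnf) => // M u ML; apply: contra (std M ML) => E.
by rewrite (monom_perm gens E) monom_cat; apply: lem_addr.
Qed.

(* A lead that is a normal form would precede itself. *)
Lemma normal_not_lead s M : nf s -> M \in LT -> monom gens s != monom gens M.
Proof.
move=> ns ML; apply/eqP => E.
have P := monom_inj (nf_gens hnf ns) (leads_gens hnf ML) E.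
have := nf_lt hnf ns ML (deg_of_perm P) (pole_of_perm P).
by rewrite E (negPf (mon_lt_irr _)).
Qed.

(** A lead dividing m is replaced by the normal form at the lattice point of that lead. *)
Lemma nonstandard_lt m : ~ standard m -> exists2 m', mon_lt m' m &
  total_degree m' = total_degree m /\ total_pole_order m' = total_pole_order m.
Proof.
move=> nstd; have /existsNP[M /not_implyP[ML /negP]] := nstd.
rewrite negbK => leM; have Mg := leads_gens hnf ML.
have Ed := total_degree_monom (gens_uniq hnf) Mg.
have Ep := total_pole_order_monom (gens_uniq hnf) Mg.
(* A sum of natural numbers different from 1 could only be 1 through a summand 1, so the point of M
   is one that carries a normal form. *)
have [c1 reg] : (pole_of M != 1%N) /\ (pole_of M)%:R <= alpha * (deg_of M)%:R.
  have Mreg w : w \in M -> w.2 != 1%N /\ w.2%:R <= alpha * w.1%:R.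
    by move/Mg/(gens_region hnf) => [].
  elim: (M) Mreg {leM ML Mg Ed Ep} => [|w M' IH] Mreg.
    by rewrite /pole_of /deg_of !big_nil mulr0.
  have [w1 wr] := Mreg w (mem_head _ _).
  have [|M1 Mr] := IH; first by move=> w' w'M; apply: Mreg; rewrite inE w'M orbT.
  rewrite /pole_of /deg_of !big_cons !natrD mulrDr lerD //; split => //.
  by move: w1 M1; rewrite /pole_of; move: w.2 (\sum_(p <- M') p.2)%N => a b; lia.
have [s [ns sd sp]] := nf_exists hnf c1 reg.
have lt := nf_lt hnf ns ML sd sp.
exists (monom gens s + (m - monom gens M))%MM.
  by rewrite -{2}(submK leM) addmC [X in mon_lt _ X]addmC [X in mon_lt X _]addmC; apply: mon_ltD.
rewrite !total_degreeD !total_pole_orderD monom_degree // monom_pole //.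
by rewrite sd sp -Ed -Ep -total_degreeD -total_pole_orderD addmC submK.
Qed.

(** Repeated replacement takes any monomial at this point down to a standard one. That one is
    normal, as is m, and normal forms at one point coincide. *)
Lemma standard_min m m' : standard m -> total_degree m' = total_degree m ->
  total_pole_order m' = total_pole_order m -> m' = m \/ mon_lt m m'.
Proof.
move=> std; elim/(mon_lt_ind degree_gt0): m' => m' IH Ed Ep.
have [std'|/nonstandard_lt[m'' lt [Ed' Ep']]] := pselect (standard m'); last first.
  right; case: (IH m'' lt (etrans Ed' Ed) (etrans Ep' Ep)) => [<- //|lt''].
  exact: mon_lt_trans lt'' lt.
left; have [s ns E] := standard_normal std; have [s' ns' E'] := standard_normal std'.
move: Ed Ep; rewrite E E' !monom_degree // !monom_pole // => Ed Ep.
exact: monom_perm (nf_unique hnf ns' ns Ed Ep).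
Qed.

(* If lead_mon p were standard, it would be the only monomial of its degree and
   pole order in p, so no other term could cancel the pole of its value. *)
Lemma lead_nonstandard p : p != 0 -> I p -> ~ standard (lead_mon p).
Proof.
move=> p0 /relationsP /(_ (total_degree (lead_mon p))) + std.
have mp := lead_mon_supp p0; set m := lead_mon p in std mp *.
rewrite raddf_sum /=.
rewrite (eq_bigr (fun m => iota p@_m * T m)); last first.
  by move=> m' _; rewrite [LHS]mmapZ mmapX.
rewrite big_mkcond (bigD1_seq m) ?msupp_uniq //= eqxx => /eqP.
rewrite addr_eq0 => /eqP E.
have pm : p@_m != 0 by rewrite -mcoeff_msupp.
have: ord_ge oo (- (total_pole_order m)%:Z + 1) (iota p@_m * T m).
  rewrite E; apply: ord_geN; rewrite big_seq_cond; apply: ord_ge_sum => m' /andP[m'p m'm].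
  case: eqP => [Ed|_]; last exact: ord_ge0.
  apply: ord_geZ => _; rewrite T_ord.
  have le := lead_mon_max m'p; have leP := mon_le_pole le Ed.
  suff : (total_pole_order m' < total_pole_order m)%N by lia.
  rewrite ltn_neqAle leP andbT; apply/eqP => Ep.
  case: (standard_min std Ed Ep) => [E'|]; first by rewrite E' eqxx in m'm.
  by rewrite /mon_lt le.
rewrite /ord_ge ord_scale // mulf_neq0 ?fmorph_eq0 ?T_neq0 // T_ord => /(_ isT).
lia.
Qed.

(** Subtracting a multiple of the normal form with the pole order of y lowers the pole order; induct
    on it. *)
Lemma normal_expansion d (c : nat) y : c%:R <= alpha * d%:R ->
  regular_off_oo oo y -> ord_ge oo (- c%:Z) y ->
  exists2 h : {mpoly k[n]}, ev h = y & {in msupp h, forall m,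
    [/\ total_degree m = d, (total_pole_order m <= c)%N & normal_mon m]}.
Proof.
elim/ltn_ind: c y => c IH y reg regy ordy.
have [->|y0] := eqVneq y 0.
  by exists 0; [rewrite raddf0 | move=> m; rewrite msupp0].
have [c' c'1 Ec'] := pole_order_nat ellC y0 regy.
have c'c : (c' <= c)%N by have := ordy y0; lia.
have reg' : c'%:R <= alpha * d%:R by apply: le_trans reg; rewrite ler_nat.
have [s [ns sd sp]] := nf_exists hnf c'1 reg'.
have oT : ord oo (T (monom gens s)) = - c'%:Z by rewrite T_ord monom_pole // sp.
have [a a0 Ha] := ord_eq_sub ellC y0 (T_neq0 (monom gens s)) (etrans Ec' (esym oT)).
have regz : regular_off_oo oo (y - iota a * T (monom gens s)).
  apply: regular_offD => // P Poo; rewrite ordN.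
  by apply: regular_offZ Poo; exact: T_regular.
have [h evh Hh] : exists2 h : {mpoly k[n]}, ev h = y - iota a * T (monom gens s) &
    {in msupp h, forall m, [/\ total_degree m = d, (total_pole_order m <= c)%N & normal_mon m]}.
  have [c'0|c'0] := posnP c'.
    exists 0; last by move=> m; rewrite msupp0.
    rewrite raddf0; symmetry; apply: (ord_oo_gt0 ellC _ regz).
    by move: Ha; rewrite Ec' c'0 oppr0 add0r.
  have ltc : (c'.-1 < c)%N by lia.
  have reg1 : (c'.-1)%:R <= alpha * d%:R by apply: le_trans reg'; rewrite ler_nat leq_pred.
  have ord1 : ord_ge oo (- c'.-1%:Z) (y - iota a * T (monom gens s)).
    by move: Ha; rewrite Ec' (_ : - c'%:Z + 1 = - c'.-1%:Z) //; lia.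
  have [h evh Hh] := IH _ ltc _ reg1 regz ord1.
  exists h => // m /Hh[? ? ?]; split => //; lia.
exists (a *: 'X_[monom gens s] + h).
  by rewrite raddfD /= [X in X + _]mmapZ mmapX evh addrC subrK.
move=> m /msuppD_le; rewrite mem_cat => /orP[/msuppZ_le|/Hh //].
rewrite msuppX inE => /eqP ->; rewrite monom_degree // monom_pole // sd sp; split => //.
by exists s.
Qed.

End Relations.

Section IdealGen.
Context (k : nzRingType) (n : nat) (A : {mpoly k[n]} -> Prop).

Lemma ideal_gen_mem p : A p -> ideal_gen A p.
Proof.
move=> Ap; exists [:: (1, p)]; split; last by rewrite big_seq1 mul1r.
by move=> x; rewrite inE => /eqP ->.
Qed.

Lemma ideal_genD p q : ideal_gen A p -> ideal_gen A q -> ideal_gen A (p + q).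
Proof.
move=> [s [As ->]] [s' [As' ->]]; exists (s ++ s'); split; last by rewrite big_cat.
by move=> x; rewrite mem_cat => /orP[/As|/As'].
Qed.

Lemma ideal_gen0 : ideal_gen A 0.
Proof. by exists [::]; rewrite big_nil. Qed.

Lemma ideal_genM p q : ideal_gen A q -> ideal_gen A (p * q).
Proof.
move=> [s [As ->]]; exists [seq (p * x.1, x.2) | x <- s]; split.
  by move=> x /mapP[y ys ->] /=; apply: (As y).
by rewrite big_map mulr_sumr; apply: eq_bigr => x _; rewrite mulrA.
Qed.

End IdealGen.

(** * The Groebner basis and the minimality of its members *)

Section GroebnerBasis.
Context (k : closedFieldType) (K : fieldType) (iota : {rmorphism k -> K}).
Context (ellC : elliptic_function_field iota) (oo : place iota) (t : nat -> K).
Context (ht : forall c : nat, c != 1%N -> has_polar_divisor (t c) << c%:Z *g oo >>).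
Context (alpha : rat).
Context (gens : seq (nat * nat)) (LT : seq (seq (nat * nat))).
Context (nf : seq (nat * nat) -> Prop) (hnf : normal_forms alpha gens LT nf).

Local Notation n := (size gens).
Local Notation pnt i := (nth (0, 0)%N gens i).
Local Notation D := (<< alpha *g oo >> : {freeg (place iota) / rat}).
Local Notation f := (fun i : 'I_n => section_gen D t (pnt i)).
Local Notation I := (relations f).
Local Notation ev := (mmap iota (fun i : 'I_n => t (pnt i).2)).
Implicit Types (m b : 'X_{1..n}) (s M : seq (nat * nat)) (p q g h : {mpoly k[n]}).

Let degree_gt0 (w : nat * nat) : w \in gens -> (0 < w.1)%N.
Proof. by case/(gens_region hnf). Qed.

Lemma pole_order_region m : 
  total_pole_order m != 1%N /\ (total_pole_order m)%:R <= alpha * (total_degree m)%:R.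
Proof.
split.
  have [c c1] := pole_order_nat ellC (T_neq0 ht hnf m) (T_regular ht hnf m).
  by rewrite (T_ord ellC ht hnf) => /oppr_inj [->].
rewrite /total_pole_order /total_degree !natr_sum mulr_sumr; apply: ler_sum => i _.
have [_ _ reg] := gens_region hnf (mem_nth (0, 0)%N (ltn_ord i)).
by rewrite !natrM mulrCA ler_wpM2l.
Qed.

(** The normal form s at the point of m is kept apart from the lower tail h: it becomes the lead
    once the monomials m of two such relations cancel in a syzygy. *)
Definition is_relation m g := exists s (a : k) h, [/\ nf s, a != 0,
  g = 'X_[m] - a *: 'X_[monom gens s] - h,
  deg_of s = total_degree m /\ pole_of s = total_pole_order m &
  I g /\ {in msupp h, forall m', [/\ total_degree m' = total_degree m,
    (total_pole_order m' < total_pole_order m)%N & normal_mon nf m']}].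

Lemma exists_relation m : exists g, is_relation m g.
Proof.
have [c1 reg] := pole_order_region m.
have [s [ns sd sp]] := nf_exists hnf c1 reg.
have Ed := monom_degree hnf ns; have Ep := monom_pole hnf ns.
have oTm := T_ord ellC ht hnf m; have oTs := T_ord ellC ht hnf (monom gens s).
rewrite Ep sp -oTm in oTs.
have [a a0 Ha] := ord_eq_sub ellC (T_neq0 ht hnf m) (T_neq0 ht hnf _) (esym oTs).
set y := _ - _ in Ha.
have regy : regular_off_oo oo y.
  apply: regular_offD; first exact: (T_regular ht hnf).
  move=> P Poo; rewrite ordN; apply: regular_offZ Poo; exact: (T_regular ht hnf).
have [h evh Hh] : exists2 h, ev h = y & {in msupp h, forall m', 
    [/\ total_degree m' = total_degree m,
    (total_pole_order m' < total_pole_order m)%N & normal_mon nf m']}.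
  have [c0|c0] := posnP (total_pole_order m).
    exists 0; last by move=> m'; rewrite msupp0.
    rewrite raddf0; symmetry; apply: (ord_oo_gt0 ellC _ regy).
    by move: Ha; rewrite oTm c0 oppr0 add0r.
  have reg' : ((total_pole_order m).-1)%:R <= alpha * (total_degree m)%:R.
    by apply: le_trans reg; rewrite ler_nat leq_pred.
  have ordy : ord_ge oo (- (total_pole_order m).-1%:Z) y.
    by move: Ha; rewrite oTm (_ : - (total_pole_order m)%:Z + 1 = - (total_pole_order m).-1%:Z)
      //; lia.
  have [h evh Hh] := normal_expansion ellC ht hnf reg' regy ordy.
  by exists h => // m' /Hh[? ? ?]; split => //; lia.
exists ('X_[m] - a *: 'X_[monom gens s] - h), s, a, h; split => //; split => //.
apply/(relations_homogeneous ellC ht hnf (d := total_degree m)).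
  move=> m' /msuppB_le; rewrite mem_cat => /orP[/msuppB_le|/Hh[] //].
  rewrite mem_cat => /orP[|/msuppZ_le]; rewrite msuppX inE => /eqP -> //.
  by rewrite Ed.
by rewrite !raddfB /= [X in _ - X - _]mmapZ !mmapX evh subrr.
Qed.

Lemma is_relation_supp M g : M \in LT -> is_relation (monom gens M) g ->
  g@_(monom gens M) = 1 /\
  {in msupp g, forall m, m = monom gens M \/
    [/\ normal_mon nf m, total_degree m = total_degree (monom gens M) & mon_lt m (monom gens M)]}.
Proof.
move=> ML [s [a [h [ns a0 -> [sd sp] [_ Hh]]]]].
have Mg := leads_gens hnf ML.
rewrite (total_degree_monom (gens_uniq hnf)) // in sd.
rewrite (total_pole_order_monom (gens_uniq hnf)) // in sp.
have lt := nf_lt hnf ns ML sd sp.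
split.
  rewrite !mcoeffB mcoeffZ !mcoeffX eqxx (negPf (normal_not_lead hnf ns ML)) mulr0 subr0.
  rewrite memN_msupp_eq0 ?subr0 //; apply/negP => /Hh[_ _ [s' ns' E]].
  by have := normal_not_lead hnf ns' ML; rewrite E eqxx.
move=> m /msuppB_le; rewrite mem_cat => /orP[/msuppB_le|/Hh[Ed Ep nm]].
  rewrite mem_cat => /orP[|/msuppZ_le]; rewrite msuppX inE => /eqP ->; first by left.
  by right; split => //; [exists s | rewrite (monom_degree hnf) // (total_degree_monom (gens_uniq
    hnf))].
by right; split => //; exact: mon_lt_pole.
Qed.

Lemma is_relation_lead M g : M \in LT -> is_relation (monom gens M) g ->
  [/\ g != 0, lead_mon g = monom gens M & homogeneous_of (total_degree (monom gens M)) g].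
Proof.
move=> ML /(is_relation_supp ML)[g1 supp].
have inM : monom gens M \in msupp g by rewrite mcoeff_msupp g1 oner_neq0.
split.
- by apply: contraTneq inM => ->; rewrite msupp0.
- by apply: lead_monP => // m /supp[->|[_ _ /mon_ltW //]]; exact: lexx.
- by move=> m /supp[->|[]].
Qed.

(* The degree part of q containing b would have a lead that is divisible by a
   member of LT and has at least the pole order of b. *)
Lemma relation_coeff0 b q : I q ->
  (forall M s, M \in LT -> {subset s <= gens} -> deg_of (M ++ s) = total_degree b ->
     (pole_of (M ++ s) < total_pole_order b)%N) -> q@_b = 0.
Proof.
move=> Iq Hb; apply/eqP/negPn/negP => qb.
pose p := component (total_degree b) q.
have pb : b \in msupp p by rewrite mcoeff_msupp mcoeff_component eqxx.
have p0 : p != 0 by apply: contraTneq pb => ->; rewrite msupp0.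
have Ip : I p by exact: (relations_component ellC ht hnf).
have := lead_nonstandard ellC ht hnf p0 Ip; apply => M ML; apply/negP.
have [s sg Es] := monom_surj (gens_uniq hnf) (lead_mon p); rewrite Es => le.
have [u ug /(monom_perm gens) E] := monom_le (gens_uniq hnf) (leads_gens hnf ML) sg le.
have Mug : {subset M ++ u <= gens}.
  by move=> w; rewrite mem_cat => /orP[/(leads_gens hnf ML)|/ug].
have Ed : deg_of (M ++ u) = total_degree b.
  rewrite -(total_degree_monom (gens_uniq hnf)) // -E -Es.
  exact: (component_homogeneous (lead_mon_supp p0)).
have := Hb M u ML ug Ed.
rewrite ltnNge -(total_pole_order_monom (gens_uniq hnf)) // -E -Es mon_le_pole //.
  exact: lead_mon_max.
by rewrite Es E (total_degree_monom (gens_uniq hnf)).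
Qed.

(** [bx] marks the leads without a minimal relation. For such a lead M, two unmarked relations with
    leads M1 and M2 are combined: their leads cancel after multiplication by variables, and the
    surviving normal form times a variable is M. *)
Context (bx : pred 'X_{1..n}).
Context (lead_size : forall M, M \in LT -> (1 < size M)%N).
Context (generator_extremal : forall w M s, w \in gens -> M \in LT ->
  {subset s <= gens} -> deg_of (M ++ s) = w.1 -> (pole_of (M ++ s) < w.2)%N).
Context (minimal_leads : forall M, M \in LT -> ~~ bx (monom gens M) ->
  size M = 2%N \/ forall M', M' \in LT -> (deg_of M <= deg_of M')%N).
Context (nonminimal_leads : forall M, M \in LT -> bx (monom gens M) ->
  exists (i j : 'I_n) M1 M2 s1 s2,
  [/\ M1 \in LT /\ ~~ bx (monom gens M1), M2 \in LT /\ ~~ bx (monom gens M2),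
      [/\ nf s1, deg_of s1 = deg_of M1 & pole_of s1 = pole_of M1],
      [/\ nf s2, deg_of s2 = deg_of M2 & pole_of s2 = pole_of M2] &
      [/\ monom gens M = (U_(i) + monom gens s1)%MM,
          (U_(i) + monom gens M1 = U_(j) + monom gens M2)%MM &
          mon_lt (U_(j) + monom gens s2)%MM (monom gens M)]]).

(** A proper divisor of a lead of size 2 is 1 or a generator, and generators are kept out of
    relations by extremality; a proper divisor of a lead of least degree is excluded by its degree
    alone. *)
Lemma minimal_lead_coeff0 M b q : M \in LT -> ~~ bx (monom gens M) -> I q ->
  (b <= monom gens M)%MM -> b != monom gens M -> q@_b = 0.
Proof.
move=> ML nbx Iq le ne; have Mg := leads_gens hnf ML.
have [u ug Eu] := monom_surj (gens_uniq hnf) b.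
have leM : (monom gens u <= monom gens M)%MM by rewrite -Eu.
have [w wg permM] := monom_le (gens_uniq hnf) ug Mg leM.
have w0 : (0 < size w)%N.
  case: w permM {wg} => [|//]; rewrite cats0 => /(monom_perm gens) E.
  by rewrite Eu E eqxx in ne.
have degs s : {subset s <= gens} -> (0 < size s)%N -> (0 < deg_of s)%N.
  case: s => [//|x s] sg _; rewrite /deg_of big_cons addn_gt0 degree_gt0 //.
  by apply: sg; rewrite inE eqxx.
have szM : size M = (size u + size w)%N by rewrite (perm_size permM) size_cat.
have degM := deg_of_perm permM; rewrite deg_of_cat in degM.
have degw := degs w wg w0.
rewrite Eu; apply: relation_coeff0 => // M' s M'L sg.
rewrite (total_degree_monom (gens_uniq hnf)) // (total_pole_order_monom (gens_uniq hnf)) //.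
have degM' := degs M' (leads_gens hnf M'L) (ltnW (lead_size M'L)).
case: (minimal_leads ML nbx) => [sz2|minM].
  case: u {Eu leM permM degM} ug szM => [|x u] ug szM;
    first by rewrite deg_of_cat [in deg_of [::]]/deg_of big_nil; lia.
  case: u ug szM => [|y u] ug szM; last by case: (w) w0 szM => [//|z w'] _;
    rewrite sz2 /= ?addnS ?addSn.
  rewrite {2}/deg_of {2}/pole_of !big_seq1; apply: generator_extremal => //.
  by apply: ug; rewrite inE eqxx.
by have := minM M' M'L; rewrite deg_of_cat; lia.
Qed.

Lemma minimal_lead_coeffM0 M x q : M \in LT -> ~~ bx (monom gens M) -> I q ->
  x@_0 = 0 -> (x * q)@_(monom gens M) = 0.
Proof.
move=> ML nbx Iq x0; rewrite mcoeffM big1 // => [[k1 k2]] /= /eqP.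
move: (k1 : 'X_{1..n}) (k2 : 'X_{1..n}) => u v E {k1 k2}.
have [u0|u0] := eqVneq u 0%MM; first by rewrite u0 x0 mul0r.
rewrite (minimal_lead_coeff0 ML nbx Iq) ?mulr0 // E; first exact: lem_addl.
by rewrite -{1}[v]add0m (inj_eq (@addIm _ _)) eq_sym.
Qed.

(** Unmarked leads receive their relation, marked ones the syzygy. A marked member is then visibly
    in the maximal ideal times the ideal of relations; an unmarked one is not, because its lead has
    coefficient 0 throughout that product. *)
Lemma exists_groebner_basis : exists G : seq {mpoly k[n]},
  [/\ groebner_basis I G, {in G, forall g, homogeneous g},
      perm_eq [seq lead_mon g | g <- G] [seq monom gens M | M <- LT],
      {in G, forall g, minimal_relation I g <-> ~~ bx (lead_mon g)} &
      minimal_generating_set I (fun g => g \in G /\ minimal_relation I g)].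
Proof.
have [rel Hrel] := choice exists_relation.
pose good M g := [/\ g != 0, lead_mon g = monom gens M, I g,
  homogeneous_of (total_degree (monom gens M)) g &
  if ~~ bx (monom gens M) then g = rel (monom gens M) else
  exists (i j : 'I_n) M1 M2, [/\ M1 \in LT /\ ~~ bx (monom gens M1),
    M2 \in LT /\ ~~ bx (monom gens M2) &
    g = 'X_i * rel (monom gens M1) - 'X_j * rel (monom gens M2)]].
have Irel M : I (rel (monom gens M)).
  by have [s [a [h [_ _ _ _ []]]]] := Hrel (monom gens M).
have [gM HgM] : exists gM, forall M, M \in LT -> good M (gM M).
  suff /choice [gM H] : forall M, exists g, M \in LT -> good M g by exists gM.
  move=> M; have [ML|ML] := boolP (M \in LT); last by exists 0.
  have [bxM|nbx] := boolP (bx (monom gens M)); last first.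
    exists (rel (monom gens M)) => _; rewrite /good nbx.
    have [g0 lg hg] := is_relation_lead ML (Hrel _).
    by split.
  have [i [j [M1 [M2 [s1 [s2 [[M1L nbx1] [M2L nbx2] [ns1 sd1 sp1] [ns2 sd2 sp2] [EM E12
    lt]]]]]]]] := nonminimal_leads ML bxM.
  exists ('X_i * rel (monom gens M1) - 'X_j * rel (monom gens M2)) => _.
  rewrite /good bxM /=; set g := _ - _.
  have [r1 [a1 [h1 [nr1 a10 Er1 [rd1 rp1] [_ Hh1]]]]] := Hrel (monom gens M1).
  have [r2 [a2 [h2 [nr2 a20 Er2 [rd2 rp2] [_ Hh2]]]]] := Hrel (monom gens M2).
  rewrite (total_degree_monom (gens_uniq hnf) (leads_gens hnf M1L)) -sd1 in rd1.
  rewrite (total_pole_order_monom (gens_uniq hnf) (leads_gens hnf M1L)) -sp1 in rp1.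
  rewrite (total_degree_monom (gens_uniq hnf) (leads_gens hnf M2L)) -sd2 in rd2.
  rewrite (total_pole_order_monom (gens_uniq hnf) (leads_gens hnf M2L)) -sp2 in rp2.
  have Es1 := monom_perm gens (nf_unique hnf nr1 ns1 rd1 rp1).
  have Es2 := monom_perm gens (nf_unique hnf nr2 ns2 rd2 rp2).
  rewrite Es1 in Er1; rewrite Es2 in Er2.
  (* The terms at U_i + M1 = U_j + M2 cancel, and U_i + s1 is M, which dominates the rest. *)
  have Eg : g = - (a1 *: 'X_[monom gens M]) + a2 *: 'X_[U_(j) + monom gens s2] -
      ('X_i * h1) + 'X_j * h2.
    rewrite /g Er1 Er2 EM !mulrBr -!scalerAr -!mpolyXD E12.
    set A1 := 'X_[_ + monom _ M2]; set A2 := 'X_[_ + monom _ s1].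
    set A3 := 'X_[_ + monom _ s2].
    by rewrite !opprB; ring.
  have degM : total_degree (monom gens M) = (total_degree U_(i)%MM + total_degree (monom gens
    M1))%N.
    rewrite EM total_degreeD (total_degree_monom (gens_uniq hnf) (nf_gens hnf ns1)) sd1.
    by rewrite (total_degree_monom (gens_uniq hnf) (leads_gens hnf M1L)).
  have poleM : total_pole_order (monom gens M) = (total_pole_order U_(i)%MM + total_pole_order
    (monom gens M1))%N.
    rewrite EM total_pole_orderD (total_pole_order_monom (gens_uniq hnf) (nf_gens hnf ns1)) sp1.
    by rewrite (total_pole_order_monom (gens_uniq hnf) (leads_gens hnf M1L)).
  have degM2 : total_degree (monom gens M) = (total_degree U_(j)%MM + total_degree (monom gens
    M2))%N.
    by rewrite degM -!total_degreeD E12.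
  have poleM2 : total_pole_order (monom gens M) = (total_pole_order U_(j)%MM + total_pole_order
    (monom gens M2))%N.
    by rewrite poleM -!total_pole_orderD E12.
  have Hlow (l : 'I_n) M' h' : total_degree (monom gens M) = (total_degree U_(l)%MM +
    total_degree (monom gens M'))%N ->
      total_pole_order (monom gens M) = (total_pole_order U_(l)%MM + total_pole_order (monom gens
        M'))%N ->
      {in msupp h', forall m', [/\ total_degree m' = total_degree (monom gens M'),
        (total_pole_order m' < total_pole_order (monom gens M'))%N & normal_mon nf m']} ->
      {in msupp ('X_l * h'), forall m,
        total_degree m = total_degree (monom gens M) /\ mon_lt m (monom gens M)}.
    move=> Ed Ep Hh' m; rewrite mulrC (perm_mem (msuppMX _ _)) => /mapP[m' /Hh'[Ed' Ep' _] ->].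
    have E : total_degree (U_(l) + m')%MM = total_degree (monom gens M).
      by rewrite total_degreeD Ed' Ed.
    split => //; apply: mon_lt_pole => //.
    by rewrite total_pole_orderD Ep; lia.
  have supp m : m \in msupp g -> m = monom gens M \/
      total_degree m = total_degree (monom gens M) /\ mon_lt m (monom gens M).
    rewrite Eg => /msuppD_le; rewrite mem_cat => /orP[/msuppB_le|]; last first.
      by move/(Hlow _ _ _ degM2 poleM2 Hh2); right.
    rewrite mem_cat => /orP[/msuppD_le|]; last by move/(Hlow _ _ _ degM poleM Hh1); right.
    rewrite mem_cat (perm_mem (msuppN _)) => /orP[/msuppZ_le|/msuppZ_le];
      rewrite msuppX inE => /eqP ->; first by left.
    right; split => //; rewrite degM2 total_degreeD (total_degree_monom (gens_uniq hnf) (nf_gens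
      hnf ns2)).
    by rewrite sd2 (total_degree_monom (gens_uniq hnf) (leads_gens hnf M2L)).
  have inM : monom gens M \in msupp g.
    rewrite mcoeff_msupp Eg !mcoeffD !mcoeffN !mcoeffZ !mcoeffX eqxx mulr1.
    have -> : (U_(j) + monom gens s2 == monom gens M)%MM = false.
      by apply: contraTF lt => /eqP ->; rewrite (negPf (mon_lt_irr _)).
    have -> : ('X_i * h1)@_(monom gens M) = 0.
      apply/memN_msupp_eq0/negP => /(Hlow _ _ _ degM poleM Hh1)[_].
      by rewrite (negPf (mon_lt_irr _)).
    have -> : ('X_j * h2)@_(monom gens M) = 0.
      apply/memN_msupp_eq0/negP => /(Hlow _ _ _ degM2 poleM2 Hh2)[_].
      by rewrite (negPf (mon_lt_irr _)).
    by rewrite mulr0 oppr0 !addr0 oppr_eq0.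
  split.
  - by apply: contraTneq inM => ->; rewrite msupp0.
  - by apply: lead_monP => // m /supp[->|[_ /mon_ltW //]]; exact: lexx.
  - by apply: relationsB; apply: relationsM.
  - by move=> m /supp[->|[]].
  - by exists i, j, M1, M2.
exists [seq gM M | M <- LT].
have minP : {in [seq gM M | M <- LT], forall g, minimal_relation I g <-> ~~ bx (lead_mon g)}.
  move=> _ /mapP[M ML ->]; have [g0 lg Ig hg] := HgM M ML; rewrite lg.
  have [bxM [i [j [M1 [M2 [_ _ Eg]]]]]|nbx Eg] /= := boolP (bx (monom gens M)).
    (* Subtracting two separate choices covers the case i = j as well. *)
    split => // -[_ []]; exists (fun l => (if l == i then rel (monom gens M1) else 0) -
      (if l == j then rel (monom gens M2) else 0)); split.
      by move=> l; apply: relationsB; case: ifP => // _; exact: relations0.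
    under eq_bigr do rewrite mulrBr.
    rewrite sumrB Eg; congr (_ - _).
      rewrite (bigD1 i) //= eqxx big1 ?addr0 // => l /negPf ->; exact: mulr0.
    rewrite (bigD1 j) //= eqxx big1 ?addr0 // => l /negPf ->; exact: mulr0.
  split => // _; split => // -[q [Iq Eq]].
  (* M has coefficient 1 in its own relation, but 0 in each product of a variable with a
     relation. *)
  have [c1 _] := is_relation_supp ML (Hrel (monom gens M)).
  move: c1; rewrite -Eg Eq raddf_sum /= big1 => [/esym/eqP|l _].
    by rewrite oner_eq0.
  apply: minimal_lead_coeffM0 => //.
  by rewrite mcoeffX mnm1_eq0.
pose A g := g \in [seq gM M | M <- LT] /\ minimal_relation I g.
(* The syzygies are combinations of unmarked members, so the minimal members generate everything
   that the whole basis does. *)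
have GA g : g \in [seq gM M | M <- LT] -> ideal_gen A g.
  have nbxA M : M \in LT -> ~~ bx (monom gens M) -> ideal_gen A (rel (monom gens M)).
    move=> ML nbx; have [_ lg _ _] := HgM M ML; rewrite nbx => Eg.
    apply: ideal_gen_mem; have gG : gM M \in [seq gM M | M <- LT] by exact: map_f.
    by rewrite /A -Eg; split => //; apply/(minP _ gG); rewrite lg.
  case/mapP => M ML ->; have [_ _ _ _] := HgM M ML.
  case: ifP => [nbx ->|_ [i [j [M1 [M2 [[M1L n1] [M2L n2] ->]]]]]]; first exact: nbxA.
  rewrite -mulNr; apply: ideal_genD; apply: ideal_genM; exact: nbxA.
split => //.
- split=> [_ /mapP[M ML ->]|p p0 Ip]; first by have [] := HgM M ML.
  have /existsNP[M /not_implyP[ML /negP]] := lead_nonstandard ellC ht hnf p0 Ip.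
  rewrite negbK => le; exists (gM M); first exact: map_f.
  by have [_ -> _ _ _] := HgM M ML.
- by move=> _ /mapP[M ML ->] m m' mg m'g; have [_ _ _ hg _] := HgM M ML; rewrite !hg.
- rewrite -map_comp; apply/permP => x; congr (count _ _); apply/eq_in_map => M ML.
  by have [_ lg _ _ _] := HgM M ML.
split.
  move=> p; split; last first.
    case=> s [As ->]; rewrite big_seq; apply: relations_sum => x xs.
    by apply: relationsM; have [_ []] := As x xs.
  move=> Ip; have [->|p0] := eqVneq p 0; first exact: ideal_gen0.
  (* Division by the basis: cancel the lead of p and recurse along the term order. *)
  move Em : (lead_mon p) => m; elim/(mon_lt_ind degree_gt0): m p Ip p0 Em => m IH p Ip p0 Em.
  have /existsNP[M /not_implyP[ML /negP]] := lead_nonstandard ellC ht hnf p0 Ip.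
  rewrite negbK Em => le; have [g0 lg Ig _ _] := HgM M ML.
  have gG : gM M \in [seq gM M | M <- LT] by exact: map_f.
  have gl : (gM M)@_(monom gens M) != 0 by rewrite -mcoeff_msupp -lg lead_mon_supp.
  pose d := (m - monom gens M)%MM; have md : m = (d + monom gens M)%MM by rewrite submK.
  pose x : {mpoly k[n]} := (p@_m / (gM M)@_(monom gens M)) *: 'X_[d].
  pose p' := p - x * gM M.
  have Ip' : I p' by apply: relationsB => //; apply: relationsM.
  have -> : p = p' + x * gM M by rewrite subrK.
  apply: ideal_genD; last exact/ideal_genM/GA.
  have [->|p'0] := eqVneq p' 0; first exact: ideal_gen0.
  have coef_m : p'@_m = 0.
    have E : ('X_[d] * gM M)@_m = (gM M)@_(monom gens M) by rewrite md mulrC mcoeffMX.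
    by rewrite mcoeffB -scalerAl mcoeffZ E divfK // subrr.
  apply: (IH (lead_mon p')) => //; rewrite mon_lt_neqAle; apply/andP; split.
    by apply: contraTneq (lead_mon_supp p'0) => ->; rewrite mcoeff_msupp coef_m eqxx.
  have := lead_mon_supp p'0; move/msuppB_le; rewrite mem_cat => /orP[pm|].
    by rewrite -Em lead_mon_max.
  rewrite -scalerAl => /msuppZ_le; rewrite mulrC (perm_mem (msuppMX _ _)).
  case/mapP => m' m'g ->; rewrite md ![(d + _)%MM]addmC; apply: mon_leD.
  by rewrite -lg lead_mon_max.
(* Irredundance: in a combination of other members, nonconstant multipliers contribute nothing at M,
   and constant ones would need M in the support of another member, where it is neither the lead nor
   a normal form. *)
move=> g [/mapP[M ML Egm] ming] [s [As Es]].
have [_ lg _ _] := HgM M ML.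
have nbx : ~~ bx (monom gens M).
  by rewrite -lg -Egm; apply/minP => //; rewrite Egm map_f.
rewrite nbx => Eg; have [c1 _] := is_relation_supp ML (Hrel (monom gens M)).
move: c1; rewrite -Eg -Egm Es raddf_sum big_seq big1 /= => [/esym/eqP|x xs].
  by rewrite oner_eq0.
have [[xG minx] xg] := As x xs; have Ix : I x.2 by case: minx.
have -> : x.1 = (x.1 - (x.1@_0)%:MP) + (x.1@_0)%:MP by rewrite subrK.
rewrite mulrDl mcoeffD minimal_lead_coeffM0 // ?add0r; last first.
  by rewrite mcoeffB mcoeffC eqxx mulr1 subrr.
rewrite mcoeffCM; case/mapP: xG => M' M'L Ex.
have [_ lx _ _] := HgM M' M'L.
have -> : ~~ bx (monom gens M') by rewrite -lx -Ex; apply/minP => //; rewrite Ex map_f.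
move=> Ex'; have [_ supp] := is_relation_supp M'L (Hrel (monom gens M')).
rewrite [x.2@_ _]memN_msupp_eq0 ?mulr0 //; apply/negP; rewrite Ex Ex' => /supp[E|[[s' ns' E] _ _]].
  by apply: xg; rewrite Egm Ex Ex' Eg E.
by have := normal_not_lead hnf ns' ML; rewrite E eqxx.
Qed.

End GroebnerBasis.

Local Open Scope nat_scope.

(** * Normal forms along the path of best lower approximations *)

Lemma deg_of_cons x s : deg_of (x :: s) = x.1 + deg_of s.
Proof. exact: big_cons. Qed.

Lemma pole_of_cons x s : pole_of (x :: s) = x.2 + pole_of s.
Proof. exact: big_cons. Qed.

Lemma deg_of_nil : deg_of [::] = 0. Proof. exact: big_nil. Qed.

Lemma pole_of_nil : pole_of [::] = 0. Proof. exact: big_nil. Qed.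

Lemma deg_of_nseq a x : deg_of (nseq a x) = a * x.1.
Proof. by rewrite /deg_of big_nseq iter_addn_0 mulnC. Qed.

Lemma pole_of_nseq a x : pole_of (nseq a x) = a * x.2.
Proof. by rewrite /pole_of big_nseq iter_addn_0 mulnC. Qed.

Definition of_wtE := (deg_of_cat, pole_of_cat, deg_of_cons, pole_of_cons,
  deg_of_nil, pole_of_nil, deg_of_nseq, pole_of_nseq).

Lemma perm_nseq2 (x y : nat * nat) s : x != y -> {subset s <= [:: x; y]} ->
  perm_eq s (nseq (count_mem x s) x ++ nseq (count_mem y s) y).
Proof.
move=> xy sxy; apply/allP => z _; apply/eqP; rewrite count_cat !count_nseq /=.
have [E|zx] := eqVneq x z.
  by rewrite -E [y == x]eq_sym (negPf xy) mul1n addn0.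
have [->|zy] := eqVneq y z; first by rewrite mul1n.
rewrite addn0; apply/count_memPn/negP => /sxy; rewrite !inE.
by rewrite ![z == _]eq_sym (negPf zx) (negPf zy).
Qed.

Lemma slope_lt_trans (x y z : nat * nat) : x.2 * y.1 < y.2 * x.1 ->
  y.2 * z.1 < z.2 * y.1 -> x.2 * z.1 < z.2 * x.1.
Proof.
move: x y z => [d1 c1] [d2 c2] [d3 c3] /= H1 H2.
have d1_gt0 : 0 < d1 by case: d1 H1 => //; rewrite muln0.
have d2_gt0 : 0 < d2 by case: d2 H2 {H1} => //; rewrite muln0.
rewrite -(ltn_pmul2r d2_gt0) mulnAC; apply: (@leq_ltn_trans (c2 * d1 * d3)).
  by rewrite leq_mul2r (ltnW H1) orbT.
by rewrite mulnAC [X in _ < X]mulnAC ltn_pmul2r.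
Qed.

Section ConeData.
Context (A : nat * nat) (r : nat) (p : nat -> nat * nat) (hp : approx_path A r p).
Context (gens : seq (nat * nat)) (LT : seq (seq (nat * nat))).

(* The generators are the low ones, in L, together with p i for i >= i0. The
   leads in LTlow only involve low generators; the other ones are the products
   of some p i, i >= i0, with all the smaller generators except p (i - 1). The
   low normal forms cover the lattice points of slope at most that of p 2. *)
Record cone_data (i0 : nat) (L : seq (nat * nat)) (LTlow : seq (seq (nat * nat)))
    (low : seq (nat * nat) -> Prop) : Prop := ConeData {
  cd_i0 : 2 < i0;
  cd_uniq : uniq gens;
  cd_sorted : sorted point_le gens;
  cd_mem : forall w, w \in gens <-> w \in L \/ exists2 i, i0 <= i <= r & w = p i;
  cd_LT : forall M, M \in LT <-> M \in LTlow \/ exists i g, [/\ i0 <= i <= r,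
    M = [:: p i; g], g \in L \/ exists2 j, i0 <= j < i & g = p j & g != p i.-1];
  cd_L : forall w, w \in L -> [/\ 0 < w.1, w.2 != 1 & below A w];
  cd_pred : forall j, 2 <= j < i0 -> j <= r -> p j \in L;
  cd_slope : forall g, i0 <= r -> g \in L -> g != p i0.-1 ->
    g.2 * (p i0.-1).1 < (p i0.-1).2 * g.1;
  cd_lt : forall g, i0 <= r -> g \in L -> point_lt g (p i0);
  cd_low : forall s, low s -> {subset s <= L};
  cd_exists : forall d c, below A (d, c) -> c != 1 ->
    (1 < r -> c * (p 2).1 <= (p 2).2 * d) ->
    exists s, [/\ low s, deg_of s = d & pole_of s = c];
  cd_below : forall s, low s -> 1 < r -> pole_of s * (p 2).1 <= (p 2).2 * deg_of s;
  cd_unique : forall s s', low s -> low s' -> deg_of s = deg_of s' ->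
    pole_of s = pole_of s' -> perm_eq s s';
  cd_std : forall s, {subset s <= L} ->
    (forall M t, M \in LTlow -> ~~ perm_eq s (M ++ t)) ->
    low s \/ exists a b, [/\ 2 < r, 0 < b & perm_eq s (nseq a (p 2) ++ nseq b (p 3))];
  cd_LTlow : forall M, M \in LTlow -> {subset M <= L};
  cd_lower : forall M, M \in LTlow -> exists s g, [/\ low s, deg_of s = deg_of M,
    pole_of s = pole_of M, g \in M &
    {in s, forall w, point_lt w g} /\ {in M, forall w, w = g \/ point_lt w g}] }.

Context (i0 : nat) (L : seq (nat * nat)) (LTlow : seq (seq (nat * nat))).
Context (low : seq (nat * nat) -> Prop) (cd : cone_data i0 L LTlow low).

Definition high s := exists l a b, [/\ 2 <= l < r, 0 < b &
  perm_eq s (nseq a (p l) ++ nseq b (p l.+1))].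

Definition normal s := high s \/ low s.

Lemma path_point_lt i j : i < j <= r -> point_lt (p i) (p j).
Proof.
move=> ij; have := path_snd_lt hp ij; have : (p i).1 <= (p j).1 by apply: (path_fst_le hp); lia.
by rewrite /point_lt; lia.
Qed.

Lemma path_gens i : 2 <= i <= r -> p i \in gens.
Proof.
move=> ir; apply/(cd_mem cd); have [ii0|i0i] := ltnP i i0.
  by left; apply: (cd_pred cd); lia.
by right; exists i => //; lia.
Qed.

Lemma normal_gens s : normal s -> {subset s <= gens}.
Proof.
case=> [[l [a [b [lr b0 ps]]]] w|/(cd_low cd) sL w /sL wL]; last first.
  by apply/(cd_mem cd); left.
rewrite (perm_mem ps) mem_cat => /orP[] /nseqP[-> _]; apply: path_gens; lia.
Qed.

Lemma gens_below (w : nat * nat) : w \in gens -> [/\ 0 < w.1, w.2 != 1 & below A w].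
Proof.
case/(cd_mem cd) => [/(cd_L cd) //|[i ir ->]]; have i2 := cd_i0 cd.
split; [apply: (path_gt0 hp) | | apply: (path_below hp)]; try lia.
have : (p 1).2 < (p i).2 by apply: (path_snd_lt hp); lia.
have : (p 0).2 < (p 1).2 by apply: (path_snd_lt hp); lia.
move=> H1 H2; rewrite neq_ltn; apply/orP; right.
exact: leq_ltn_trans (leq_ltn_trans (leq0n _) H1) H2.
Qed.

Lemma high_slope s : high s ->
  (p 2).2 * deg_of s < pole_of s * (p 2).1.
Proof.
move=> [l [a [b [lr b0 ps]]]].
rewrite (deg_of_perm ps) (pole_of_perm ps) !of_wtE.
have H1 : (p 2).2 * (p l).1 <= (p l).2 * (p 2).1.
  have [->|ne] := eqVneq l 2; first by [].
  by apply/ltnW/(path_incr hp); lia.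
have H2 : (p 2).2 * (p l.+1).1 < (p l.+1).2 * (p 2).1 by apply: (path_incr hp); lia.
have := leq_mul (leqnn a) H1; have : b * ((p 2).2 * (p l.+1).1) < b * ((p l.+1).2 * (p 2).1).
  by rewrite ltn_pmul2l.
lia.
Qed.

(** High and low forms are separated by the slope of p 2; high ones are unique by the cone
    decomposition. *)
Lemma normal_unique s s' : normal s -> normal s' -> deg_of s = deg_of s' ->
  pole_of s = pole_of s' -> perm_eq s s'.
Proof.
have high_low u u' : high u -> low u' -> deg_of u = deg_of u' ->
    pole_of u = pole_of u' -> False.
  move=> hu lu' Ed Ep; have r2 : 2 < r by case: hu => l [a [b [lr _ _]]]; lia.
  have := high_slope hu; have := cd_below cd lu' ltac:(lia).
  by rewrite Ed Ep; lia.
case=> hs [] hs' Ed Ep; last exact: (cd_unique cd).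
- have [l [a [b [lr b0 ps]]]] := hs; have [l' [a' [b' [lr' b0' ps']]]] := hs'.
  move: Ed Ep; rewrite (deg_of_perm ps) (pole_of_perm ps).
  rewrite (deg_of_perm ps') (pole_of_perm ps') !of_wtE => Ed Ep.
  have [||E1 E2 E3] := path_cone_unique hp _ _ b0 b0' Ed Ep; try lia.
  by apply: (perm_trans ps); rewrite perm_sym E1 E2 E3.
- by case: (high_low _ _ hs hs' Ed Ep).
- by case: (high_low _ _ hs' hs (esym Ed) (esym Ep)).
Qed.

Lemma normal_exists d c : below A (d, c) -> c != 1 ->
  exists s, [/\ normal s, deg_of s = d & pole_of s = c].
Proof.
move=> bel c1; have [H|H] := boolP ((1 < r) ==> (c * (p 2).1 <= (p 2).2 * d)).
  have [s [ls sd sp]] := cd_exists cd bel c1 (implyP H).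
  by exists s; split => //; right.
move: H; rewrite negb_imply -ltnNge => /andP[r1 H].
have r2 : 2 < r.
  rewrite ltn_neqAle r1 andbT; apply/eqP => r2.
  by move: bel; rewrite /below -(path_last hp) -r2 /=; lia.
have [l [a [b [lr b0 /= [Ed Ec]]]]] := path_cone hp r2 bel H.
exists (nseq a (p l) ++ nseq b (p l.+1)); rewrite !of_wtE; split => //.
by left; exists l, a, b; split.
Qed.

(** If some p i with i >= i0 occurs in s, take the largest. Its products with all smaller generators
    other than p (i - 1) are leads, so s consists of p (i - 1) and p i. Otherwise s is made of low
    generators. *)
Lemma normal_standard s : {subset s <= gens} ->
  (forall M u, M \in LT -> ~~ perm_eq s (M ++ u)) -> normal s.
Proof.
move=> sg std; have i2 := cd_i0 cd.
have [/hasP[i ir si]|noi] := boolP (has (fun i => p i \in s) (iota i0 (r.+1 - i0))); last first.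
  have sL : {subset s <= L}.
    move=> w ws; case/(cd_mem cd): (sg w ws) => // -[i ir Ew].
    case/hasP: noi; exists i; last by rewrite -Ew.
    by rewrite mem_iota; lia.
  case: (cd_std cd sL) => [M u ML|ls|[a [b [r2 b0 ps]]]].
  - by apply: std; apply/(cd_LT cd); left.
  - by right.
  by left; exists 2, a, b; split.
have Q : exists i, (i0 <= i <= r) && (p i \in s).
  by exists i; rewrite si andbT; move: ir; rewrite mem_iota; lia.
have Qr j : (i0 <= j <= r) && (p j \in s) -> j <= r by lia.
case: (ex_maxnP Q Qr) => {si ir}i /andP[ir si] imax; left.
have no_pair g : g \in s -> g != p i -> g \in L \/ (exists2 j, i0 <= j < i & g = p j) -> g = p i.-1.
  move=> gs gi Hg; apply/eqP/negPn/negP => ne.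
  have ML : [:: p i; g] \in LT by apply/(cd_LT cd); right; exists i, g; split.
  have := std _ (rem g (rem (p i) s)) ML; case/negP.
  apply: (perm_trans (perm_to_rem si)); rewrite /= perm_cons; apply: perm_to_rem.
  by rewrite mem_rem_uniq_ne || move: gs; rewrite (perm_mem (perm_to_rem si)) inE (negPf gi).
have ssub : {subset s <= [:: p i.-1; p i]}.
  move=> g gs; rewrite !inE; have [->|gi] := eqVneq g (p i); first by rewrite orbT.
  rewrite orbF; apply/eqP/no_pair => //.
  case/(cd_mem cd): (sg g gs) => [|[j jr Eg]]; [by left | right].
  have ji : j <= i by apply: imax; rewrite jr -Eg.
  exists j => //; move: ji; rewrite leq_eqVlt => /orP[/eqP E|]; last by lia.
  by rewrite Eg E eqxx in gi.
have ne : p i.-1 != p i.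
  have : (p i.-1).2 < (p i).2 by apply: (path_snd_lt hp); lia.
  by apply: contraTneq => ->; rewrite ltnn.
exists i.-1, (count_mem (p i.-1) s), (count_mem (p i) s); split; first lia.
  by rewrite -has_count has_pred1.
by rewrite prednK; [exact: perm_nseq2 | lia].
Qed.

(** In a lead p i g the factor g has smaller slope than p (i - 1). This forces the normal form at
    the same point to use only generators below p i, so the exponent of p i decides. *)
Lemma normal_lt s M : normal s -> M \in LT -> deg_of s = deg_of M ->
  pole_of s = pole_of M -> mon_lt (monom gens s) (monom gens M).
Proof.
move=> ns /(cd_LT cd) [ML|[i [g [ir EM Hg ne]]]] Ed Ep.
  have [s' [g [ls' Ed' Ep' gM [ltg leg]]]] := cd_lower cd ML.
  have ps := normal_unique ns (or_intror ls') (etrans Ed (esym Ed')) (etrans Ep (esym Ep')).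
  rewrite (monom_perm gens ps); apply: (mon_lt_top (cd_uniq cd) (cd_sorted cd) _ _ Ed' Ep' gM) =>
    //.
    exact: normal_gens (or_intror ls').
  by move=> w /(cd_LTlow cd ML) wL; apply/(cd_mem cd); left.
have i2 := cd_i0 cd.
have gg : g \in gens.
  by apply/(cd_mem cd); case: Hg => [|[j jr ->]]; [left | right; exists j => //; lia].
have ig : p i \in gens by apply: path_gens; lia.
have gi : point_lt g (p i).
  case: Hg => [gL|[j jr ->]]; last by apply: path_point_lt; lia.
  have := cd_lt cd ltac:(lia) gL; have [<- //|ne'] := eqVneq i0 i.
  have : point_lt (p i0) (p i) by apply: path_point_lt; lia.
  by rewrite /point_lt; lia.
have slope_g : g.2 * (p i.-1).1 < (p i.-1).2 * g.1.
  case: Hg => [gL|[j jr Eg]]; last first.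
    rewrite Eg; apply: (path_incr hp); suff : j != i.-1 by lia.
    by apply: contraNneq ne => <-; rewrite Eg.
  have [E|gpred] := eqVneq g (p i0.-1).
    rewrite E; apply: (path_incr hp); suff : i != i0 by lia.
    by apply: contraNneq ne => ->; rewrite E eqxx.
  have := cd_slope cd ltac:(lia) gL gpred; have [<- //|ne'] := eqVneq i0 i.
  have : (p i0.-1).2 * (p i.-1).1 < (p i.-1).2 * (p i0.-1).1 by apply: (path_incr hp); lia.
  by move=> H1 H2; exact: slope_lt_trans H2 H1.
have lt_s : {in s, forall w, point_lt w (p i)}.
  case: ns => [[l [a [b [lr b0 ps]]]]|ls] w; last first.
    move/(cd_low cd ls)/(cd_lt cd ltac:(lia)); have [<- //|ne'] := eqVneq i0 i.
    have : point_lt (p i0) (p i) by apply: path_point_lt; lia.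
    by rewrite /point_lt; lia.
  (* For l >= i the slope of s would be at least that of p i, which exceeds that of M. For l = i -
     1, cancelling one p i leaves g = a p l + (b - 1) p i, of slope at least that of p (i - 1). *)
  suff li : l.+1 < i.
    by rewrite (perm_mem ps) mem_cat => /orP[] /nseqP[-> _]; apply: path_point_lt; lia.
  move: Ed Ep; rewrite EM (deg_of_perm ps) (pole_of_perm ps) !of_wtE !addn0 => Ed Ep.
  have slope_gi : g.2 * (p i).1 < (p i).2 * g.1.
    have : (p i.-1).2 * (p i).1 < (p i).2 * (p i.-1).1 by apply: (path_incr hp); lia.
    exact: slope_lt_trans.
  rewrite ltnNge; apply/negP => il.
  have [il'|il'] := leqP i l.
    have H1 : (p i).2 * (p l).1 <= (p l).2 * (p i).1.
      have [->|ne'] := eqVneq l i; first by [].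
      by apply/ltnW/(path_incr hp); lia.
    have H2 : (p i).2 * (p l.+1).1 < (p l.+1).2 * (p i).1 by apply: (path_incr hp); lia.
    have := leq_mul (leqnn a) H1; have := leq_mul (leqnn b) (ltnW H2).
    have := congr1 (muln (p i).2) Ed; have := congr1 (muln (p i).1) Ep.
    move: (p i) (p l) (p l.+1) (g) slope_gi => [d1 c1] [d2 c2] [d3 c3] [d4 c4] /=.
    lia.
  have El : i = l.+1 by lia.
  have det := path_det hp (_ : l < r); move: det => /(_ ltac:(lia)) det.
  move: Ed Ep slope_g; rewrite El /=.
  case: b b0 {ps} => // b _.
  move: (p l) (p l.+1) (g) det => [d1 c1] [d2 c2] [d3 c3] /= det Ed Ep.
  have E1 : d3 = a * d1 + b * d2 by lia.
  have E2 : c3 = a * c1 + b * c2 by lia.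
  rewrite E1 E2; have := congr1 (muln b) det; lia.
apply: (mon_lt_top (cd_uniq cd) (cd_sorted cd) _ _ Ed Ep (g := p i)) => //.
- exact: normal_gens.
- by rewrite EM => w; rewrite !inE => /orP[] /eqP ->.
- by rewrite EM inE eqxx.
by rewrite EM => w; rewrite !inE => /orP[] /eqP ->; [left | right].
Qed.

(** A best approximation has larger slope than each factor of a proper product of the same degree,
    hence than the product. A generator off the path is low, and leads containing some p i with i >=
    i0 exceed its degree; the leads in [LTlow] are left to the hypothesis. *)
Lemma normal_extremal (w : nat * nat) M s :
  (forall (w' : nat * nat) M' s', w' \in L -> (forall j, j <= r -> w' != p j) -> M' \in LTlow ->
    {subset s' <= gens} -> deg_of (M' ++ s') = w'.1 -> pole_of (M' ++ s') < w'.2) ->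
  (forall M', M' \in LTlow -> 1 < size M') ->
  w \in gens -> M \in LT -> {subset s <= gens} -> deg_of (M ++ s) = w.1 ->
  pole_of (M ++ s) < w.2.
Proof.
move=> low_extremal low_size wg ML sg Ed; have i2 := cd_i0 cd.
have Mg : {subset M <= gens}.
  case/(cd_LT cd): ML => [ML u /(cd_LTlow cd ML) uL|[i [g [ir -> Hg _]]] u].
    by apply/(cd_mem cd); left.
  rewrite !inE => /orP[] /eqP ->; first by apply: path_gens; lia.
  by apply/(cd_mem cd); case: Hg => [|[j jr ->]]; [left | right; exists j => //; lia].
have szM : 1 < size M by case/(cd_LT cd): ML => [/low_size //|[i [g [_ -> _ _]]]].
have [/hasP[j jr /eqP Ew]|now] := boolP (has (fun j => w == p j) (iota 0 r.+1)).
  have jr' : j <= r by move: jr; rewrite mem_iota; lia.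
  suff : pole_of (M ++ s) * w.1 < w.2 * deg_of (M ++ s).
    by rewrite Ed ltn_pmul2r // Ew; apply: (path_gt0 hp).
  have allM : {subset M ++ s <= gens} by move=> u; rewrite mem_cat => /orP[/Mg|/sg].
  have lt1 : forall u, u \in M ++ s -> u.1 < w.1.
    move=> u us; rewrite -Ed.
    have /(perm_to_rem) pu := us; rewrite (deg_of_perm pu) deg_of_cons -{1}[u.1]addn0 ltn_add2l.
    have : 0 < size (rem u (M ++ s)) by rewrite size_rem // size_cat; lia.
    have := @mem_rem _ u (M ++ s); case: (rem u _) => // x y H _.
    rewrite deg_of_cons addn_gt0; suff [-> _ _] : [/\ 0 < x.1, x.2 != 1 & below A x] by [].
    by apply/gens_below/allM/H; rewrite inE eqxx.
  have lt2 u : u \in M ++ s -> u.2 * w.1 < w.2 * u.1.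
    move=> us; rewrite Ew; have [u0 _ ub] := gens_below (allM u us).
    by apply: (best_below_strict (path_best hp jr')) => //; rewrite u0 -Ew lt1.
  move: lt2; have : 0 < size (M ++ s) by rewrite size_cat; lia.
  elim: (M ++ s) => [//|u [|u' s'] IH] _ lt2.
    by rewrite !of_wtE !addn0; apply: lt2; rewrite inE eqxx.
  rewrite deg_of_cons pole_of_cons mulnDl mulnDr -addSn leq_add //.
    by apply: lt2; rewrite inE eqxx.
  by apply/ltnW/IH => // x xs; apply: lt2; rewrite inE xs orbT.
have neq j : j <= r -> w != p j.
  move=> jr; apply: contra now => E; apply/hasP; exists j => //.
  by rewrite mem_iota.
have wL : w \in L by case/(cd_mem cd): wg => // -[i ir E]; case/eqP: (neq i ltac:(lia)).
case/(cd_LT cd): (ML) => [ML'|[i [g [ir EM _ _]]]]; first exact: low_extremal.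
have := cd_lt cd ltac:(lia) wL; have : (p i0).1 <= (p i).1 by apply: (path_fst_le hp); lia.
have : 0 < g.1 by case: (gens_below (w := g)) => //; apply: Mg; rewrite EM !inE eqxx orbT.
by move: Ed; rewrite EM !of_wtE /point_lt; lia.
Qed.

(** Applied to points u just above the line, this bounds the slopes of cofactors strictly; the
    origin is the only point of degree 0 under the line. *)
Lemma below_lt (w u : nat * nat) : below A w -> ~~ below A u -> w = (0, 0) \/ w.2 * u.1 < u.2 * w.1.
Proof.
case: w => d c; rewrite /below /= -ltnNge => H1 H2.
have A0 : 0 < A.1 by rewrite -(path_last hp); exact: (path_gt0 hp).
have [d0|d0] := posnP d.
  left; subst d; congr (_, _); apply/eqP; move: H1.
  by rewrite muln0 leqn0 muln_eq0 => /orP[//|]; lia.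
right; rewrite -(ltn_pmul2r A0); apply: (@leq_ltn_trans (A.2 * d * u.1)).
  by rewrite mulnAC leq_mul2r H1 orbT.
by rewrite mulnAC [X in _ < X]mulnAC ltn_pmul2r.
Qed.

Lemma below_sum s : {subset s <= gens} -> below A (deg_of s, pole_of s).
Proof.
elim: s => [|u s IH] sg; first by rewrite !of_wtE /below /= muln0.
have sg' : {subset s <= gens} by move=> x xs; apply: sg; rewrite inE xs orbT.
have := IH sg'; have [_ _] := gens_below (sg u (mem_head _ _)).
by rewrite /below !of_wtE /= mulnDl mulnDr => H1 H2; apply: leq_add.
Qed.

End ConeData.

Lemma perm_by_count (L s s' : seq (nat * nat)) : {subset s <= L} -> {subset s' <= L} ->
  {in L, forall w, count_mem w s = count_mem w s'} -> perm_eq s s'.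
Proof.
move=> sL s'L E; apply/allP => w ws; apply/eqP/E.
by move: ws; rewrite mem_cat => /orP[/sL|/s'L].
Qed.

Lemma sub_multiset (M s : seq (nat * nat)) :
  {in M, forall w, count_mem w M <= count_mem w s} -> exists t, perm_eq s (M ++ t).
Proof.
elim: M s => [|x M IH] s H; first by exists s.
have xs : x \in s.
  rewrite -has_pred1 has_count; apply: leq_trans (H x _); last by rewrite inE eqxx.
  by rewrite /= eqxx.
have [|t pt] := IH (rem x s).
  move=> w wM; have := H w; rewrite inE wM orbT => /(_ isT).
  by rewrite (permP (perm_to_rem xs)) /= leq_add2l.
by exists t; apply: perm_trans (perm_to_rem xs) _; rewrite /= perm_cons.
Qed.

(** * The first points of the path in terms of theta *)

Section Theta.
Context (alpha : rat) (alpha_gt0 : (0 < alpha)%R).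
Context (v : seq (nat * nat)) (hv : best_lower_approxs alpha v).
Local Notation r := (size v).-1.
Local Notation A := (pt v r).
Local Notation n := (pt v 1).1.
Local Notation th := (theta alpha).
Local Notation p := (pt v).

Let hp : approx_path A r p := pt_path alpha_gt0 hv.
Let n_gt0' : 0 < n := n_gt0 alpha_gt0 hv.
Let r_gt0' : 0 < r := r_gt0 alpha_gt0 hv.

Lemma theta_ge (j c : nat) : j < c ->
  (j%:R / c%:R <= th)%R = below A (n * c - j, c).
Proof.
move=> jc; have d0 : 0 < n * c - j by nia.
have jnc : j <= n * c by nia.
rewrite (below_theta alpha_gt0 hv) //= natrB // ler_pdivrMr ?ltr0n //; last by lia.
by congr (_ <= _)%R; ring.
Qed.

(** A point above p i in slope lies in a later cone and uses some p (l + 1) with l >= i, of pole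
    order at least that of p (i + 1). *)
Lemma next_pole_le i (w : nat * nat) : i <= r -> below A w ->
  (p i).2 * w.1 < w.2 * (p i).1 -> i < r /\ (p i.+1).2 <= w.2.
Proof.
move=> ir wb H; have ir' : i < r.
  rewrite ltn_neqAle ir andbT; apply/eqP => E.
  by move: wb; rewrite /below -E; lia.
split => //; have [l [a [b [lr b0 E]]]] := path_cone hp ir' wb H.
have : (p i.+1).2 <= (p l.+1).2.
  have [->|ne] := eqVneq l i; first by [].
  by apply/ltnW/(path_snd_lt hp); lia.
by rewrite E /=; nia.
Qed.

Lemma pt1_snd : (p 1).2 = 1.
Proof. by have := pt1E alpha_gt0 hv => ->. Qed.

Lemma pt2_det : 1 < r -> (p 2).1 + 1 = n * (p 2).2.
Proof. by move=> r1; have := path_det hp r1; rewrite pt1_snd; lia. Qed.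

Lemma pt2_snd : 1 < r -> 1 < (p 2).2.
Proof. by move=> r1; rewrite -{1}pt1_snd; apply: (path_snd_lt hp); lia. Qed.

Lemma pt3_det : 2 < r -> (p 2).1 * (p 3).2 = (p 2).2 * (p 3).1 + 1.
Proof. by move=> r2; exact: (path_det hp r2). Qed.

(** If p 2 exists it has deficit 1, which needs theta > 0; if it does not, alpha = 1 / n. *)
Lemma theta_eq0 : (th == 0)%R = (r == 1).
Proof.
have [r1|r1] := eqVneq r 1.
  have [_ _ _ _] := approx_pathP alpha_gt0 hv; rewrite r1 => sl.
  rewrite (thetaE alpha_gt0 hv) -sl /slope pt1_snd div1r invrK subrr; exact: eqxx.
have r2 : 1 < r by lia.
have := path_below hp (_ : 2 <= r); move=> /(_ r2).
rewrite (below_theta alpha_gt0 hv) ?(path_gt0 hp) // -(pt2_det r2) natrD.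
rewrite addrC addKr => th1; apply/eqP => th0; move: th1; rewrite th0 mul0r.
by rewrite ler10.
Qed.

(** The point p 2 has deficit 1 and least pole order among the points steeper than p 1, so its pole
    order is the least c with 1 / c <= theta. *)
Lemma theta_ge_inv c : 1 < r -> 1 < c -> (1 / c%:R <= th)%R = ((p 2).2 <= c).
Proof.
move=> r1 c1; rewrite (theta_ge c1); apply/idP/idP => [H|H].
  have [|_] := next_pole_le (ltnW r1) H => //.
  by rewrite pt1_snd /=; nia.
have : (1 / c%:R <= th)%R.
  have := path_below hp r1; rewrite (below_theta alpha_gt0 hv) ?(path_gt0 hp) //.
  rewrite -(pt2_det r1) natrD addrC addKr => H1.
  rewrite ler_pdivrMr ?ltr0n; last by lia.
  apply: le_trans H1 _; rewrite ler_wpM2l ?ler_nat //.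
  exact: theta_ge0.
by rewrite (theta_ge c1).
Qed.

Lemma theta_ge23 : (2 / 3 <= th)%R -> [/\ 2 < r, p 2 = (2 * n - 1, 2) & p 3 = (3 * n - 2, 3)].
Proof.
move=> th23; have r1 : 1 < r.
  suff : r != 1 by lia.
  by rewrite -theta_eq0; apply: contraTneq th23 => ->; lra.
have m2 : (p 2).2 = 2.
  have := @theta_ge_inv 2 r1 isT; have := pt2_snd r1.
  have -> : (1 / 2 <= th)%R by lra.
  by lia.
have d2 := pt2_det r1; rewrite m2 in d2.
have b3 : below A (3 * n - 2, 3).
  by rewrite mulnC -(@theta_ge 2 3).
have [|r2 c3] := @next_pole_le 2 (3 * n - 2, 3) r1 b3; first by rewrite m2 /=; lia.
have c3' : (p 3).2 = 3.
  have : (p 2).2 < (p 3).2 by apply: (path_snd_lt hp); lia.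
  by rewrite m2 /= in c3 *; lia.
have := pt3_det r2; rewrite m2 c3' => d3; split => //.
  by rewrite [p 2]surjective_pairing m2; congr (_, _); lia.
by rewrite [p 3]surjective_pairing c3'; congr (_, _); lia.
Qed.

Lemma theta_ge34 : (3 / 4 <= th)%R -> 3 < r /\ p 4 = (4 * n - 3, 4).
Proof.
move=> th34; have [|r2 E2 E3] := theta_ge23; first by lra.
have b4 : below A (4 * n - 3, 4) by rewrite mulnC -(@theta_ge 3 4).
have [|r3 c4] := @next_pole_le 3 (4 * n - 3, 4) r2 b4; first by rewrite E3 /=; lia.
have c4' : (p 4).2 = 4.
  have : (p 3).2 < (p 4).2 by apply: (path_snd_lt hp); lia.
  by rewrite E3 /= in c4 *; lia.
have := path_det hp r3; rewrite E3 c4' /= => d4; split => //.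
by rewrite [p 4]surjective_pairing c4'; congr (_, _); lia.
Qed.

(** The determinant with p 3 = (3 n - 2, 3) makes c_4 congruent to 1 modulo 3, and c_4 = 4 would
    give theta >= 3/4. *)
Lemma theta_lt34 : (2 / 3 <= th < 3 / 4)%R -> 3 < r -> 7 <= (p 4).2 /\ 7 * n - 5 <= (p 4).1.
Proof.
move=> /andP[/theta_ge23[r2 E2 E3] th34] r3.
have := path_det hp r3; rewrite E3 /= => d4.
have : (p 3).2 < (p 4).2 by apply: (path_snd_lt hp); lia.
rewrite E3 /= => c4; have c4n : (p 4).2 != 4.
  apply/eqP => c4'; move: th34; rewrite ltNge; case/negP.
  rewrite (@theta_ge 3 4) // -c4' (_ : n * (p 4).2 - 3 = (p 4).1) -?surjective_pairing.
    exact: (path_below hp).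
  by rewrite c4' in d4 *; lia.
have c47 : 7 <= (p 4).2.
  move: d4 c4 c4n; case: (p 4) => d c /= d4 c4 c4n.
  have : (3 * n) * c - 2 * c = 3 * d + 1 by rewrite -d4 mulnBl.
  suff : c != 5 /\ c != 6 by lia.
  by split; apply/eqP => E; subst c; lia.
split => //; nia.
Qed.

(** The determinant with p 2 = (2 n - 1, 2) makes c_3 odd, and c_3 = 3 would give theta >= 2/3. *)
Lemma pt3_snd_ge5 : (th < 2 / 3)%R -> 2 < r -> (p 2).2 = 2 -> 5 <= (p 3).2.
Proof.
move=> th23 r2 m2; have r1 : 1 < r by lia.
have := pt3_det r2; have := pt2_det r1; rewrite m2 => d2 d3.
have : (p 2).2 < (p 3).2 by apply: (path_snd_lt hp); lia.
rewrite m2 => c3; suff : (p 3).2 != 3.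
  move: d3; move: (p 3) c3 d2 => [d c] /= c3 d2 d3 c3n; suff : c != 4 by lia.
  by apply/eqP => E; subst c; lia.
apply/eqP => c3'; move: th23; rewrite ltNge; case/negP.
rewrite (@theta_ge 2 3) // -c3' (_ : n * (p 3).2 - 2 = (p 3).1) -?surjective_pairing.
  exact: (path_below hp).
by rewrite c3' in d3 *; lia.
Qed.

(** The determinants give c_3 + 1 = c_2 (n c_3 - d_3); since c_3 > c_2, the second factor is at
    least 2. *)
Lemma pt3_snd_ge : 2 < r -> 2 * (p 2).2 <= (p 3).2 + 1.
Proof.
move=> r2; have r1 : 1 < r by lia.
have := pt3_det r2; have := pt2_det r1.
have : (p 2).2 < (p 3).2 by apply: (path_snd_lt hp); lia.
move: (p 2) (p 3) => [d2 m] [d3 c] /= lt d2E d3E.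
have E : c + 1 = m * (n * c - d3).
  have : n * m * c = c + m * d3 + 1 by rewrite -d2E; lia.
  rewrite mulnBr; lia.
rewrite E; case: (n * c - d3) E => [|[|a]] E; [lia|lia|].
by rewrite mulnC leq_mul2l orbT.
Qed.

Lemma ceil_div_alpha (c : nat) (d : nat) : ((n * c)%:R - d%:R <= th * c%:R)%R ->
  (th * c%:R < (n * c)%:R - d%:R + 1)%R -> `|Num.ceil (c%:R / alpha)| = d.
Proof.
move=> H1 H2; have -> : (c%:R / alpha = (n * c)%:R - th * c%:R :> rat)%R.
  by rewrite (thetaE alpha_gt0 hv) natrM; ring.
have -> : Num.ceil ((n * c)%:R - th * c%:R : rat)%R = Posz d; last by [].
apply: ceil_def; rewrite -natz intrD; apply/andP; split; rewrite /= ?natz; lra.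
Qed.

End Theta.

(** * Membership in the lists of generators and leading terms *)

Section Membership.
Context (alpha : rat) (alpha_gt0 : (0 < alpha)%R).
Context (v : seq (nat * nat)) (hv : best_lower_approxs alpha v).
Local Notation r := (size v).-1.
Local Notation A := (pt v r).
Local Notation th := (theta alpha).
Local Notation p := (pt v).
Local Notation exc := (exceptional alpha v).
Local Notation gens := (generators alpha v).
Local Notation LT := (leading_terms alpha v).

Let hp : approx_path A r p := pt_path alpha_gt0 hv.
Let r_gt0' : 0 < r := r_gt0 alpha_gt0 hv.
Let size_v' : size v = r.+1 := size_v alpha_gt0 hv.

Lemma pt_inj i j : i <= r -> j <= r -> p i = p j -> i = j.
Proof.
move=> ir jr E; case: (ltngtP i j) => // ij.
  by have : (p i).2 < (p j).2; [apply: (path_snd_lt hp); rewrite ij | rewrite E ltnn].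
by have : (p j).2 < (p i).2; [apply: (path_snd_lt hp); rewrite ij | rewrite E ltnn].
Qed.

Lemma mem_drop2 (w : nat * nat) : w \in drop 2 v <-> exists2 i, 2 <= i <= r & w = p i.
Proof.
split=> [/(nthP (0, 0))[i]|[i ir ->]].
  by rewrite size_drop nth_drop size_v' => iv <-; exists (2 + i) => //; lia.
apply/(nthP (0, 0)); exists (i - 2); first by rewrite size_drop size_v'; lia.
by rewrite nth_drop subnKC //; lia.
Qed.

Lemma mem_generators (w : nat * nat) : w \in gens <->
  w = p 0 \/ (exists2 i, 2 <= i <= r & w = p i) \/ w \in exc.
Proof.
rewrite mem_sort inE mem_cat; split=> [/or3P[/eqP|/mem_drop2|]|[->|[/mem_drop2 ->|->]]];
  by [left | right; left | right; right | rewrite ?eqxx ?orbT].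
Qed.

Lemma generators_uniq : uniq exc ->
  {in exc, forall e, forall j, j <= r -> (p j).2 != e.2} -> uniq gens.
Proof.
move=> uexc Hexc; rewrite sort_uniq /= cat_uniq uexc andbT mem_cat negb_or.
have uv : uniq v.
  apply/(uniqP (0, 0)) => i j; rewrite !inE size_v' => ir jr.
  exact: pt_inj.
rewrite drop_uniq // -andbA; apply/and3P; split.
- apply/negP => /mem_drop2[i ir /pt_inj]; lia.
- by apply/negP => /Hexc /(_ 0 isT); rewrite eqxx.
- apply/hasPn => e ee; apply/negP => /mem_drop2[i ir E].
  by have := Hexc e ee i; rewrite E eqxx => H; have: false by apply: H; lia.
Qed.

Lemma generators_sorted : sorted point_le gens.
Proof. by apply: sort_sorted => -[a b] [c d]; rewrite /point_le /=; lia. Qed.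

Definition table : seq (seq (nat * nat)) :=
  if th == 0%R then [:: [:: ptc alpha; ptc alpha]]
  else if (th < 1 / 3)%R then
    [:: [:: ptc alpha; ptc alpha]; [:: ptb alpha; ptd v]; [:: ptc alpha; ptd v];
        [:: ptd v; ptd v]; [:: p 0; ptd v]; [:: p 0; p 2]]
  else if (th < 1 / 2)%R then
    [:: [:: p 0; p 0; p 2; p 2]; [:: p 0; ptd v]; [:: ptb alpha; ptd v];
        [:: ptd v; ptd v]]
  else if (th < 2 / 3)%R then [:: [:: ptc alpha; ptc alpha]]
  else [:: [:: p 0; p 3; p 3]].

Lemma mem_leading_terms M : M \in LT <-> [\/
  exists i j, [/\ 3 <= i <= r, j <= i - 2, j != 1,
    ~~ [&& i == 3, j == 0 & (2 / 3 <= th)%R] & M = [:: p i; p j]],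
  exists i e, [/\ 3 <= i <= r, e \in exc & M = [:: p i; e]] | M \in table].
Proof.
rewrite /leading_terms !mem_cat -/table; split.
  case/or3P => [/allpairsPdep[i [j [+ + ->]]]|/allpairsPdep[i [e [+ ee ->]]]|H].
  - rewrite mem_iota mem_filter mem_iota => ir /andP[/andP[j1 nj] jr].
    by constructor 1; exists i, j; split => //; lia.
  - by rewrite mem_iota => ir; constructor 2; exists i, e; split => //; lia.
  - by constructor 3.
case=> [[i [j [ir ji j1 nij ->]]]|[i [e [ir ee ->]]]|->]; last by rewrite !orbT.
- apply/or3P; constructor 1; apply/allpairsPdep; exists i, j; split => //.
    by rewrite mem_iota; lia.
  by rewrite mem_filter mem_iota j1 nij /=; lia.
- apply/or3P; constructor 2; apply/allpairsPdep; exists i, e; split => //.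
  by rewrite mem_iota; lia.
Qed.

(** Common to the four ranges below 2/3: the low generators are p 0, the exceptional ones and p 2,
    and i0 = 3. What remains for each range is its table and its low normal forms. *)
Lemma cone_data3 L low : (th < 2 / 3)%R -> uniq exc ->
  {in exc, forall e, forall j, j <= r -> (p j).2 != e.2} ->
  (forall w, w \in L <-> [\/ w = p 0, w \in exc | 1 < r /\ w = p 2]) ->
  {in exc, forall e, [/\ 0 < e.1, e.2 != 1, below A e,
    2 < r -> e.2 * (p 2).1 < (p 2).2 * e.1 & 2 < r -> point_lt e (p 3)]} ->
  (forall s, low s -> {subset s <= L}) ->
  (forall d c, below A (d, c) -> c != 1 ->
    (1 < r -> c * (p 2).1 <= (p 2).2 * d) ->
    exists s, [/\ low s, deg_of s = d & pole_of s = c]) ->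
  (forall s, low s -> 1 < r -> pole_of s * (p 2).1 <= (p 2).2 * deg_of s) ->
  (forall s s', low s -> low s' -> deg_of s = deg_of s' ->
    pole_of s = pole_of s' -> perm_eq s s') ->
  (forall s, {subset s <= L} ->
    (forall M t, M \in table -> ~~ perm_eq s (M ++ t)) -> low s) ->
  (forall M, M \in table -> {subset M <= L}) ->
  (forall M, M \in table -> exists s g, [/\ low s, deg_of s = deg_of M,
    pole_of s = pole_of M, g \in M &
    {in s, forall w, point_lt w g} /\ {in M, forall w, w = g \/ point_lt w g}]) ->
  cone_data A r p gens LT 3 L table low.
Proof.
move=> th23 uexc exc2 memL Hexc low_sub low_ex low_below low_uniq low_std tabL tab_lower.
have p0 := pt0E alpha_gt0 hv.
split => //.
- exact: generators_uniq.
- exact: generators_sorted.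
- move=> w; rewrite mem_generators memL; split.
    case=> [->|[[i ir ->]|we]]; [by left; constructor 1 | | by left; constructor 2].
    have [i3|i3] := ltnP i 3; last by right; exists i => //; lia.
    by left; constructor 3; split; [lia | congr pt; lia].
  case=> [[->|we|[r1 ->]]|[i ir ->]].
  - by left.
  - by right; right.
  - by right; left; exists 2 => //; lia.
  - by right; left; exists i => //; lia.
- move=> M; rewrite mem_leading_terms; split.
    case=> [[i [j [ir ji j1 nij ->]]]|[i [e [ir ee ->]]]|]; last by left.
      right; exists i, (p j); split => //; last first.
        by apply/eqP => /pt_inj; lia.
      have [j3|j3] := ltnP j 3; last by right; exists j => //; lia.
      left; apply/memL; have [->|j0] := eqVneq j 0; first by constructor 1.
      by constructor 3; split; [lia | congr pt; lia].
    right; exists i, e; split => //; first by left; apply/memL; constructor 2.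
    apply/eqP => E; have := exc2 e ee i.-1; rewrite E eqxx => H.
    by have: false by apply: H; lia.
  case=> [|[i [g [ir -> Hg ne]]]]; first by constructor 3.
  case: Hg => [/memL[Eg|ee|[r1 Eg]]|[j jr Eg]].
  - constructor 1; exists i, 0; rewrite Eg; split => //.
    by rewrite leNgt th23 !andbF.
  - by constructor 2; exists i, g; split => //; lia.
  - constructor 1; exists i, 2; rewrite Eg; split => //; last by rewrite andbF.
    suff : i != 3 by lia.
    by apply: contraNneq ne => ->; rewrite Eg.
  - constructor 1; exists i, j; rewrite Eg; split => //; first last.
    + by have -> : (j == 0) = false by [lia]; rewrite andbF.
    + lia.
    suff : j != i.-1 by lia.
    by apply: contraNneq ne => <-; rewrite Eg.
- move=> w /memL[->|/Hexc[] //|[r1 ->]].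
    by rewrite p0; split => //; rewrite /below /= mul0n.
  split; [apply: (path_gt0 hp) | | apply: (path_below hp)]; try lia.
  by have := pt2_snd alpha_gt0 hv r1; case: (p 2).2 => [|[]].
- by move=> j j2 jr; apply/memL; constructor 3; split; [lia | congr pt; lia].
- move=> g r3 /memL[->|/Hexc[_ _ _ H _] _|[_ ->]].
  + by move=> _; rewrite p0 mul0n muln1; have := pt2_snd alpha_gt0 hv; rewrite /=; lia.
  + exact: H.
  + by rewrite eqxx.
- move=> g r3 /memL[->|/Hexc[_ _ _ _ H]|[_ ->]]; last 1 first.
  + by apply: (path_point_lt hp); lia.
  + by apply: (path_point_lt hp); lia.
  + exact: H.
- by move=> s sL std; left; apply: low_std.
Qed.

End Membership.

(** * Multisets not divisible by given products *)

Section Multisets.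
Implicit Types (x y w : nat * nat) (s L : seq (nat * nat)).

Lemma perm_counts L s : uniq L -> {subset s <= L} ->
  perm_eq s (flatten [seq nseq (count_mem w s) w | w <- L]).
Proof.
move=> uL sL; apply: (@perm_by_count L) => // [w /flattenP[_ /mapP[x xL ->]] /nseqP[-> _] //|w wL].
rewrite count_flatten -map_comp sumnE big_map (bigD1_seq w) //= count_nseq /= eqxx mul1n.
by rewrite big1 ?addn0 // => x xw; rewrite count_nseq /= (negPf xw).
Qed.

Lemma indivisible_pair x y s : x != y -> (forall t, ~~ perm_eq s ([:: x; y] ++ t)) ->
  count_mem x s = 0 \/ count_mem y s = 0.
Proof.
move=> xy nd; have [|x0] := posnP (count_mem x s); first by left.
have [|y0] := posnP (count_mem y s); first by right.
have [|t pt] := @sub_multiset [:: x; y] s; last by move: (nd t); rewrite pt.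
by move=> w; rewrite !inE => /orP[] /eqP -> /=;
  rewrite eqxx ?(negPf xy) ?[y == x]eq_sym ?(negPf xy).
Qed.

Lemma indivisible_square x s : (forall t, ~~ perm_eq s ([:: x; x] ++ t)) ->
  count_mem x s <= 1.
Proof.
move=> nd; rewrite leqNgt; apply/negP => x2.
have [|t pt] := @sub_multiset [:: x; x] s; last by move: (nd t); rewrite pt.
by move=> w; rewrite !inE => /orP[] /eqP -> /=; rewrite eqxx.
Qed.

Lemma indivisible_cube x y s : x != y -> (forall t, ~~ perm_eq s ([:: x; y; y] ++ t)) ->
  count_mem x s = 0 \/ count_mem y s <= 1.
Proof.
move=> xy nd; have [|x0] := posnP (count_mem x s); first by left.
have [|y0] := leqP (count_mem y s) 1; first by right.
have [|t pt] := @sub_multiset [:: x; y; y] s; last by move: (nd t); rewrite pt.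
by move=> w; rewrite !inE => /or3P[] /eqP -> /=;
  rewrite eqxx ?(negPf xy) ?[y == x]eq_sym ?(negPf xy).
Qed.

Lemma indivisible_quartic x y s : x != y ->
  (forall t, ~~ perm_eq s ([:: x; x; y; y] ++ t)) ->
  count_mem x s <= 1 \/ count_mem y s <= 1.
Proof.
move=> xy nd; have [|x0] := leqP (count_mem x s) 1; first by left.
have [|y0] := leqP (count_mem y s) 1; first by right.
have [|t pt] := @sub_multiset [:: x; x; y; y] s; last by move: (nd t); rewrite pt.
by move=> w; rewrite !inE => /or4P[] /eqP -> /=;
  rewrite eqxx ?(negPf xy) ?[y == x]eq_sym ?(negPf xy).
Qed.

(** Take b to be the parity of c. Pole orders 2 and 3 thus fill every pole order but 1, with at most
    one 3. *)
Lemma even_or_odd3 c : c != 1 -> exists e b, b <= 1 /\ c = 2 * e + 3 * b.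
Proof.
move=> c1; exists ((c - 3 * odd c)./2), (odd c); split; first by case: odd.
have := odd_double_half c; rewrite -muln2; case oc : (odd c) => /=.
  have := odd_double_half (c - 3); rewrite -muln2 oddB; last by lia.
  by rewrite oc /= muln1; lia.
by rewrite muln0 subn0; lia.
Qed.

End Multisets.

Definition has_lower (low : seq (nat * nat) -> Prop) M := exists s g,
  [/\ low s, deg_of s = deg_of M, pole_of s = pole_of M, g \in M &
  {in s, forall w, point_lt w g} /\ {in M, forall w, w = g \/ point_lt w g}].

Lemma has_lowerI (low : seq (nat * nat) -> Prop) M s g : low s ->
  deg_of s = deg_of M -> pole_of s = pole_of M -> g \in M ->
  all (point_lt^~ g) s -> all (fun w => (w == g) || point_lt w g) M ->
  has_lower low M.
Proof.
move=> ls Ed Ep gM /allP lts /allP leM; exists s, g; split => //; split=> // w /leM.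
by case/orP => [/eqP|]; [left | right].
Qed.

(** * Normal forms at small slope *)

Section LowForms.
Context (n m : nat).
Local Notation f0 := (1, 0).
Local Notation fb := (2 * n, 2).
Local Notation fc := (3 * n, 3).
Local Notation fc' := (3 * n - 1, 3).
Local Notation f2 := (n * m - 1, m).
Local Notation fd := (n * (m + 1) - 1, m + 1).
Local Notation f2' := (2 * n - 1, 2).
Local Notation f3' := (3 * n - 2, 3).
Local Notation f2'' := (3 * n - 1, 3).
Local Notation fd'' := (4 * n - 1, 4).

(* The suffixes refer to theta: 0, lt13 for (0, 1/3), ge13 for [1/3, 1/2), ge12
   for [1/2, 2/3) and ge23 for [2/3, 1). *)
Definition low_0 s := exists e0 eb ec, ec <= 1 /\
  perm_eq s (nseq e0 f0 ++ nseq eb fb ++ nseq ec fc).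

(* Here p 2 = (n m - 1, m) with m > 3. *)
Definition low_lt13 s := exists e0 eb ec e2 ed,
  [/\ ec <= 1, e0 = 0 \/ e2 = 0, ed = 0 \/ [/\ ed = 1, e0 = 0, eb = 0 & ec = 0] &
  perm_eq s (nseq e0 f0 ++ nseq eb fb ++ nseq ec fc ++ nseq e2 f2 ++ nseq ed fd)].

Definition low_ge13 s := exists e0 eb e2 ed,
  [/\ e0 <= 1 \/ e2 <= 1, ed = 0 \/ [/\ ed = 1, e0 = 0 & eb = 0] &
  perm_eq s (nseq e0 f0 ++ nseq eb fb ++ nseq e2 f2'' ++ nseq ed fd'')].

Definition low_ge12 s := exists e0 e2 ec, ec <= 1 /\
  perm_eq s (nseq e0 f0 ++ nseq e2 f2' ++ nseq ec fc').

Definition low_ge23 s := exists e0 e2 e3, (e3 = 0 \/ e3 = 1 /\ 0 < e0) /\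
  perm_eq s (nseq e0 f0 ++ nseq e2 f2' ++ nseq e3 f3').

Context (n_gt0 : 0 < n).

Lemma low_0_exists d c : c != 1 -> n * c <= d ->
  exists s, [/\ low_0 s, deg_of s = d & pole_of s = c].
Proof.
move=> /even_or_odd3[e [b [b1 ->]]] H.
exists (nseq (d - n * (2 * e + 3 * b)) f0 ++ nseq e fb ++ nseq b fc).
by rewrite !of_wtE /=; split; [exists (d - n * (2 * e + 3 * b)), e, b | lia | lia].
Qed.

Lemma low_0_unique s s' : low_0 s -> low_0 s' -> deg_of s = deg_of s' ->
  pole_of s = pole_of s' -> perm_eq s s'.
Proof.
move=> [e0 [eb [ec [c1 ps]]]] [e0' [eb' [ec' [c1' ps']]]].
rewrite (deg_of_perm ps) (pole_of_perm ps) (deg_of_perm ps') (pole_of_perm ps') !of_wtE /= => Ed Ep.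
have E1 : ec = ec' by lia.
have E2 : eb = eb' by lia.
have E3 : e0 = e0' by subst; lia.
by apply: (perm_trans ps); rewrite perm_sym E1 E2 E3.
Qed.

(** With deficit at most 0, f_0, f_b and f_c suffice. Otherwise the deficit y + 1 is the number of
    factors f_2 or f_d, which have deficit 1, and the remaining pole order k is filled by f_b and
    f_c, of deficit 0. *)
Lemma low_lt13_exists d c : 3 < m -> c != 1 -> c * (n * m - 1) <= m * d ->
  exists s, [/\ low_lt13 s, deg_of s = d & pole_of s = c].
Proof.
move=> m3 c1 H; have nm : 0 < n * m by rewrite muln_gt0 n_gt0; lia.
have [dn|nd] := leqP (n * c) d.
  have [e [b [b1 E]]] := even_or_odd3 c1; subst c.
  exists (nseq (d - n * (2 * e + 3 * b)) f0 ++ nseq e fb ++ nseq b fc ++ nseq 0 f2 ++ nseq 0 fd).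
  rewrite !of_wtE /=; split; [|lia|lia].
  by exists (d - n * (2 * e + 3 * b)), e, b, 0, 0; split => //; [right | left].
have [y Ey] : exists y, n * c = d + y.+1 by exists (n * c - d).-1; lia.
have H' : m * y.+1 <= c.
  have : c * (n * m - 1) + c = m * (n * c) by rewrite mulnBr; nia.
  by rewrite Ey mulnDr; lia.
have [k Ek] : exists k, c = m * y.+1 + k by exists (c - m * y.+1); lia.
(* Naming the predecessor of n m removes the truncated subtractions for [lia]. *)
have [N EN] : exists N, n * m = N.+1 by exists (n * m).-1; lia.
have e2 : n * m - 1 = N by lia.
have ed : n * (m + 1) - 1 = N + n by lia.
have Enc : N.+1 * y.+1 + n * k = d + y.+1 by rewrite -Ey Ek mulnDr mulnA EN.
(* k = 1 is the one gap that f_b and f_c cannot fill; there one f_2 becomes f_d, of the same deficit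
   and one more pole order. *)
have [k1|k1] := eqVneq k 1.
  exists (nseq 0 f0 ++ nseq 0 fb ++ nseq 0 fc ++ nseq y f2 ++ nseq 1 fd).
  split; [|rewrite !of_wtE /= ed e2; subst k; lia|rewrite !of_wtE /=; subst c k; lia].
  by exists 0, 0, 0, y, 1; split => //; [left | right].
have [e [b [b1 E]]] := even_or_odd3 k1.
exists (nseq 0 f0 ++ nseq e fb ++ nseq b fc ++ nseq y.+1 f2 ++ nseq 0 fd).
split; [|rewrite !of_wtE /= ed e2; subst k; lia|rewrite !of_wtE /=; subst c k; lia].
by exists 0, e, b, y.+1, 0; split => //; [left | left].
Qed.

Lemma low_lt13_below s : 3 < m -> low_lt13 s -> pole_of s * (n * m - 1) <= m * deg_of s.
Proof.
move=> m3 [e0 [eb [ec [e2 [ed [_ _ _ ps]]]]]].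
rewrite (deg_of_perm ps) (pole_of_perm ps) !of_wtE /=.
have nm : 0 < n * m by rewrite muln_gt0 n_gt0; lia.
have [N EN] : exists N, n * m = N.+1 by exists (n * m).-1; lia.
have e2N : n * m - 1 = N by lia.
have edN : n * (m + 1) - 1 = N + n by lia.
rewrite e2N edN.
have := congr1 (muln eb) EN; have := congr1 (muln ec) EN.
have := congr1 (muln e2) EN; have := congr1 (muln ed) EN.
lia.
Qed.

Lemma low_lt13_unique s s' : 3 < m -> low_lt13 s -> low_lt13 s' -> deg_of s = deg_of s' ->
  pole_of s = pole_of s' -> perm_eq s s'.
Proof.
move=> m3 [e0 [eb [ec [e2 [ed [c1 H1 H2 ps]]]]]] [e0' [eb' [ec' [e2' [ed' [c1' H1' H2' ps']]]]]].
rewrite (deg_of_perm ps) (pole_of_perm ps) (deg_of_perm ps') (pole_of_perm ps') !of_wtE /=.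
have nm : 0 < n * m by rewrite muln_gt0 n_gt0; lia.
have [N EN] : exists N, n * m = N.+1 by exists (n * m).-1; lia.
have e2N : n * m - 1 = N by lia.
have edN : n * (m + 1) - 1 = N + n by lia.
rewrite e2N edN => Ed Ep.
(* Equality of the deficits n c - d: f_2 and f_d contribute 1, f_0 contributes -1, f_b and f_c
   nothing. *)
have X : e2 + ed + e0' = e2' + ed' + e0.
  have := congr1 (muln e2) EN; have := congr1 (muln ed) EN.
  have := congr1 (muln e2') EN; have := congr1 (muln ed') EN.
  have := congr1 (muln n) Ep; lia.
have [E1 E2] : ed = ed' /\ e2 = e2'.
  case: H2 H2' => [d0|[d1 z0 zb zc]] [d0'|[d1' z0' zb' zc']].
  - by split; lia.
  (* This case would leave f_b and f_c to make up pole order 1. *)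
  - have E : e2 = e2' + 1 by lia.
    by move: Ep; rewrite E d0 d1' zb' zc'; lia.
  - have E : e2' = e2 + 1 by lia.
    by move: Ep; rewrite E d0' d1 zb zc; lia.
  - by split; lia.
have E3 : e0 = e0' by lia.
have E4 : ec = ec' by subst; lia.
have E5 : eb = eb' by subst; lia.
by apply: (perm_trans ps); rewrite perm_sym E1 E2 E3 E4 E5.
Qed.

(** The scheme of [low_lt13_exists], with the product f_0 f_2 at the point (3 n, 3) standing in for
    the missing f_c. For this reason f_0^2 f_2^2 takes over the part of the lead f_c^2. *)
Lemma low_ge13_exists d c : c != 1 -> c * (3 * n - 1) <= 3 * d ->
  exists s, [/\ low_ge13 s, deg_of s = d & pole_of s = c].
Proof.
move=> c1 H; have [dn|nd] := leqP (n * c) d.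
  have [e [b [b1 E]]] := even_or_odd3 c1; subst c.
  exists (nseq (d - n * (2 * e + 3 * b) + b) f0 ++ nseq e fb ++ nseq b f2'' ++ nseq 0 fd'').
  split; [|rewrite !of_wtE /=|by rewrite !of_wtE /=; lia].
    by exists (d - n * (2 * e + 3 * b) + b), e, b, 0; split => //; [right | left].
  rewrite mulnBr; have : b <= b * (3 * n) by rewrite leq_pmulr; lia.
  lia.
have [y Ey] : exists y, n * c = d + y.+1 by exists (n * c - d).-1; lia.
have [N EN] : exists N, 3 * n = N.+1 by exists (3 * n).-1; lia.
have fE : 3 * n - 1 = N by lia.
have gE : 4 * n - 1 = N + n by lia.
have H' : 3 * y.+1 <= c.
  move: H; rewrite fE; have := congr1 (muln c) EN; lia.
have [k Ek] : exists k, c = 3 * y.+1 + k by exists (c - 3 * y.+1); lia.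
have Enc : N.+1 * y.+1 + n * k = d + y.+1 by rewrite -Ey Ek mulnDr -EN; lia.
have [k1|k1] := eqVneq k 1.
  exists (nseq 0 f0 ++ nseq 0 fb ++ nseq y f2'' ++ nseq 1 fd'').
  split; [|rewrite !of_wtE /= fE gE; subst k; lia|rewrite !of_wtE /=; lia].
  by exists 0, 0, y, 1; split => //; [left | right].
have [e [b [b1 E]]] := even_or_odd3 k1.
exists (nseq b f0 ++ nseq e fb ++ nseq (y.+1 + b) f2'' ++ nseq 0 fd'').
split; [|rewrite !of_wtE /= fE|rewrite !of_wtE /=; lia].
  by exists b, e, (y.+1 + b), 0; split => //; [left | left].
by have := congr1 (muln b) EN; subst k; lia.
Qed.

Lemma low_ge13_below s : low_ge13 s -> pole_of s * (3 * n - 1) <= 3 * deg_of s.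
Proof.
move=> [e0 [eb [e2 [ed [_ _ ps]]]]].
rewrite (deg_of_perm ps) (pole_of_perm ps) !of_wtE /=.
have [N EN] : exists N, 3 * n = N.+1 by exists (3 * n).-1; lia.
have fE : 3 * n - 1 = N by lia.
have gE : 4 * n - 1 = N + n by lia.
rewrite fE gE.
have := congr1 (muln eb) EN; have := congr1 (muln ed) EN; lia.
Qed.

Lemma low_ge13_unique s s' : low_ge13 s -> low_ge13 s' -> deg_of s = deg_of s' ->
  pole_of s = pole_of s' -> perm_eq s s'.
Proof.
move=> [e0 [eb [e2 [ed [H1 H2 ps]]]]] [e0' [eb' [e2' [ed' [H1' H2' ps']]]]].
rewrite (deg_of_perm ps) (pole_of_perm ps) (deg_of_perm ps') (pole_of_perm ps') !of_wtE /=.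
have [N EN] : exists N, 3 * n = N.+1 by exists (3 * n).-1; lia.
have fE : 3 * n - 1 = N by lia.
have gE : 4 * n - 1 = N + n by lia.
rewrite fE gE => Ed Ep.
have X : e2 + ed + e0' = e2' + ed' + e0.
  have := congr1 (muln e2) EN; have := congr1 (muln ed) EN.
  have := congr1 (muln e2') EN; have := congr1 (muln ed') EN.
  have := congr1 (muln n) Ep; lia.
have [E1 E2 E3 E4] : [/\ ed = ed', e2 = e2', e0 = e0' & eb = eb'].
  by clear Ed ps ps' EN fE gE; case: H2 H2' => [d0|[d1 z0 zb]] [d0'|[d1' z0' zb']]; split; lia.
by apply: (perm_trans ps); rewrite perm_sym E1 E2 E3 E4.
Qed.

(** For odd c the bound on d is half-integral; rounding up 3 (2 n - 1) / 2 gives 3 n - 1, the degree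
    of f_c. *)
Lemma low_ge12_exists d c : c != 1 -> c * (2 * n - 1) <= 2 * d ->
  exists s, [/\ low_ge12 s, deg_of s = d & pole_of s = c].
Proof.
move=> c1 H; have [e [b [b1 E]]] := even_or_odd3 c1; subst c.
have [N EN] : exists N, 2 * n = N.+1 by exists (2 * n).-1; lia.
have fE : 2 * n - 1 = N by lia.
have gE : 3 * n - 1 = N + n by lia.
rewrite fE in H.
have H2 : e * N + b * (N + n) <= d.
  by move: H; have [->|->] : b = 0 \/ b = 1; lia.
exists (nseq (d - (e * N + b * (N + n))) f0 ++ nseq e f2' ++ nseq b fc').
split; [|rewrite !of_wtE /= fE gE; lia|rewrite !of_wtE /=; lia].
by exists (d - (e * N + b * (N + n))), e, b.
Qed.

Lemma low_ge12_below s : low_ge12 s -> pole_of s * (2 * n - 1) <= 2 * deg_of s.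
Proof.
move=> [e0 [e2 [ec [_ ps]]]].
rewrite (deg_of_perm ps) (pole_of_perm ps) !of_wtE /=.
have [N EN] : exists N, 2 * n = N.+1 by exists (2 * n).-1; lia.
have fE : 2 * n - 1 = N by lia.
have gE : 3 * n - 1 = N + n by lia.
rewrite fE gE; have := congr1 (muln ec) EN; lia.
Qed.

Lemma low_ge12_unique s s' : low_ge12 s -> low_ge12 s' -> deg_of s = deg_of s' ->
  pole_of s = pole_of s' -> perm_eq s s'.
Proof.
move=> [e0 [e2 [ec [c1 ps]]]] [e0' [e2' [ec' [c1' ps']]]].
rewrite (deg_of_perm ps) (pole_of_perm ps) (deg_of_perm ps') (pole_of_perm ps') !of_wtE /= => Ed Ep.
have E1 : ec = ec' by clear Ed; lia.
have E2 : e2 = e2' by clear Ed; lia.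
have E3 : e0 = e0' by subst; lia.
by apply: (perm_trans ps); rewrite perm_sym E1 E2 E3.
Qed.

(** f_3 alone is steeper than p 2. For odd c it occurs with at least one f_0, since f_0 f_3 sits at
    (3 n - 1, 3), the place of f_c in the preceding range. *)
Lemma low_ge23_exists d c : c != 1 -> c * (2 * n - 1) <= 2 * d ->
  exists s, [/\ low_ge23 s, deg_of s = d & pole_of s = c].
Proof.
move=> c1 H; have [e [b [b1 E]]] := even_or_odd3 c1; subst c.
have [N EN] : exists N, 2 * n = N.+1 by exists (2 * n).-1; lia.
have fE : 2 * n - 1 = N by lia.
have gE : 3 * n - 2 + 1 = N + n by lia.
rewrite fE in H.
have H2 : e * N + b * (3 * n - 2) + b <= d.
  by move: H; have [->|->] : b = 0 \/ b = 1; lia.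
exists (nseq (d - (e * N + b * (3 * n - 2))) f0 ++ nseq e f2' ++ nseq b f3').
split; [|rewrite !of_wtE /= fE; lia|rewrite !of_wtE /=; lia].
exists (d - (e * N + b * (3 * n - 2))), e, b; split => //.
by have [E|E] : b = 0 \/ b = 1; [lia | left | right; split => //; lia].
Qed.

Lemma low_ge23_below s : low_ge23 s -> pole_of s * (2 * n - 1) <= 2 * deg_of s.
Proof.
move=> [e0 [e2 [e3 [H ps]]]].
rewrite (deg_of_perm ps) (pole_of_perm ps) !of_wtE /=.
have [N EN] : exists N, 2 * n = N.+1 by exists (2 * n).-1; lia.
have fE : 2 * n - 1 = N by lia.
rewrite fE; have := congr1 (muln e3) EN; case: H => [->|[-> e00]]; lia.
Qed.

Lemma low_ge23_unique s s' : low_ge23 s -> low_ge23 s' -> deg_of s = deg_of s' ->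
  pole_of s = pole_of s' -> perm_eq s s'.
Proof.
move=> [e0 [e2 [ec [c1 ps]]]] [e0' [e2' [ec' [c1' ps']]]].
rewrite (deg_of_perm ps) (pole_of_perm ps) (deg_of_perm ps') (pole_of_perm ps') !of_wtE /= => Ed Ep.
have E1 : ec = ec' by clear Ed; lia.
have E2 : e2 = e2' by clear Ed; lia.
have E3 : e0 = e0' by subst; lia.
by apply: (perm_trans ps); rewrite perm_sym E1 E2 E3.
Qed.

Lemma points_0_uniq : uniq [:: f0; fb; fc].
Proof. by rewrite /= !inE !xpair_eqE /=; lia. Qed.

Lemma points_lt13_uniq : 3 < m -> uniq [:: f0; fb; fc; f2; fd].
Proof. by move=> m3; rewrite /= !inE !xpair_eqE /=; lia. Qed.

Lemma points_ge13_uniq : uniq [:: f0; fb; f2''; fd''].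
Proof. by rewrite /= !inE !xpair_eqE /=; lia. Qed.

Lemma points_ge12_uniq : uniq [:: f0; f2'; fc'].
Proof. by rewrite /= !inE !xpair_eqE /=; lia. Qed.

Lemma points_ge23_uniq : uniq [:: f0; f2'; f3'].
Proof. by rewrite /= !inE !xpair_eqE /=; lia. Qed.

Lemma low_0_lower : has_lower low_0 [:: fc; fc].
Proof.
apply: (@has_lowerI _ _ [:: fb; fb; fb] fc); first by exists 0, 3, 0; split.
all: by rewrite ?of_wtE ?inE ?eqxx //= ?/point_lt /= ?eqxx //=; lia.
Qed.

Lemma low_ge12_lower : has_lower low_ge12 [:: fc'; fc'].
Proof.
apply: (@has_lowerI _ _ [:: f0; f2'; f2'; f2'] fc'); first by exists 1, 3, 0; split.
all: by rewrite ?of_wtE ?inE ?eqxx //= ?/point_lt /= ?eqxx //=; lia.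
Qed.

Lemma low_ge23_lower : has_lower low_ge23 [:: f0; f3'; f3'].
Proof.
apply: (@has_lowerI _ _ [:: f2'; f2'; f2'] f3'); first by exists 0, 3, 0; split => //; left.
all: by rewrite ?of_wtE ?inE ?eqxx ?orbT //= ?/point_lt /= ?eqxx //=; lia.
Qed.

Lemma low_ge13_lower1 : has_lower low_ge13 [:: f0; f0; f2''; f2''].
Proof.
apply: (@has_lowerI _ _ [:: fb; fb; fb] f2''); first by exists 0, 3, 0, 0; split => //; left.
all: by rewrite ?of_wtE ?inE ?eqxx ?orbT //= ?/point_lt /= ?eqxx //=; lia.
Qed.

Lemma low_ge13_lower2 : has_lower low_ge13 [:: f0; fd''].
Proof.
apply: (@has_lowerI _ _ [:: fb; fb] fd''); first by exists 0, 2, 0, 0; split => //; left.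
all: by rewrite ?of_wtE ?inE ?eqxx ?orbT //= ?/point_lt /= ?eqxx //=; lia.
Qed.

Lemma low_ge13_lower3 : has_lower low_ge13 [:: fb; fd''].
Proof.
apply: (@has_lowerI _ _ [:: f0; f2''; f2''] fd''); first by exists 1, 0, 2, 0; split => //; left.
all: by rewrite ?of_wtE ?inE ?eqxx ?orbT //= ?/point_lt /= ?eqxx //=; lia.
Qed.

Lemma low_ge13_lower4 : has_lower low_ge13 [:: fd''; fd''].
Proof.
apply: (@has_lowerI _ _ [:: fb; f2''; f2''] fd''); first by exists 0, 1, 2, 0; split => //; left.
all: by rewrite ?of_wtE ?inE ?eqxx ?orbT //= ?/point_lt /= ?eqxx //=; lia.
Qed.

Let nm : 3 < m -> exists N, [/\ n * m = N.+1, n * m - 1 = N,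
  n * (m + 1) - 1 = N + n & 4 * n <= N.+1].
Proof.
move=> m3; have H : n * 4 <= n * m by rewrite leq_mul2l; lia.
by exists (n * m).-1; split; lia.
Qed.

Section Low4.
Context (m3 : 3 < m).

Lemma low_lt13_lower1 : has_lower low_lt13 [:: fc; fc].
Proof.
apply: (@has_lowerI _ _ [:: fb; fb; fb] fc); first by exists 0, 3, 0, 0, 0; split => //; left.
all: by rewrite ?of_wtE ?inE ?eqxx ?orbT //= ?/point_lt /= ?eqxx //=; lia.
Qed.

Lemma low_lt13_lower2 : has_lower low_lt13 [:: fb; fd].
Proof.
have [N [E0 E1 E2 E3]] := nm m3.
apply: (@has_lowerI _ _ [:: fc; f2] fd); first by exists 0, 0, 1, 1, 0; split => //; left.
all: by rewrite ?of_wtE ?inE ?eqxx ?orbT //= ?/point_lt /= ?E1 ?E2 ?eqxx //=; lia.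
Qed.

Lemma low_lt13_lower3 : has_lower low_lt13 [:: fc; fd].
Proof.
have [N [E0 E1 E2 E3]] := nm m3.
apply: (@has_lowerI _ _ [:: fb; fb; f2] fd); first by exists 0, 2, 0, 1, 0; split => //; left.
all: by rewrite ?of_wtE ?inE ?eqxx ?orbT //= ?/point_lt /= ?E1 ?E2 ?eqxx //=; lia.
Qed.

Lemma low_lt13_lower4 : has_lower low_lt13 [:: fd; fd].
Proof.
have [N [E0 E1 E2 E3]] := nm m3.
apply: (@has_lowerI _ _ [:: fb; f2; f2] fd); first by exists 0, 1, 0, 2, 0; split => //; left.
all: by rewrite ?of_wtE ?inE ?eqxx ?orbT //= ?/point_lt /= ?E1 ?E2 ?eqxx //=; lia.
Qed.

Let fbfc e b : exists2 s, s = nseq e fb ++ nseq b fc &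
  [/\ {subset s <= [:: fb; fc]}, deg_of s = n * (2 * e + 3 * b) & pole_of s = 2 * e + 3 * b].
Proof.
exists (nseq e fb ++ nseq b fc) => //; rewrite !of_wtE /=; split; try lia.
by move=> w; rewrite mem_cat !inE => /orP[] /nseqP[-> _]; rewrite eqxx ?orbT.
Qed.

(** The point of f_0 f_d has deficit 0, so its normal form is a product of f_b and f_c alone; the
    same holds for f_0 f_2 below. *)
Lemma low_lt13_lower5 : has_lower low_lt13 [:: f0; fd].
Proof.
have [N [E0 E1 E2 E3]] := nm m3.
have m1 : m + 1 != 1 by lia.
have [e [b [b1 E]]] := even_or_odd3 m1; have [s Es [sub Ed Ep]] := fbfc e b.
apply: (@has_lowerI _ _ s fd); first by exists 0, e, b, 0, 0; rewrite Es cats0; split => //; left.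
4: by apply/allP => w /sub; rewrite !inE => /orP[] /eqP ->; rewrite /point_lt /= ?E1 ?E2; lia.
all: by rewrite ?Ed ?Ep -?E ?of_wtE ?inE ?eqxx ?orbT //= ?/point_lt /= ?E1 ?E2 ?eqxx //=; lia.
Qed.

Lemma low_lt13_lower6 : has_lower low_lt13 [:: f0; f2].
Proof.
have [N [E0 E1 E2 E3]] := nm m3.
have m1 : m != 1 by lia.
have [e [b [b1 E]]] := even_or_odd3 m1; have [s Es [sub Ed Ep]] := fbfc e b.
apply: (@has_lowerI _ _ s f2); first by exists 0, e, b, 0, 0; rewrite Es cats0; split => //; left.
4: by apply/allP => w /sub; rewrite !inE => /orP[] /eqP ->; rewrite /point_lt /= ?E1 ?E2; lia.
all: by rewrite ?Ed ?Ep -?E ?of_wtE ?inE ?eqxx ?orbT //= ?/point_lt /= ?E1 ?E2 ?eqxx //=; lia.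
Qed.

End Low4.

Lemma low_0_extremal (w : nat * nat) s : w \in [:: f0; fb; fc] ->
  deg_of ([:: fc; fc] ++ s) != w.1.
Proof.
clear -n_gt0.
by rewrite !of_wtE !inE => /or3P[] /eqP -> /=; move: (deg_of s) => d; lia. Qed.

Lemma low_ge12_extremal (w : nat * nat) s : w \in [:: f0; f2'; fc'] ->
  deg_of ([:: fc'; fc'] ++ s) != w.1.
Proof.
clear -n_gt0.
by rewrite !of_wtE !inE => /or3P[] /eqP -> /=; move: (deg_of s) => d; lia. Qed.

Lemma low_ge13_extremal (w : nat * nat) M s : w \in [:: fb; fd''] ->
  M \in [:: [:: f0; f0; f2''; f2'']; [:: f0; fd'']; [:: fb; fd'']; [:: fd''; fd'']] ->
  deg_of (M ++ s) != w.1.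
Proof.
clear -n_gt0.
rewrite !inE => /orP[] /eqP -> /or4P[] /eqP ->; rewrite !of_wtE /=;
  by move: (deg_of s) => d; lia.
Qed.

(** Degrees settle every case except f_d against f_c^2 or f_0 f_2, where there is room for a
    cofactor; the next two lemmas bound its pole order. *)
Lemma low_lt13_extremal (w : nat * nat) M s : 3 < m -> w \in [:: fb; fc; fd] ->
  M \in [:: [:: fc; fc]; [:: fb; fd]; [:: fc; fd]; [:: fd; fd]; [:: f0; fd]; [:: f0; f2]] ->
  deg_of (M ++ s) = w.1 -> w = fd /\ (M = [:: fc; fc] \/ M = [:: f0; f2]).
Proof.
move=> m3; have [N [E0 E1 E2 E3]] := nm m3.
rewrite !inE => /or3P[] /eqP -> /or4P[|||/or3P[]] /eqP ->; rewrite !of_wtE /= ?E1 ?E2;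
  move: (deg_of s) => d E; try (by exfalso; lia); by split; [|left + right].
Qed.

(** The cofactor has degree n - 1 and slope below 3 / (3 n - 1), which leaves only pole order 0. *)
Lemma low_lt13_extremal_low d c : 3 < m ->
  (d, c) = (0, 0) \/ c * (3 * n - 1) < 3 * d ->
  1 + (n * m - 1 + d) = n * (m + 1) - 1 -> m + c < m + 1.
Proof.
move=> m3; have [N [E0 E1 E2 E3]] := nm m3; rewrite E1 E2 => H Ed.
have dE : d = n - 1 by lia.
case: H => [[_ ->]|H]; first by lia.
suff -> : c = 0 by lia.
apply/eqP; rewrite -leqn0 -ltnS; rewrite -(ltn_pmul2r (_ : 0 < 3 * n - 1)); last by lia.
by apply: leq_trans H _; rewrite dE mul1n; lia.
Qed.

(** The cofactor of f_c^2 has degree n j - 1 with j = m - 5. Pole order j in that degree would be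
    steeper than the point (n (m - 1) - 1, m - 1), because j / (n j - 1) decreases with j. *)
Lemma low_lt13_extremal_square d c : 3 < m ->
  (d, c) = (0, 0) \/ c * (n * (m - 1) - 1) < (m - 1) * d ->
  3 * n + (3 * n + d) = n * (m + 1) - 1 -> 6 + c < m + 1.
Proof.
move=> m3; have [N [E0 E1 E2 E3]] := nm m3; rewrite E2 => H Ed.
case: H => [[d0 ->]|H].
  have : n * 5 < n * m by lia.
  by rewrite ltn_pmul2l //; lia.
rewrite ltnNge; apply/negP => Hc.
have [k Ek] : exists k, m = k + 1 by exists (m - 1); lia.
have Enk : n * k = N.+1 - n by rewrite -E0 Ek mulnDr; lia.
move: H; rewrite Ek addnK Enk.
have Hk : k * (k - 4) <= k * c by rewrite leq_mul2l; lia.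
have k4 : 3 <= k by lia.
have nk : n * 3 <= n * k by rewrite leq_mul2l k4 orbT.
have H1 : (k - 4) * (N.+1 - n - 1) <= c * (N.+1 - n - 1) by rewrite leq_mul2r; lia.
move=> H2; have {H1 H2} : (k - 4) * (N.+1 - n - 1) < k * d by exact: leq_ltn_trans H1 H2.
have -> : N.+1 - n - 1 = n * k - 1 by rewrite Enk.
have dE : d + 4 * n + 1 = n * k by lia.
have [k4'|k4'] := ltnP 4 k; last first.
  have : n * k <= n * 4 by rewrite leq_mul2l k4' orbT.
  lia.
have [j Ej] : exists j, k = j + 4 by exists (k - 4); lia.
rewrite -dE Ej addnK addnK.
have dEj : d + 1 = n * j by move: dE; rewrite Ej mulnDr; lia.
by have := congr1 (muln j) dEj; have := congr1 (muln 4) dEj; lia.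
Qed.

Lemma point_lt_pt3 d c : (2 * n - 1) * c = 2 * d + 1 -> 5 <= c -> point_lt fc' (d, c).
Proof.
clear -n_gt0.
move=> E c5; rewrite /point_lt /=;
  have : (2 * n - 1) * 5 <= (2 * n - 1) * c by rewrite leq_mul2l c5 orbT.
lia.
Qed.

End LowForms.

(** * Coordinates of the generators and the bridge to normal forms *)

Section Values.
Context (alpha : rat) (alpha_gt0 : (0 < alpha)%R).
Context (v : seq (nat * nat)) (hv : best_lower_approxs alpha v).
Local Notation r := (size v).-1.
Local Notation A := (pt v r).
Local Notation n := (pt v 1).1.
Local Notation th := (theta alpha).
Local Notation p := (pt v).
Local Notation gens := (generators alpha v).
Local Notation LT := (leading_terms alpha v).
Local Notation tab := (table alpha v).

Let hp : approx_path A r p := pt_path alpha_gt0 hv.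
Let r_gt0' : 0 < r := r_gt0 alpha_gt0 hv.
Let p0 : p 0 = (1, 0) := pt0E alpha_gt0 hv.
Let n_gt0' : 0 < n := n_gt0 alpha_gt0 hv.
Let th0 : (0 <= th)%R := theta_ge0 alpha.

Lemma ptbE : (th < 1 / 2)%R -> ptb alpha = (2 * n, 2).
Proof.
move=> lt; have ge0 := th0; rewrite /ptb; congr (_, _);
  apply: (@ceil_div_alpha _ alpha_gt0 _ hv 2); rewrite !natrM; lra.
Qed.

Lemma ptcE : (th < 1 / 3)%R -> ptc alpha = (3 * n, 3).
Proof.
move=> lt; have ge0 := th0; rewrite /ptc; congr (_, _);
  apply: (@ceil_div_alpha _ alpha_gt0 _ hv 3); rewrite !natrM; lra.
Qed.

Lemma ptcE' : (1 / 2 <= th < 2 / 3)%R -> ptc alpha = (3 * n - 1, 3).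
Proof.
move=> /andP[ge lt]; rewrite /ptc; congr (_, _).
by apply: (@ceil_div_alpha _ alpha_gt0 _ hv 3); rewrite natrB ?natrM; [lra | lia | lra | lia].
Qed.

Lemma pt2E : 1 < r -> p 2 = (n * (p 2).2 - 1, (p 2).2).
Proof.
by move=> r1; rewrite -(pt2_det alpha_gt0 hv r1) addnK -surjective_pairing.
Qed.

Lemma ptdE : 1 < r -> ptd v = (n * ((p 2).2 + 1) - 1, (p 2).2 + 1).
Proof.
move=> r1; rewrite /ptd (pt1_snd alpha_gt0 hv); have := pt2_det alpha_gt0 hv r1.
by move=> H; congr (_, _); lia.
Qed.

Lemma below_add (w u : nat * nat) : below A w -> below A u ->
  below A (w.1 + u.1, w.2 + u.2).
Proof. by rewrite /below /= mulnDl mulnDr; apply: leq_add. Qed.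

Lemma below_ge1 c : below A (n * c, c).
Proof.
have := path_below hp r_gt0'; rewrite /below (pt1_snd alpha_gt0 hv) mul1n /= => H.
have := leq_mul H (leqnn c); lia.
Qed.

Lemma pt_snd_cases j : j <= r -> [\/ (p j).2 = 0, (p j).2 = 1,
  1 < r /\ (p j).2 = (p 2).2 | 2 < r /\ (p 3).2 <= (p j).2].
Proof.
case: j => [|[|[|j]]] jr.
- by constructor 1; rewrite p0.
- by constructor 2; exact: (pt1_snd alpha_gt0 hv).
- by constructor 3.
constructor 4; split; first by apply: leq_trans jr.
case: j jr => [|j] jr; first by [].
by apply/ltnW/(path_snd_lt hp); lia.
Qed.

(* As d_2 c_3 = c_2 d_3 + 1, the bound c_3 >= 2 c_2 - 1 gives a bound on d_3. *)
Lemma pt3_bounds : 2 < r -> 2 < (p 2).2 ->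
  n * ((p 2).2 + 1) - 1 <= (p 3).1 /\ (p 2).2 + 1 < (p 3).2.
Proof.
move=> r2 m2; have r1 : 1 < r by lia.
have c3 := pt3_snd_ge alpha_gt0 hv r2; have det := pt3_det alpha_gt0 hv r2.
have E2 := pt2_det alpha_gt0 hv r1.
move: (p 2) (p 3) m2 c3 det E2 => [d2 m] [d3 c] /= m2 c3 det E2; split; last by lia.
have d2c : d2 * (2 * m - 1) <= d2 * c by rewrite leq_mul2l; lia.
have m0 : 0 < m by lia.
have : m * (2 * (n * m) - n - 2) <= m * d3.
  have <- : d2 + 1 = n * m by [].
  have Em : m * n = d2 + 1 by lia.
  rewrite !mulnBr mulnCA; have : m * (2 * (d2 + 1)) = 2 * m * d2 + 2 * m by lia.
  have : d2 * (2 * m - 1) = 2 * m * d2 - d2 by rewrite mulnBr; lia.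
  have : d2 <= m * d2 by rewrite leq_pmull.
  lia.
rewrite leq_pmul2l // => H.
have : n * 3 <= n * m by rewrite leq_mul2l; lia.
by move: H; rewrite mulnDr; lia.
Qed.

(** The quartic carries no condition on theta because, among leading terms, its monomial occurs only
    for theta in [1/3, 1/2); see [boxedP]. *)
Definition boxed : pred 'X_{1..size gens} := fun m =>
  (m == monom gens [:: p 0; p 0; p 2; p 2]) ||
  (m == monom gens [:: p 0; p 3; p 3]) && (3 / 4 <= th)%R.

Lemma normal_forms_of_cone_data i0 L low : cone_data A r p gens LT i0 L tab low ->
  normal_forms alpha gens LT (normal r p low).
Proof.
move=> cd; have reg (w : nat * nat) : 0 < w.1 -> below A w = (w.2%:R <= alpha * w.1%:R)%R.
  by move=> w0; rewrite (belowE alpha_gt0 hv w0) /slope ler_pdivrMr ?ltr0n.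
split.
- exact: (cd_uniq cd).
- move=> w /(gens_below hp cd)[w0 w1 wb]; split => //.
  by rewrite -reg.
- move=> M /(cd_LT cd)[ML w /(cd_LTlow cd ML) wL|[i [g [ir -> Hg _]]] w].
    by apply/(cd_mem cd); left.
  have i2 := cd_i0 cd.
  rewrite !inE => /orP[] /eqP ->; first by apply: (path_gens cd); lia.
  by apply/(cd_mem cd); case: Hg => [|[j jr ->]]; [left | right; exists j => //; lia].
- by move=> s; exact: (normal_gens cd).
- move=> d c c1 H; apply: (normal_exists hp cd) => //.
  have [d0|d0] := posnP d; last by rewrite reg.
  by move: H; rewrite d0 mulr0 lern0 => /eqP ->; rewrite /below /= muln0.
- by move=> s; exact: (normal_standard hp cd).
- by move=> s s'; exact: (normal_unique hp cd).
- by move=> s M; exact: (normal_lt hp cd).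
Qed.

Lemma leading_terms_size M : M \in LT -> [\/ size M = 2,
  [/\ (1 / 3 <= th < 1 / 2)%R & M = [:: p 0; p 0; p 2; p 2]] |
  [/\ (2 / 3 <= th)%R & M = [:: p 0; p 3; p 3]]].
Proof.
case/(mem_leading_terms alpha_gt0 hv) => [[i [j [_ _ _ _ ->]]]|[i [e [_ _ ->]]]|];
  [by constructor 1 | by constructor 1 |].
rewrite /table; case: ifP => _.
  by rewrite inE => /eqP ->; constructor 1.
case: (ltP th (1 / 3)%R) => th13.
  by rewrite !inE => /or4P[|||/or3P[]] /eqP ->; constructor 1.
case: (ltP th (1 / 2)%R) => th12.
  rewrite !inE => /or4P[] /eqP ->; [constructor 2 | by constructor 1..].
  by split => //; rewrite th13 th12.
case: (ltP th (2 / 3)%R) => th23; rewrite inE => /eqP ->; first by constructor 1.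
by constructor 3.
Qed.

End Values.

(** * The five ranges of theta *)

Section Cases.
Context (alpha : rat) (alpha_gt0 : (0 < alpha)%R).
Context (v : seq (nat * nat)) (hv : best_lower_approxs alpha v).
Local Notation r := (size v).-1.
Local Notation A := (pt v r).
Local Notation n := (pt v 1).1.
Local Notation th := (theta alpha).
Local Notation p := (pt v).
Local Notation exc := (exceptional alpha v).
Local Notation gens := (generators alpha v).
Local Notation LT := (leading_terms alpha v).
Local Notation tab := (table alpha v).

Let hp : approx_path A r p := pt_path alpha_gt0 hv.
Let r_gt0' : 0 < r := r_gt0 alpha_gt0 hv.
Let p0 : p 0 = (1, 0) := pt0E alpha_gt0 hv.
Let n_gt0' : 0 < n := n_gt0 alpha_gt0 hv.
Let th0 : (0 <= th)%R := theta_ge0 alpha.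

(** The second clause concerns generators off the path, that is, exceptional ones, to which the
    best-approximation argument does not apply. *)
Definition case_data i0 L low := cone_data A r p gens LT i0 L tab low /\
  forall (w : nat * nat) M s, w \in L -> (forall j, j <= r -> w != p j) ->
    M \in tab -> {subset s <= gens} ->
    deg_of (M ++ s) = w.1 -> pole_of (M ++ s) < w.2.

Lemma r1_of_theta_gt0 : (0 < th)%R -> 1 < r.
Proof.
move=> th_gt0; suff : r != 1 by lia.
by rewrite -(theta_eq0 alpha_gt0 hv); lra.
Qed.

(** This separates the exceptional generators from the path: pole orders on the path are 0, 1, c_2,
    and then at least c_3. *)
Lemma pt_snd_neq c : 1 < c -> (1 < r -> (p 2).2 != c) -> (2 < r -> c < (p 3).2) ->
  forall j, j <= r -> (p j).2 != c.
Proof.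
move=> c1 c2 c3 j jr; case: (pt_snd_cases alpha_gt0 hv jr) => [->|->|[r1 ->]|[r2 le]].
- by rewrite eq_sym gtn_eqF // (ltn_trans _ c1).
- by rewrite eq_sym gtn_eqF.
- exact: c2.
- by rewrite gtn_eqF // (leq_trans (c3 r2) le).
Qed.

Lemma case_0 : (th = 0)%R -> exists L low, case_data 3 L low.
Proof.
move=> thE; have r1 : r = 1 by apply/eqP; rewrite -(theta_eq0 alpha_gt0 hv) thE.
have bE : ptb alpha = (2 * n, 2) by apply: (ptbE alpha_gt0 hv); rewrite thE; lra.
have cE : ptc alpha = (3 * n, 3) by apply: (ptcE alpha_gt0 hv); rewrite thE; lra.
have excE : exc = [:: (2 * n, 2); (3 * n, 3)].
  by rewrite /exceptional /has_b /has_c /has_d thE /= bE cE.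
have tabE : tab = [:: [:: (3 * n, 3); (3 * n, 3)]] by rewrite /table thE eqxx cE.
have bel2 : below A (2 * n, 2) by rewrite mulnC; exact: (below_ge1 alpha_gt0 hv).
have bel3 : below A (3 * n, 3) by rewrite mulnC; exact: (below_ge1 alpha_gt0 hv).
have uL := points_0_uniq n_gt0'.
exists [:: (1, 0); (2 * n, 2); (3 * n, 3)], (low_0 n); split.
apply: (cone_data3 alpha_gt0 hv).
- by rewrite thE; lra.
- by rewrite excE; case/andP: uL.
- by rewrite excE => e; rewrite !inE => /orP[] /eqP -> j jr;
    apply: pt_snd_neq => //; rewrite r1.
- move=> w; rewrite excE p0 r1 !inE; split=> [/or3P[] /eqP ->|[->|/orP[] /eqP ->|[]]];
    rewrite ?eqxx ?orbT //; by [constructor 1 | constructor 2; rewrite ?eqxx ?orbT].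
- rewrite excE => e; rewrite !inE => /orP[] /eqP ->;
    by split=> //; [rewrite /= muln_gt0 n_gt0' | rewrite r1 | rewrite r1].
- move=> s [e0 [eb [ec [_ ps]]]] w; rewrite (perm_mem ps).
  by rewrite !mem_cat => /or3P[] /nseqP[-> _]; rewrite !inE eqxx ?orbT.
- move=> d c; rewrite r1 /below (pt1_snd alpha_gt0 hv) mul1n /= => H c1 _.
  by apply: low_0_exists; rewrite // mulnC.
- by move=> s _; rewrite r1.
- exact: low_0_unique.
- move=> s sL nd; have := perm_counts uL sL; rewrite /= cats0 => ps.
  exists (count_mem (1, 0) s), (count_mem (2 * n, 2) s), (count_mem (3 * n, 3) s).
  by split => //; apply: indivisible_square => t; apply: nd; rewrite tabE inE.
- by rewrite tabE => M; rewrite inE => /eqP -> w; rewrite !inE => /orP[] ->; rewrite !orbT.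
- by rewrite tabE => M; rewrite inE => /eqP ->; exact: low_0_lower.
move=> w M s wL _; rewrite tabE inE => /eqP -> _ Ed.
by have := low_0_extremal n_gt0' s wL; rewrite Ed eqxx.
Qed.

Lemma pt2_snd_theta : (0 < th)%R ->
  [/\ ((p 2).2 <= 2) = (1 / 2 <= th)%R, ((p 2).2 <= 3) = (1 / 3 <= th)%R & 1 < (p 2).2].
Proof.
move=> /r1_of_theta_gt0 r1.
by rewrite !(theta_ge_inv alpha_gt0 hv) // (pt2_snd alpha_gt0 hv r1).
Qed.

Lemma case_ge12 : (1 / 2 <= th < 2 / 3)%R -> exists L low, case_data 3 L low.
Proof.
move=> /andP[th12 th23]; have th_gt0 : (0 < th)%R by lra.
have r1 := r1_of_theta_gt0 th_gt0.
have m2 : (p 2).2 = 2 by have [] := pt2_snd_theta th_gt0; rewrite th12; lia.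
have E2 : p 2 = (2 * n - 1, 2) by have := pt2E alpha_gt0 hv r1; rewrite m2 [n * 2]mulnC.
have cE : ptc alpha = (3 * n - 1, 3) by apply: (ptcE' alpha_gt0 hv); rewrite th12.
have excE : exc = [:: (3 * n - 1, 3)].
  rewrite /exceptional /has_b /has_c /has_d cE th12 th23 th0 th_gt0 orbT.
  by rewrite [(th < 1 / 2)%R]ltNge th12.
have tabE : tab = [:: [:: (3 * n - 1, 3); (3 * n - 1, 3)]].
  rewrite /table cE th23 [(th < 1 / 2)%R]ltNge th12 [(th < 1 / 3)%R]ltNge.
  by rewrite (_ : (1 / 3 <= th)%R) ?gt_eqF //; lra.
have b3 : below A (3 * n - 1, 3).
  by rewrite mulnC -(theta_ge alpha_gt0 hv (j := 1)) //; lra.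
have uL := points_ge12_uniq n_gt0'.
have c3 : 2 < r -> 5 <= (p 3).2 by move=> r2; exact: (pt3_snd_ge5 alpha_gt0 hv).
have lt3 : 2 < r -> point_lt (3 * n - 1, 3) (p 3).
  move=> r2; rewrite [p 3]surjective_pairing; apply: point_lt_pt3 => //; last exact: c3.
  by have := pt3_det alpha_gt0 hv r2; rewrite E2.
have slope2 : 3 * (2 * n - 1) < 2 * (3 * n - 1) by clear -n_gt0'; lia.
exists [:: (1, 0); (2 * n - 1, 2); (3 * n - 1, 3)], (low_ge12 n); split.
apply: (cone_data3 alpha_gt0 hv).
- by [].
- by rewrite excE.
- rewrite excE => e; rewrite !inE => /eqP -> j jr; apply: pt_snd_neq => //.
    by rewrite m2.
  by move=> r2; apply: leq_trans (c3 r2).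
- move=> w; rewrite excE p0 E2 !inE; split=> [/or3P[/eqP ->|/eqP ->|H]|[->|->|[_ ->]]];
    rewrite ?eqxx ?orbT //; by [constructor 1 | constructor 3 | constructor 2].
- rewrite excE => e; rewrite !inE => /eqP ->; split; rewrite ?E2 //=.
  by clear -n_gt0'; lia.
- move=> s [e0 [eb [ec [_ ps]]]] w; rewrite (perm_mem ps).
  by rewrite !mem_cat => /or3P[] /nseqP[-> _]; rewrite !inE eqxx ?orbT.
- by move=> d c _ c1 /(_ r1); rewrite E2; exact: low_ge12_exists.
- by move=> s ls _; rewrite E2; exact: low_ge12_below.
- exact: low_ge12_unique.
- move=> s sL nd; have := perm_counts uL sL; rewrite /= cats0 => ps.
  exists (count_mem (1, 0) s), (count_mem (2 * n - 1, 2) s), (count_mem (3 * n - 1, 3) s).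
  by split => //; apply: indivisible_square => t; apply: nd; rewrite tabE inE.
- by rewrite tabE => M; rewrite inE => /eqP -> w; rewrite !inE => /orP[] ->; rewrite !orbT.
- by rewrite tabE => M; rewrite inE => /eqP ->; exact: low_ge12_lower.
move=> w M s wL _; rewrite tabE inE => /eqP -> _ Ed.
by have := low_ge12_extremal n_gt0' s wL; rewrite Ed eqxx.
Qed.

Lemma case_ge13 : (1 / 3 <= th < 1 / 2)%R ->
  [/\ 1 < r, p 2 = (3 * n - 1, 3), ptb alpha = (2 * n, 2) & ptd v = (4 * n - 1, 4)] /\
  case_data 3 [:: (1, 0); (2 * n, 2); (3 * n - 1, 3); (4 * n - 1, 4)] (low_ge13 n).
Proof.
move=> /andP[th13 th12]; have th_gt0 : (0 < th)%R by lra.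
have r1 := r1_of_theta_gt0 th_gt0.
have m3 : (p 2).2 = 3.
  by have [] := pt2_snd_theta th_gt0; rewrite th13 leNgt th12 /=; lia.
have E2 : p 2 = (3 * n - 1, 3) by have := pt2E alpha_gt0 hv r1; rewrite m3 [n * 3]mulnC.
have bE : ptb alpha = (2 * n, 2) by apply: (ptbE alpha_gt0 hv).
have dE : ptd v = (4 * n - 1, 4) by rewrite (ptdE alpha_gt0 hv r1) m3 [n * _]mulnC.
have excE : exc = [:: (2 * n, 2); (4 * n - 1, 4)].
  rewrite /exceptional /has_b /has_c /has_d bE dE th12 th0 th_gt0 /=.
  by rewrite [(th < 1 / 3)%R]ltNge th13 [(1 / 2 <= th)%R]leNgt th12.
have tabE : tab = [:: [:: (1, 0); (1, 0); (3 * n - 1, 3); (3 * n - 1, 3)];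
    [:: (1, 0); (4 * n - 1, 4)]; [:: (2 * n, 2); (4 * n - 1, 4)];
    [:: (4 * n - 1, 4); (4 * n - 1, 4)]].
  by rewrite /table p0 E2 bE dE th12 [(th < 1 / 3)%R]ltNge th13 gt_eqF.
have bel2 : below A (2 * n, 2) by rewrite mulnC; exact: (below_ge1 alpha_gt0 hv).
have bel4 : below A (4 * n - 1, 4).
  have := below_add (path_below hp r_gt0') (path_below hp r1).
  by rewrite -/(ptd v) dE.
have uL := points_ge13_uniq n_gt0'.
have next : 2 < r -> 4 * n - 1 <= (p 3).1 /\ 4 < (p 3).2.
  by move=> r2; have := pt3_bounds alpha_gt0 hv r2; rewrite m3 [n * _]mulnC; apply.
have slope2 : 2 * (3 * n - 1) < 3 * (2 * n) by clear -n_gt0'; lia.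
have slope4 : 4 * (3 * n - 1) < 3 * (4 * n - 1) by clear -n_gt0'; lia.
split => //; split.
apply: (cone_data3 alpha_gt0 hv).
- by lra.
- by rewrite excE /= !inE xpair_eqE andbF.
- rewrite excE => e; rewrite !inE => /orP[] /eqP -> j jr; apply: pt_snd_neq => //;
    rewrite ?m3 //; by move=> /next[_ H]; apply: leq_trans H.
- move=> w; rewrite excE p0 E2 !inE.
  split=> [/or4P[] /eqP ->|[->|/orP[] /eqP ->|[_ ->]]]; rewrite ?eqxx ?orbT //;
    by [constructor 1 | constructor 3 | constructor 2; rewrite ?eqxx ?orbT].
- rewrite excE => e; rewrite !inE => /orP[] /eqP ->; split; rewrite ?E2 //=.
  + by rewrite muln_gt0 n_gt0'.
  + move=> /next; move: (p 3) => [d c] /=; rewrite /point_lt /=; clear -n_gt0'; lia.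
  + by clear -n_gt0'; lia.
  + move=> /next; move: (p 3) => [d c] /=; rewrite /point_lt /=; clear -n_gt0'; lia.
- move=> s [e0 [eb [ec [ed [_ _ ps]]]]] w; rewrite (perm_mem ps).
  by rewrite !mem_cat => /or4P[] /nseqP[-> _]; rewrite !inE eqxx ?orbT.
- by move=> d c _ c1 /(_ r1); rewrite E2; exact: low_ge13_exists.
- by move=> s ls _; rewrite E2; exact: low_ge13_below.
- exact: low_ge13_unique.
- move=> s sL nd; have := perm_counts uL sL; rewrite /= cats0 => ps.
  exists (count_mem (1, 0) s), (count_mem (2 * n, 2) s), (count_mem (3 * n - 1, 3) s),
    (count_mem (4 * n - 1, 4) s).
  have H1 : count_mem (1, 0) s <= 1 \/ count_mem (3 * n - 1, 3) s <= 1.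
    by apply: indivisible_quartic => [|t]; [rewrite xpair_eqE andbF | apply: nd;
      rewrite tabE !inE eqxx].
  have H2 : count_mem (1, 0) s = 0 \/ count_mem (4 * n - 1, 4) s = 0.
    by apply: indivisible_pair => [|t]; [rewrite xpair_eqE andbF | apply: nd;
      rewrite tabE !inE eqxx !orbT].
  have H3 : count_mem (2 * n, 2) s = 0 \/ count_mem (4 * n - 1, 4) s = 0.
    by apply: indivisible_pair => [|t]; [rewrite xpair_eqE andbF | apply: nd;
      rewrite tabE !inE eqxx !orbT].
  have H4 : count_mem (4 * n - 1, 4) s <= 1.
    by apply: indivisible_square => t; apply: nd; rewrite tabE !inE eqxx !orbT.
  split => //; clear -H2 H3 H4.
  have [|d0] := posnP (count_mem (4 * n - 1, 4) s); first by left.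
  by right; split; [lia | case: H2 => // E; rewrite E in d0 | case: H3 => // E; rewrite E in d0].
- rewrite tabE => M; rewrite !inE => /or4P[] /eqP -> w; rewrite !inE => H;
    by repeat (case/orP: H => H); rewrite H ?orbT.
- rewrite tabE => M; rewrite !inE => /or4P[] /eqP ->.
  + exact: low_ge13_lower1.
  + exact: low_ge13_lower2.
  + exact: low_ge13_lower3.
  + exact: low_ge13_lower4.
move=> w M s wL now; rewrite tabE => ML _ Ed; exfalso.
have wE : w \in [:: (2 * n, 2); (4 * n - 1, 4)].
  move: wL (now 0 isT) (now 2 r1); rewrite p0 E2 !inE.
  by case/or4P => ->; rewrite ?orbT.
by have := low_ge13_extremal n_gt0' s wE ML; rewrite Ed eqxx.
Qed.

Lemma case_lt13 : (0 < th < 1 / 3)%R -> exists L low, case_data 3 L low.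
Proof.
move=> /andP[th_gt0 th13].
have r1 := r1_of_theta_gt0 th_gt0.
have m3 : 3 < (p 2).2.
  by have [_ H _] := pt2_snd_theta th_gt0; rewrite ltnNge H -ltNge.
have E2 := pt2E alpha_gt0 hv r1.
have bE : ptb alpha = (2 * n, 2) by apply: (ptbE alpha_gt0 hv); lra.
have cE : ptc alpha = (3 * n, 3) by apply: (ptcE alpha_gt0 hv).
have dE := ptdE alpha_gt0 hv r1.
(* These two points above the line give the slope bounds on cofactors in the extremality of f_d; the
   first one uses that m is the least c with 1 / c <= theta. *)
have not_u : ~~ below A (n * ((p 2).2 - 1) - 1, (p 2).2 - 1).
  rewrite -(theta_ge alpha_gt0 hv (j := 1)); last by clear -m3; lia.
  by rewrite (theta_ge_inv alpha_gt0 hv) // -?ltnNge; clear -m3; lia.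
have not_u3 : ~~ below A (3 * n - 1, 3).
  by rewrite mulnC -(theta_ge alpha_gt0 hv (j := 1)) // -ltNge.
have next : 2 < r -> n * ((p 2).2 + 1) - 1 <= (p 3).1 /\ (p 2).2 + 1 < (p 3).2.
  by move=> r2; apply: (pt3_bounds alpha_gt0 hv r2); apply: ltn_trans m3.
have belb : below A (2 * n, 2) by rewrite mulnC; exact: (below_ge1 alpha_gt0 hv).
have belc : below A (3 * n, 3) by rewrite mulnC; exact: (below_ge1 alpha_gt0 hv).
have beld : below A (ptd v) := below_add (path_below hp r_gt0') (path_below hp r1).
rewrite dE in beld.
have excE : exc = [:: (2 * n, 2); (3 * n, 3); (n * ((p 2).2 + 1) - 1, (p 2).2 + 1)].
  rewrite /exceptional /has_b /has_c /has_d bE cE dE th0 th_gt0 th13 /=.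
  by have -> : (th < 1 / 2)%R by lra.
have tabE : tab = [:: [:: (3 * n, 3); (3 * n, 3)];
    [:: (2 * n, 2); (n * ((p 2).2 + 1) - 1, (p 2).2 + 1)];
    [:: (3 * n, 3); (n * ((p 2).2 + 1) - 1, (p 2).2 + 1)];
    [:: (n * ((p 2).2 + 1) - 1, (p 2).2 + 1); (n * ((p 2).2 + 1) - 1, (p 2).2 + 1)];
    [:: (1, 0); (n * ((p 2).2 + 1) - 1, (p 2).2 + 1)];
    [:: (1, 0); (n * (p 2).2 - 1, (p 2).2)]].
  by rewrite /table p0 -E2 bE cE dE th13 gt_eqF.
set m := (p 2).2 in m3 E2 not_u next beld excE tabE.
have uL := points_lt13_uniq n_gt0' m3.
have nm : 4 * n <= n * m by rewrite mulnC leq_mul2l m3 orbT.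
have nm1 : n * (m + 1) = n * m + n by rewrite mulnDr muln1.
exists [:: (1, 0); (2 * n, 2); (3 * n, 3); (n * m - 1, m);
  (n * (m + 1) - 1, m + 1)], (low_lt13 n m).
have slopes : [/\ 2 * (n * m - 1) < m * (2 * n), 3 * (n * m - 1) < m * (3 * n) &
    (m + 1) * (n * m - 1) < m * (n * (m + 1) - 1)].
  have [N EN] : exists N, n * m = N.+1.
    by exists (n * m).-1; clear -nm n_gt0'; lia.
  rewrite nm1 EN subn1 addSn subn1 /=; clear -EN; split; lia.
have [sb sc sd] := slopes.
suff cd : cone_data A r p gens LT 3 [:: (1, 0); (2 * n, 2); (3 * n, 3);
    (n * m - 1, m); (n * (m + 1) - 1, m + 1)] tab (low_lt13 n m).
  split=> // w M s wL now; rewrite tabE => ML sg Ed.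
  have wE : w \in [:: (2 * n, 2); (3 * n, 3); (n * (m + 1) - 1, m + 1)].
    move: wL (now 0 isT) (now 2 r1); rewrite p0 E2 !inE.
    by case/or4P => [->|->|->|/orP[->|->]]; rewrite ?orbT.
  have [Ew EM] := low_lt13_extremal n_gt0' m3 wE ML Ed.
  have bel := below_sum hp cd sg; rewrite Ew in Ed *.
  case: EM Ed => ->; rewrite /cat !(deg_of_cons, pole_of_cons) => Ed.
    exact: (low_lt13_extremal_square n_gt0' m3 (below_lt hp bel not_u) Ed).
  exact: (low_lt13_extremal_low n_gt0' m3 (below_lt hp bel not_u3) Ed).
apply: (cone_data3 alpha_gt0 hv).
- by lra.
- by rewrite excE; move: uL => /= /and4P[_ H1 H2 _]; move: H1 H2;
  rewrite !inE !negb_or => /and3P[-> _ ->] /andP[_ ->].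
- rewrite excE => e; rewrite !inE => /or3P[] /eqP -> j jr; apply: pt_snd_neq => //;
    rewrite /= -/m; first [by move: m3; clear; lia | by move=> /next[_ H]; move: m3 H; clear; lia].
- move=> w; rewrite excE p0 E2 !inE.
  split=> [/or4P[| | |/orP[]] /eqP ->|[->|/or3P[] /eqP ->|[_ ->]]]; rewrite ?eqxx ?orbT //;
    by [constructor 1 | constructor 3 | constructor 2; rewrite ?eqxx ?orbT].
- rewrite excE => e; rewrite !inE => /or3P[] /eqP ->; split; rewrite ?E2 //=.
  + by rewrite muln_gt0 n_gt0'.
  + move=> /next; move: (p 3) => [d c] /=; rewrite /point_lt /=; clear -n_gt0' m3 nm nm1; lia.
  + by rewrite muln_gt0 n_gt0'.
  + move=> /next; move: (p 3) => [d c] /=; rewrite /point_lt /=; clear -n_gt0' m3 nm nm1; lia.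
  + by clear -n_gt0' m3 nm nm1; lia.
  + by clear -m3; lia.
  + move=> /next; move: (p 3) => [d c] /=; rewrite /point_lt /=; clear -n_gt0' m3 nm nm1; lia.
- move=> s [e0 [eb [ec [e2 [ed [_ _ _ ps]]]]]] w; rewrite (perm_mem ps).
  by rewrite !mem_cat => /or4P[| | |/orP[]] /nseqP[-> _]; rewrite !inE eqxx ?orbT.
- by move=> d c _ c1 /(_ r1); rewrite E2; exact: low_lt13_exists.
- by move=> s ls _; rewrite E2; exact: low_lt13_below.
- by move=> s s'; exact: low_lt13_unique.
- move=> s sL nd; have := perm_counts uL sL; rewrite /= cats0 => ps.
  have nd' M : M \in tab -> forall t, ~~ perm_eq s (M ++ t) by move=> ML t; exact: nd.
  have pos_c : (1, 0) != (n * (m + 1) - 1, m + 1) by rewrite xpair_eqE addn1 andbF.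
  exists (count_mem (1, 0) s), (count_mem (2 * n, 2) s), (count_mem (3 * n, 3) s),
    (count_mem (n * m - 1, m) s), (count_mem (n * (m + 1) - 1, m + 1) s).
  have H1 : count_mem (3 * n, 3) s <= 1.
    by apply/indivisible_square/nd'; rewrite tabE !inE eqxx.
  have H2 : count_mem (2 * n, 2) s = 0 \/ count_mem (n * (m + 1) - 1, m + 1) s = 0.
    apply: indivisible_pair; last by apply: nd'; rewrite tabE !inE eqxx !orbT.
    by rewrite xpair_eqE negb_and orbC; clear -m3; lia.
  have H3 : count_mem (3 * n, 3) s = 0 \/ count_mem (n * (m + 1) - 1, m + 1) s = 0.
    apply: indivisible_pair; last by apply: nd'; rewrite tabE !inE eqxx !orbT.
    by rewrite xpair_eqE negb_and orbC; clear -m3; lia.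
  have H4 : count_mem (n * (m + 1) - 1, m + 1) s <= 1.
    by apply/indivisible_square/nd'; rewrite tabE !inE eqxx !orbT.
  have H5 : count_mem (1, 0) s = 0 \/ count_mem (n * (m + 1) - 1, m + 1) s = 0.
    by apply: indivisible_pair => //; apply: nd'; rewrite tabE !inE eqxx !orbT.
  have H6 : count_mem (1, 0) s = 0 \/ count_mem (n * m - 1, m) s = 0.
    apply: indivisible_pair; last by apply: nd'; rewrite tabE !inE eqxx !orbT.
    by rewrite xpair_eqE negb_and orbC; clear -m3; lia.
  split => //; clear -H2 H3 H4 H5.
  have [|d0] := posnP (count_mem (n * (m + 1) - 1, m + 1) s); first by left.
  right; split; [lia | case: H5 => // E | case: H2 => // E | case: H3 => // E];
    by rewrite E in d0.
- rewrite tabE => M; rewrite !inE => /or4P[| | |/or3P[]] /eqP -> w; rewrite !inE => H;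
    by repeat (case/orP: H => H); rewrite H ?orbT.
- rewrite tabE => M; rewrite !inE => /or4P[| | |/or3P[]] /eqP ->.
  + exact: low_lt13_lower1.
  + exact: low_lt13_lower2.
  + exact: low_lt13_lower3.
  + exact: low_lt13_lower4.
  + exact: low_lt13_lower5.
  + exact: low_lt13_lower6.
Qed.

(** Since f_0 f_3 is not a lead here, p 3 counts as a low generator and i0 is 4. *)
Lemma case_ge23 : (2 / 3 <= th)%R ->
  case_data 4 [:: (1, 0); (2 * n - 1, 2); (3 * n - 2, 3)] (low_ge23 n).
Proof.
move=> th23; have [r2 E2 E3] := theta_ge23 alpha_gt0 hv th23.
have excE : exc = [::].
  rewrite /exceptional /has_b /has_c /has_d th0.
  have -> : (th < 1 / 2)%R = false by apply/negbTE; rewrite -leNgt; lra.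
  have -> : (th < 1 / 3)%R = false by apply/negbTE; rewrite -leNgt; lra.
  have -> : (th < 2 / 3)%R = false by apply/negbTE; rewrite -leNgt; lra.
  by rewrite !andbF.
have tabE : tab = [:: [:: (1, 0); (3 * n - 2, 3); (3 * n - 2, 3)]].
  rewrite /table p0 E3.
  have -> : (th < 1 / 2)%R = false by apply/negbTE; rewrite -leNgt; lra.
  have -> : (th < 1 / 3)%R = false by apply/negbTE; rewrite -leNgt; lra.
  have -> : (th < 2 / 3)%R = false by apply/negbTE; rewrite -leNgt; lra.
  by rewrite gt_eqF //; lra.
have uL := points_ge23_uniq n_gt0'.
pose L := [:: (1, 0); (2 * n - 1, 2); (3 * n - 2, 3)].
have memL w : w \in L <-> [\/ w = p 0, w = p 2 | w = p 3].
  rewrite p0 E2 E3 !inE; split=> [/or3P[] /eqP ->|[] ->]; rewrite ?eqxx ?orbT //;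
  by [constructor 1 | constructor 2 | constructor 3].
split; first split => //.
- by apply: (generators_uniq alpha_gt0 hv); rewrite excE.
- exact: generators_sorted.
- move=> w; rewrite (mem_generators alpha_gt0 hv) excE memL; split.
    case=> [->|[[i ir ->]|//]]; first by left; constructor 1.
    have [i4|i4] := ltnP i 4; last by right; exists i => //; lia.
    by left; have [->|->] : i = 2 \/ i = 3; [lia | constructor 2 | constructor 3].
  case=> [[->|->|->]|[i ir ->]]; [by left | | | ]; right; left.
  + by exists 2 => //; lia.
  + by exists 3 => //; lia.
  + by exists i => //; lia.
- move=> M; rewrite (mem_leading_terms alpha_gt0 hv) excE; split.
    case=> [[i [j [ir ji j1 nij ->]]]|[i [e [//]]]|]; last by left.
    have i4 : 4 <= i.
      rewrite ltnNge; apply/negP => i3; have Ei : i = 3 by lia.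
      by move: nij; rewrite Ei th23; have -> : j = 0 by lia.
    right; exists i, (p j); split => //; first lia; last first.
      by apply/eqP => /(pt_inj alpha_gt0 hv); lia.
    have [j4|j4] := ltnP j 4; last by right; exists j => //; lia.
    left; apply/memL; have [->|[->|->]] : j = 0 \/ j = 2 \/ j = 3; first lia.
    + by constructor 1.
    + by constructor 2.
    + by constructor 3.
  case=> [|[i [g [ir -> Hg ne]]]]; first by constructor 3.
  have [j [Eg ji j1]] : exists j, [/\ g = p j, j < i & j != 1].
    case: Hg => [/memL[->|->|->]|[j jr ->]]; [exists 0|exists 2|exists 3|exists j]; split => //;
      lia.
  constructor 1; exists i, j; rewrite Eg; split => //; first lia; last first.
    by have -> : (i == 3) = false by lia.
  suff : j != i.-1 by lia.
  by apply: contraNneq ne => <-; rewrite Eg.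
- move=> w /memL[] ->; first by rewrite p0; split => //; rewrite /below /= mul0n.
  + by split; [rewrite E2 /=; lia | rewrite E2 | apply: (path_below hp); lia].
  + by split; [rewrite E3 /=; lia | rewrite E3 | apply: (path_below hp); lia].
- move=> j j4 jr; apply/memL.
  by have [->|->] : j = 2 \/ j = 3; [lia | constructor 2 | constructor 3].
- move=> g r4 gL /=; rewrite E3; case/memL: gL => ->; rewrite ?p0 ?E2 ?E3 ?eqxx //=; lia.
- move=> g r4 /memL[] ->; apply: (path_point_lt hp); lia.
- move=> s [e0 [eb [ec [_ ps]]]] w; rewrite (perm_mem ps).
  by rewrite !mem_cat => /or3P[] /nseqP[-> _]; rewrite !inE eqxx ?orbT.
- by move=> d c _ c1 /(_ (ltnW r2)); rewrite E2; exact: low_ge23_exists.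
- by move=> s ls _; rewrite E2; exact: low_ge23_below.
- exact: low_ge23_unique.
- move=> s sL nd; have := perm_counts uL sL; rewrite /= cats0 => ps.
  have H : count_mem (1, 0) s = 0 \/ count_mem (3 * n - 2, 3) s <= 1.
    by apply: indivisible_cube => [|t]; [rewrite xpair_eqE andbF | apply: nd; rewrite tabE inE].
  have [e3|e3] := posnP (count_mem (3 * n - 2, 3) s).
    by left; exists (count_mem (1, 0) s), (count_mem (2 * n - 1, 2) s), (count_mem (3 * n - 2,
      3) s); split; first left.
  have [e0|e0] := posnP (count_mem (1, 0) s); last first.
    left; exists (count_mem (1, 0) s), (count_mem (2 * n - 1, 2) s), (count_mem (3 * n - 2,
      3) s); split => //.
    by right; split => //; lia.
  (* Without f_0 and with some f_3, s is a product of p 2 and p 3, a high form of the first cone. *)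
  right; exists (count_mem (2 * n - 1, 2) s), (count_mem (3 * n - 2, 3) s); rewrite E2 E3;
    split => //.
  by move: ps; rewrite e0.
- by rewrite tabE => M; rewrite inE => /eqP -> w; rewrite !inE => /or3P[] ->; rewrite ?orbT.
- by rewrite tabE => M; rewrite inE => /eqP ->; exact: low_ge23_lower.
move=> w M s /memL[] -> now; [have := now 0 isT | have := now 2 (ltnW r2) | have := now 3 r2];
  by rewrite eqxx.
Qed.

End Cases.

Arguments boxed : clear implicits.

(** * The two boxed relations *)

Section Boxed.
Context (alpha : rat) (alpha_gt0 : (0 < alpha)%R).
Context (v : seq (nat * nat)) (hv : best_lower_approxs alpha v).
Local Notation r := (size v).-1.
Local Notation A := (pt v r).
Local Notation n := (pt v 1).1.
Local Notation th := (theta alpha).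
Local Notation p := (pt v).
Local Notation exc := (exceptional alpha v).
Local Notation gens := (generators alpha v).
Local Notation LT := (leading_terms alpha v).
Local Notation tab := (table alpha v).
Local Notation quartic := [:: p 0; p 0; p 2; p 2].
Local Notation cubic := [:: p 0; p 3; p 3].

Let hp : approx_path A r p := pt_path alpha_gt0 hv.
Let p0 : p 0 = (1, 0) := pt0E alpha_gt0 hv.
Let n_gt0' : 0 < n := n_gt0 alpha_gt0 hv.
Let th0 : (0 <= th)%R := theta_ge0 alpha.

Lemma exists_case : exists i0 L low, [/\ case_data alpha v i0 L low,
  (1 / 3 <= th < 1 / 2)%R -> low = low_ge13 n & (2 / 3 <= th)%R -> low = low_ge23 n].
Proof.
have [thE|th_gt0] : th = 0%R \/ (0 < th)%R.
- by have := th0; rewrite le_eqVlt => /orP[/eqP <-|]; [left | right].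
- have [L [low cd]] := case_0 alpha_gt0 hv thE.
  by exists 3, L, low; split=> //; (move=> /andP[? ?] || move=> ?); exfalso; lra.
have [th13|th13] := ltP th (1 / 3)%R.
  have [|L [low cd]] := case_lt13 alpha_gt0 hv; first by rewrite th_gt0.
  by exists 3, L, low; split=> //; (move=> /andP[? ?] || move=> ?); exfalso; lra.
have [th12|th12] := ltP th (1 / 2)%R.
  have [|_ cd] := case_ge13 alpha_gt0 hv; first by rewrite th13.
  by eexists 3, _, _; split; [exact: cd | by [] | move=> ?; exfalso; lra].
have [th23|th23] := ltP th (2 / 3)%R.
  have [|L [low cd]] := case_ge12 alpha_gt0 hv; first by rewrite th12.
  by exists 3, L, low; split=> //; (move=> /andP[? ?] || move=> ?); exfalso; lra.
eexists 4, _, _; split; first exact: (case_ge23 alpha_gt0 hv th23).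
  by (move=> /andP[? ?] || move=> ?); exfalso; lra.
by [].
Qed.

Lemma pt_gens i : i <= r -> i != 1 -> p i \in gens.
Proof.
move=> ir i1; apply/(mem_generators alpha_gt0 hv); case: i ir i1 => [|[//|i]] ir _.
  by left.
by right; left; exists i.+2.
Qed.

Context (leads_gens : forall M, M \in LT -> {subset M <= gens}).
Context (uniq_gens : uniq gens).

Lemma boxedP M : M \in LT -> reflect
  ((1 / 3 <= th < 1 / 2)%R /\ M = quartic \/ (3 / 4 <= th)%R /\ M = cubic)
  (boxed alpha v (monom gens M)).
Proof.
move=> ML; apply: (iffP idP) => [|[[_ ->]|[th34 ->]]]; rewrite /boxed ?eqxx //; last first.
  by rewrite th34 orbT.
have perm s : {subset s <= gens} -> monom gens M = monom gens s -> perm_eq M s.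
  by move=> sg /(monom_inj (leads_gens ML) sg).
case/orP => [/eqP E|/andP[/eqP E th34]].
  have [r1|r1] := ltnP 1 r.
    have /perm_size sz : perm_eq M quartic.
      by apply: perm E => w; rewrite !inE => /or4P[] /eqP ->; apply: pt_gens.
    by have [sz2|[th13 ->]|[_ EM]] := leading_terms_size alpha_gt0 hv ML;
      [rewrite sz2 in sz | left | rewrite EM in sz].
  (* For r = 1 the point p 2 is the default (0, 0), not a generator, so the quartic list denotes
     f_0^2; the only lead is then f_c^2. *)
  have r1' : r = 1 by have := r_gt0 alpha_gt0 hv; lia.
  have th_eq0 : th = 0%R by apply/eqP; rewrite (theta_eq0 alpha_gt0 hv) r1'.
  have p2 : p 2 = (0, 0) by rewrite /pt nth_default //; lia.
  have EM : M = [:: ptc alpha; ptc alpha].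
    case/(mem_leading_terms alpha_gt0 hv): ML => [[i [j [ir _ _ _ _]]]|[i [e [ir _ _]]]|].
    - by exfalso; lia.
    - by exfalso; lia.
    by rewrite /table th_eq0 eqxx inE => /eqP.
  have cg : ptc alpha \in gens by apply: (leads_gens ML); rewrite EM inE eqxx.
  have /mnmP/(_ (Ordinal (etrans (index_mem _ gens) cg))) := E.
  by rewrite EM !mnmE /= nth_index // p0 p2 !xpair_eqE !andbF eqxx.
have [r3 _] := theta_ge34 alpha_gt0 hv th34; right; split => //.
have /perm_size sz : perm_eq M cubic.
  by apply: perm E => w; rewrite !inE => /or3P[] /eqP ->; apply: pt_gens => //; lia.
have [sz2|[_ EM]|[_ //]] := leading_terms_size alpha_gt0 hv ML.
  by rewrite sz2 in sz.
by rewrite EM in sz.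
Qed.

Lemma not_boxed2 M : M \in LT -> size M = 2 -> ~~ boxed alpha v (monom gens M).
Proof. by move=> ML sz; apply/negP => /(boxedP ML)[] [_ EM]; rewrite EM in sz. Qed.

Lemma monom_mem w : w \in gens -> exists i, monom gens [:: w] = U_(i)%MM.
Proof.
move=> wg; exists (Ordinal (etrans (index_mem _ gens) wg)).
by rewrite -(monom_gen uniq_gens) /= nth_index.
Qed.

(** Only the cubic with theta < 3/4 needs work: its degree is 6 n - 3, while every other lead
    contains some p i with i >= 4, of degree at least 7 n - 5 by [theta_lt34], and a further
    factor. *)
Lemma unboxed_lead_degree M : M \in LT -> ~~ boxed alpha v (monom gens M) ->
  size M = 2 \/ forall M', M' \in LT -> deg_of M <= deg_of M'.
Proof.
move=> ML nb; have [->|[th13 EM]|[th23 EM]] := leading_terms_size alpha_gt0 hv ML.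
- by left.
- by case/(boxedP ML): nb; left.
right=> M' /(mem_leading_terms alpha_gt0 hv) ML'.
have th34 : (th < 3 / 4)%R.
  by rewrite ltNge; apply/negP => th34; case/(boxedP ML): nb; right.
have [r2 E2 E3] := theta_ge23 alpha_gt0 hv th23.
have excE : exc = [::].
  rewrite /exceptional /has_b /has_c /has_d th0.
  have -> : (th < 1 / 2)%R = false by apply/negbTE; rewrite -leNgt; lra.
  have -> : (th < 1 / 3)%R = false by apply/negbTE; rewrite -leNgt; lra.
  by rewrite [(th < 2 / 3)%R]ltNge th23 !andbF.
have tabE : tab = [:: M].
  rewrite /table EM.
  have -> : (th < 1 / 2)%R = false by apply/negbTE; rewrite -leNgt; lra.
  have -> : (th < 1 / 3)%R = false by apply/negbTE; rewrite -leNgt; lra.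
  by rewrite [(th < 2 / 3)%R]ltNge th23 gt_eqF //; lra.
case: ML' => [[i [j [ir ji j1 nij ->]]]|[i [e [_]]]|]; last 2 first.
- by rewrite excE.
- by rewrite tabE inE => /eqP ->.
rewrite EM p0 E3 !of_wtE /=.
have i4 : 4 <= i.
  rewrite ltnNge; apply/negP => i3; have Ei : i = 3 by lia.
  by move: nij; rewrite Ei th23; have -> : j = 0 by lia.
have r3 : 3 < r by lia.
have [|_ d4] := theta_lt34 alpha_gt0 hv _ r3; first by rewrite th23.
have : (p 4).1 <= (p i).1 by apply: (path_fst_le hp); lia.
have : 0 < (p j).1 by apply: (path_gt0 hp); lia.
move: d4; move: (p 4) (p i) (p j) => [? ?] [? ?] [? ?] /=; clear -n_gt0'; lia.
Qed.

Context (gens_sorted : sorted point_le gens).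

(** The normal forms of f_b f_d and f_0 f_d are f_0 f_2^2 and f_b^2, so the first syzygy sets f_0^2
    f_2^2 against f_b^3. Those of f_4 f_2 and f_4 f_0 are f_3^2 and f_2^2, so the second sets f_0
    f_3^2 against f_2^3. *)
Lemma boxed_lead_syzygy low M :
  ((1 / 3 <= th < 1 / 2)%R -> low = low_ge13 n) -> ((2 / 3 <= th)%R -> low = low_ge23 n) ->
  M \in LT -> boxed alpha v (monom gens M) ->
  let nf := normal r p low in
  exists (i j : 'I_(size gens)) M1 M2 s1 s2,
  [/\ M1 \in LT /\ ~~ boxed alpha v (monom gens M1),
      M2 \in LT /\ ~~ boxed alpha v (monom gens M2),
      [/\ nf s1, deg_of s1 = deg_of M1 & pole_of s1 = pole_of M1],
      [/\ nf s2, deg_of s2 = deg_of M2 & pole_of s2 = pole_of M2] &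
      [/\ monom gens M = (U_(i) + monom gens s1)%MM,
          (U_(i) + monom gens M1 = U_(j) + monom gens M2)%MM &
          mon_lt (U_(j) + monom gens s2)%MM (monom gens M)]].
Proof.
move=> low_ge13E low_ge23E ML /(boxedP ML) bM nf; rewrite /nf {nf}.
have [i Ei] := monom_mem (pt_gens (leq0n r) isT).
case: bM => [[th13 EM]|[th34 EM]].
  have [[r1 E2 bE dE] _] := case_ge13 alpha_gt0 hv th13.
  have tabE : tab = [:: quartic; [:: p 0; ptd v]; [:: ptb alpha; ptd v]; [:: ptd v; ptd v]].
    rewrite /table; case/andP: th13 => th13 ->.
    by rewrite gt_eqF ?[(th < 1 / 3)%R]ltNge ?th13 //; lra.
  have L1 : [:: ptb alpha; ptd v] \in LT.
    by apply/(mem_leading_terms alpha_gt0 hv); constructor 3; rewrite tabE !inE eqxx !orbT.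
  have L2 : [:: p 0; ptd v] \in LT.
    by apply/(mem_leading_terms alpha_gt0 hv); constructor 3; rewrite tabE !inE eqxx !orbT.
  have bg : ptb alpha \in gens by apply: (leads_gens L1); rewrite inE eqxx.
  have [j Ej] := monom_mem bg.
  exists i, j, [:: ptb alpha; ptd v], [:: p 0; ptd v], [:: p 0; p 2; p 2], [:: ptb alpha;
    ptb alpha].
  split; first by split => //; exact: not_boxed2.
  - by split => //; exact: not_boxed2.
  - rewrite bE dE p0 E2 !of_wtE /=; split; [right | by clear -n_gt0'; lia..].
    rewrite low_ge13E //; exists 1, 0, 2, 0; split => //; first by left.
    by left.
  - rewrite bE dE p0 !of_wtE /=; split; [right | by clear -n_gt0'; lia..].
    by rewrite low_ge13E //; exists 0, 2, 0, 0; split => //; left.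
  split.
  - by rewrite EM -Ei -monom_cat.
  - rewrite -Ei -Ej -!monom_cat; apply: monom_perm.
    by rewrite (perm_catCA [:: _] [:: _] [:: _]).
  rewrite -Ej -monom_cat EM; apply: (mon_lt_top uniq_gens gens_sorted _ _ _ _ (_ : p 2 \in _)).
  - by move=> w; rewrite !inE orbb orbb => /eqP ->.
  - by rewrite -EM; exact: leads_gens.
  - rewrite bE p0 E2 !of_wtE /=; clear -n_gt0'; lia.
  - by rewrite bE p0 E2 !of_wtE /=.
  - by rewrite !inE eqxx !orbT.
  - move=> w; rewrite !inE orbb orbb => /eqP ->; rewrite bE E2 /point_lt /=; clear -n_gt0'; lia.
  move=> w; rewrite !inE => /or4P[] /eqP ->; by [left | right; apply: (path_point_lt hp)].
have [r3 E4] := theta_ge34 alpha_gt0 hv th34.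
have th23 : (2 / 3 <= th)%R by lra.
have [r2 E2 E3] := theta_ge23 alpha_gt0 hv th23.
have L1 : [:: p 4; p 2] \in LT.
  by apply/(mem_leading_terms alpha_gt0 hv); constructor 1; exists 4, 2.
have L2 : [:: p 4; p 0] \in LT.
  by apply/(mem_leading_terms alpha_gt0 hv); constructor 1; exists 4, 0.
have g2 : p 2 \in gens := pt_gens (ltnW r2) isT.
have [j Ej] := monom_mem g2.
exists i, j, [:: p 4; p 2], [:: p 4; p 0], [:: p 3; p 3], [:: p 2; p 2].
split; first by split => //; exact: not_boxed2.
- by split => //; exact: not_boxed2.
- rewrite E2 E3 E4 !of_wtE /=; split; [left | by clear -n_gt0'; lia..].
  by exists 2, 0, 2; split => //; rewrite E3.
- rewrite p0 E2 E4 !of_wtE /=; split; [right | by clear -n_gt0'; lia..].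
  by rewrite low_ge23E //; exists 0, 2, 0; split => //; left.
split.
- by rewrite EM -Ei -monom_cat.
- rewrite -Ei -Ej -!monom_cat; apply: monom_perm.
  exact/permPl/(perm_rev [:: p 2; p 4; p 0]).
rewrite -Ej -monom_cat EM; apply: (mon_lt_top uniq_gens gens_sorted _ _ _ _ (_ : p 3 \in _)).
- by move=> w; rewrite !inE orbb orbb => /eqP ->.
- by rewrite -EM; exact: leads_gens.
- rewrite p0 E2 E3 !of_wtE /=; clear -n_gt0'; lia.
- by rewrite p0 E2 E3 !of_wtE /=.
- by rewrite !inE eqxx !orbT.
- by move=> w; rewrite !inE orbb orbb => /eqP ->; apply: (path_point_lt hp).
by move=> w; rewrite !inE => /or3P[] /eqP ->;
  [right; apply: (path_point_lt hp) | left | left].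
Qed.

End Boxed.

Local Open Scope ring_scope.

Theorem theorem2p7 (k : closedFieldType) (K : fieldType)
    (iota : {rmorphism k -> K}) (hC : elliptic_function_field iota)
    (oo : place iota) (t : nat -> K)
    (ht : forall c : nat, c != 1%N -> has_polar_divisor (t c) << c%:Z *g oo >>)
    (alpha : rat) (halpha : 0 < alpha)
    (v : seq (nat * nat)) (hv : best_lower_approxs alpha v) :
  let D : {freeg (place iota) / rat} := << alpha *g oo >> in
  let gens := generators alpha v in
  let f := fun i : 'I_(size gens) => section_gen D t (nth (0, 0)%N gens i) in
  let I := relations f in
  exists G : seq {mpoly k[size gens]},
    [/\ groebner_basis I G,
        {in G, forall g, homogeneous g},
        perm_eq [seq lead_mon g | g <- G]
                [seq monom gens s | s <- leading_terms alpha v],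
        (* f_0^2 f_2^2 is never minimal, f_0 f_3^2 only below 3/4 *)
        {in G, forall g, minimal_relation I g <->
           lead_mon g <> monom gens [:: pt v 0; pt v 0; pt v 2; pt v 2] /\
           (lead_mon g = monom gens [:: pt v 0; pt v 3; pt v 3] ->
              theta alpha < 3 / 4)} &
        minimal_generating_set I (fun g => g \in G /\ minimal_relation I g)].
Proof.
move=> D gens f I.
have hp := pt_path halpha hv.
have [i0 [low_gens [low [[cd extremal] low_ge13E low_ge23E]]]] := exists_case halpha hv.
have hnf := normal_forms_of_cone_data halpha hv cd.
have leads := leads_gens hnf.
have size_gt1 M : M \in leading_terms alpha v -> (1 < size M)%N.
  by case/(leading_terms_size halpha hv) => [->|[_ ->]|[_ ->]].
have [|||G [gbG homG leadG minG genG]] :=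
  @exists_groebner_basis k K iota hC oo t ht alpha gens _ _ hnf (boxed alpha v) size_gt1.
- move=> w M s; apply: (normal_extremal hp cd extremal) => M' ML.
  by apply/size_gt1/(cd_LT cd); left.
- exact: (unboxed_lead_degree halpha hv leads (gens_uniq hnf)).
- by move=> M ML bM; apply: (boxed_lead_syzygy halpha hv leads (gens_uniq hnf) (cd_sorted cd)).
exists G; split => // g gG; rewrite (minG g gG) /boxed negb_or negb_and -ltNge.
split=> [/andP[/eqP ne cubic]|[/eqP -> cubic]].
  by split=> // E; move: cubic; rewrite E eqxx.
by case: eqP => //= /cubic.
Qed.
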